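(* Let $n\ge1$ and $D>0$. Assume that for every isotropic log-concave probability measure $\mu$ on $\mathbb{R}^n$ and every symmetric linear operator $M:\mathbb{R}^n\to\mathbb{R}^n$, \[ \operatorname{Var}_{Y\sim\mu}\left(\langle MY,Y\rangle\right)\le2D\operatorname{tr}(M^2). \] Let $\nu$ be a log-concave probability measure on $\mathbb{R}^n$, let $Z\sim\nu$, and denote $\Sigma:=\operatorname{Cov}(\nu)$. Then for every $\varepsilon\in(0,1)$, \[ \nu\left(|Z-\mathbb{E}Z|\le\varepsilon\sqrt{\operatorname{tr}\Sigma}\right)\le\exp\left\{-\frac{(\operatorname{tr}\Sigma)^2}{2D\,\operatorname{tr}(\Sigma^2)}\left(1-\varepsilon^2+\varepsilon^2\log\varepsilon^2\right)\right\}. \]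
   Context: $|\cdot|$ and $\langle\cdot,\cdot\rangle$ are the Euclidean norm and inner product on $\mathbb{R}^n$; $\operatorname{tr}$ is the trace. A log-concave probability measure on $\mathbb{R}^n$ is a probability measure having a density $f$ with respect to Lebesgue measure such that $\log f$ is concave. $\operatorname{Cov}(\mu)=\mathbb{E}(X-\mathbb{E}X)\otimes(X-\mathbb{E}X)$ for $X\sim\mu$; $\mu$ is isotropic if $\mathbb{E}X=0$ and $\operatorname{Cov}(\mu)=\operatorname{Id}$. The notation $\nu(|Z-\mathbb{E}Z|\le r)$ means the probability of the event $\{|Z-\mathbb{E}Z|\le r\}$. *)

(* Defs.v *)
From HB Require Import structures.
From mathcomp Require Import all_boot all_order all_algebra.
From mathcomp Require Import all_classical all_reals all_analysis.

Set Implicit Arguments.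
Unset Strict Implicit.
Unset Printing Implicit Defensive.

Import Order.TTheory GRing.Theory Num.Theory.

Local Open Scope classical_set_scope.
Local Open Scope ring_scope.

Definition measure_cV_display : measure_display -> measure_display.
Proof. exact. Qed.

(* The sigma-algebra on column vectors is the one generated by the
   coordinates, as the library does for tuples; on 'cV[R]_n with R : realType
   it is the Borel sigma-algebra of R^n. *)
Section measurable_cV.
Context d (T : sigmaRingType d) (n : nat).

Let coors : 'I_n -> 'cV[T]_n -> T := fun i x => x i ord0.

Let cV_set0 : g_sigma_preimage coors set0.
Proof. exact: sigma_algebra0. Qed.

Let cV_setC A : g_sigma_preimage coors A -> g_sigma_preimage coors (~` A).
Proof. exact: sigma_algebraC. Qed.

Let cV_bigcup (F : _^nat) : (forall i, g_sigma_preimage coors (F i)) ->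
  g_sigma_preimage coors (\bigcup_i (F i)).
Proof. exact: sigma_algebra_bigcup. Qed.

HB.instance Definition _ := @isMeasurable.Build (measure_cV_display d)
  'cV[T]_n (g_sigma_preimage coors) cV_set0 cV_setC cV_bigcup.

End measurable_cV.

Lemma measurable_coord_cV d (T : sigmaRingType d) n (i : 'I_n) :
  measurable_fun [set: 'cV[T]_n] (fun x => x i ord0).
Proof.
move=> _ Y mY; rewrite setTI; apply: sub_sigma_algebra => /=.
rewrite -bigcup_seq/=; exists i => /=; first by rewrite mem_index_enum.
by exists Y => //; rewrite setTI.
Qed.

Lemma measurable_fun_cVP d1 d2 (T1 : measurableType d1)
    (T2 : measurableType d2) n (f : T1 -> 'cV[T2]_n) :
  (forall i, measurable_fun [set: T1] (fun x => f x i ord0)) ->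
  measurable_fun [set: T1] f.
Proof.
move=> mf _ A; rewrite setTI => mA.
suff : measurable `<=` [set B | measurable (f @^-1` B)] by exact.
apply: smallest_sub; first split => /=.
- by rewrite preimage_set0; exact: measurable0.
- by move=> B mB; rewrite setTD preimage_setC; exact: measurableC.
- by move=> F mF; rewrite preimage_bigcup; exact: bigcupT_measurable.
- rewrite -bigcup_seq/=; apply: bigcup_sub => i _ _ [B mB <-] /=.
  by rewrite setTI; have := mf i measurableT _ mB; rewrite setTI.
Qed.

Section cons_cV.
Context (T : Type) (n : nat).

Definition cons_cV (p : T * 'cV[T]_n) : 'cV[T]_n.+1 :=
  \col_i oapp (fun j => p.2 j ord0) p.1 (unlift ord0 i).

Definition uncons_cV (x : 'cV[T]_n.+1) : T * 'cV[T]_n :=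
  (x ord0 ord0, \col_j x (lift ord0 j) ord0).

Lemma cons_cVK : cancel cons_cV uncons_cV.
Proof.
case=> a v; rewrite /uncons_cV mxE unlift_none/=; congr pair.
by apply/colP => j; rewrite !mxE liftK.
Qed.

End cons_cV.

(* lebesgue_measure lives on measurableTypeR R, whose sigma-algebra is the
   canonical one of R, but under another display. *)
Section measurable_cons_cV.
Context (R : realType) (n : nat).

Lemma measurable_cons_cV :
  measurable_fun [set: measurableTypeR R * 'cV[R]_n] (@cons_cV R n).
Proof.
apply: measurable_fun_cVP => i.
under eq_fun do rewrite mxE.
case: unliftP => [j _|_] /=.
  apply: (measurableT_comp (f := fun v : 'cV[R]_n => v j ord0)) => //.
  exact: measurable_coord_cV.
move=> _ B mB.
exact: (@measurable_fst _ _ (measurableTypeR R) 'cV[R]_n measurableT B mB).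
Qed.

Lemma measurable_uncons_cV :
  measurable_fun [set: 'cV[R]_n.+1]
    (@uncons_cV R n : 'cV[R]_n.+1 -> measurableTypeR R * 'cV[R]_n).
Proof.
apply/measurable_fun_pairP; split.
  by move=> _ B mB; exact: (@measurable_coord_cV _ R _ ord0 measurableT B mB).
apply: measurable_fun_cVP => i /=.
under eq_fun do rewrite mxE.
exact: measurable_coord_cV.
Qed.

End measurable_cons_cV.

(* The library proves this, but leaves it out of reach of inference: the
   instance on products of subprobabilities takes precedence. *)
Lemma product_measure1_sigma_finite d1 d2 (T1 : measurableType d1)
    (T2 : measurableType d2) (R : realType)
    (m1 : {sigma_finite_measure set T1 -> \bar R})
    (m2 : {sigma_finite_measure set T2 -> \bar R}) :
  sigma_finite setT (m1 \x m2)%E.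
Proof.
have /sigma_finiteP[F [TF ndF Foo]] := sigma_finiteT m1.
have /sigma_finiteP[G [TG ndG Goo]] := sigma_finiteT m2.
exists (fun n => F n `*` G n).
  rewrite -setXTT TF TG predeqE => -[x y]; split.
    move=> [/= [n _ Fnx] [k _ Gky]]; exists (maxn n k) => //; split.
    - by move: x Fnx; exact/subsetPset/ndF/leq_maxl.
    - by move: y Gky; exact/subsetPset/ndG/leq_maxr.
  by move=> [n _ []/= ? ?]; split; exists n.
move=> k; have [? ?] := Foo k; have [? ?] := Goo k.
split; first exact: measurableX.
by rewrite product_measure1E// lte_mul_pinfty// ge0_fin_numE.
Qed.

Section lebesgue_cons.
Context (R : realType) (n : nat).
Variable mu : {sigma_finite_measure set 'cV[R]_n -> \bar R}.

Definition lebesgue_cons : set 'cV[R]_n.+1 -> \bar R :=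
  pushforward (@lebesgue_measure R \x mu)%E (@cons_cV R n).

Let lebesgue_cons0 : lebesgue_cons set0 = 0%E.
Proof. by rewrite /lebesgue_cons /pushforward preimage_set0 measure0. Qed.

Let lebesgue_cons_ge0 A : (0 <= lebesgue_cons A)%E.
Proof. by apply: integral_ge0. Qed.

Let lebesgue_cons_sigma_additive : semi_sigma_additive lebesgue_cons.
Proof.
exact: (@measure_semi_sigma_additive _ _ _
  (measure_function_pushforward__canonical__measure_function_Measure
     (@lebesgue_measure R \x mu)%E (@measurable_cons_cV R n))).
Qed.

HB.instance Definition _ := isMeasure.Build _ _ _ lebesgue_cons
  lebesgue_cons0 lebesgue_cons_ge0 lebesgue_cons_sigma_additive.

Let lebesgue_cons_sigma_finite : sigma_finite setT lebesgue_cons.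
Proof.
have [F FT mF] : sigma_finite setT (@lebesgue_measure R \x mu)%E.
  exact: product_measure1_sigma_finite.
exists (fun k => @uncons_cV R n @^-1` F k).
  by rewrite -preimage_bigcup -FT preimage_setT.
move=> k; have [mFk Fkoo] := mF k; split.
  by rewrite -[X in measurable X]setTI; exact: measurable_uncons_cV.
rewrite /lebesgue_cons /pushforward -comp_preimage.
rewrite (_ : uncons_cV (n:=n) \o cons_cV (n:=n) = id)//.
by apply/funext => p /=; rewrite cons_cVK.
Qed.

HB.instance Definition _ := Measure_isSigmaFinite.Build _ _ _ lebesgue_cons
  lebesgue_cons_sigma_finite.

End lebesgue_cons.

(* Lebesgue measure on R^n: the unit mass on the one-point space R^0, and
   R^(n+1) identified with R * R^n. *)
Fixpoint lebesgue_cV (R : realType) (n : nat) :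
    {sigma_finite_measure set 'cV[R]_n -> \bar R} :=
  match n with
  | 0 => \d_(0 : 'cV[R]_0)
  | n'.+1 => lebesgue_cons (lebesgue_cV R n')
  end.

Lemma lebesgue_cV_box (R : realType) (n : nat) (A : 'I_n -> set R) :
  (forall i, measurable (A i)) ->
  lebesgue_cV R n [set x | forall i, A i (x i ord0)] =
  (\prod_(i < n) lebesgue_measure (A i))%E.
Proof.
elim: n A => [|n ih] A mA.
  rewrite big_ord0 /= diracE mem_set//.
  by case.
have mB : measurable [set x : 'cV[R]_n | forall i, A (lift ord0 i) (x i ord0)].
  suff -> : [set x : 'cV[R]_n | forall i, A (lift ord0 i) (x i ord0)] =
      \bigcap_(i in [set: 'I_n]) [set x | A (lift ord0 i) (x i ord0)].
    apply: fin_bigcap_measurable => [|i _]; first exact: finite_finset.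
    by rewrite -[X in measurable X]setTI; exact: measurable_coord_cV.
  by apply/seteqP; split => x /= h i; [move=> _; exact: h|exact: (h i I)].
rewrite big_ord_recl -ih//= /lebesgue_cons /pushforward -product_measure1E//;
  last exact: (mA ord0).
congr (_ _); apply/seteqP; split => -[a v] /=.
  move=> h; split=> [|i]; first by have := h ord0; rewrite mxE unlift_none.
  by have := h (lift ord0 i); rewrite mxE liftK.
by move=> [h0 h] i; rewrite mxE; case: unliftP => [j ->|->].
Qed.

Section euclidean.
Context (R : realType) (n : nat).
Implicit Types x y : 'cV[R]_n.

Definition inner x y : R := \sum_(i < n) x i ord0 * y i ord0.

Definition enorm x : R := Num.sqrt (inner x x).

End euclidean.

(* For g with values in [-oo, +oo[; at t = 0 and t = 1 the convention
   0 * -oo = 0 makes the inequality trivial. *)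
Definition concave_ereal (R : realType) (E : lmodType R) (g : E -> \bar R) :=
  forall (x y : E) (t : R), 0 <= t <= 1 ->
    ((1 - t)%:E * g x + t%:E * g y <= g ((1 - t) *: x + t *: y)%R)%E.

Section log_concave.
Context (R : realType) (n : nat).
Implicit Types (f : 'cV[R]_n -> R) (mu : probability 'cV[R]_n R).

Definition is_density mu f :=
  [/\ measurable_fun setT f,
      forall x, 0 <= f x &
      forall A, measurable A ->
        mu A = (\int[lebesgue_cV R n]_(x in A) (f x)%:E)%E].

(* lne is the extended logarithm, with lne 0 = -oo: densities may vanish. *)
Definition log_concave mu :=
  exists2 f, is_density mu f & concave_ereal (fun x => lne (f x)%:E).

(* Log-concave measures have finite moments, so fine loses nothing. *)
Definition mean mu : 'cV[R]_n :=
  \col_i fine 'E_mu[fun x : 'cV[R]_n => x i ord0].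

Definition Cov mu : 'M[R]_n :=
  \matrix_(i, j) fine (covariance mu (fun x : 'cV[R]_n => x i ord0)
                                     (fun x : 'cV[R]_n => x j ord0)).

Definition isotropic mu := mean mu = 0 /\ Cov mu = 1%:M.

End log_concave.

(* Main.v *)
Require Import Defs.
From HB Require Import structures.
From mathcomp Require Import all_boot all_order all_algebra.
From mathcomp Require Import all_classical all_reals all_analysis.
From mathcomp Require Import measurable_realfun fingroup perm ring lra.

Set Implicit Arguments.
Unset Strict Implicit.
Unset Printing Implicit Defensive.

Import Order.TTheory GRing.Theory Num.Theory.
Import numFieldNormedType.Exports.

Local Open Scope classical_set_scope.
Local Open Scope ring_scope.

(** Why the theorem holds.  Let [g] and [Sigma] be the mean and the covariance
    matrix of [Z], [m = tr Sigma], [q = tr Sigma^2], and let [k > 2 D].  The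
    core of the proof is the Laplace transform bound
    [E exp(- s |Z - g|^2) <= det(1 + k s Sigma)^(-1/k)] for [s > 0].
    Its right-hand side is at most
    [exp(- m^2/(k q) ln(1 + k s q/m))], by Cauchy-Schwarz for the trace along
    the path [s |-> 1 + s Sigma] ([ln_det_ge]).  Markov's inequality with
    [1 + k s q/m = 1/u], [u = eps^2], then bounds the small-ball probability by
    [exp(m^2/(k q) (1 - u + ln u))], which is at most
    [exp(- m^2/(k q) (1 - u + u ln u))], because
    [2 (1 - u) + (1 + u) ln u <= 0] for [0 < u <= 1].  It remains to let [k]
    tend to [2 D].

    For the Laplace transform consider, with [z = x - g], the weights
    [w(b,B) = <b,z> - s |z|^2 + <Bz,z>], where [b] is a vector and
    [0 <= B <= s] a symmetric matrix.  They are concave, so [exp(w)] times the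
    law of [Z] is proportional to a log-concave law; an affine map makes it
    isotropic, and the hypothesis applied there says that, if [a] and [A] are
    the mean and the covariance of [z] under the tilted law and [N] is
    symmetric, then the variance of [<N(z - a), z - a>] is at most
    [2 D tr(N A N A)] ([normalized_law], [var_quad_tilted]).  Put, [g0] being
    the mean of [z] for the weight [w(0,0)],
    [Phi(b,B) = exp(k (<b,g0> + 2 <Ba,g0> - <Ba,a> - ln E e^w)) det(1 + k B A)].
    At [b = 0], [B = s] the weight vanishes and, [z] being centred,
    [Phi = det(1 + k s Sigma)]; at [B = 0], Jensen's inequality gives
    [Phi <= (E exp(- s |z|^2))^(-k)].  So it is enough that [Phi] has a maximum
    and that [B = 0] there.

    A maximum exists by compactness, as [Phi] is small for large [b]
    ([Phi_coercive]).  Suppose [B <> 0] at a maximum, and let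
    [N = (B^-1 + k A)^-1].  The derivative of [ln Phi / k] in the direction
    [(2 N a, - N)] is [k tr(N A N A) - Var <N(z - a), z - a> - 2 C] with [C] the
    covariance of [<B(g0 - a), z>] and [<N(z - a), z - a>], and stationarity in
    the direction [(B(g0 - a), 0)] forces [C <= 0].  As [k > 2 D], this
    derivative is positive, although [B - h N] remains between [0] and [s] for
    [0 <= h <= 1]: a contradiction ([Phi_increase], [exp_moment_le]).

    Differentiating under the integral sign is immediate for bounded functions,
    so all of this is carried out for the law of [Z] conditioned to a cube.
    The variance bound for [<Nz,z> = z_i^2] gives [E X^4 <= C (E X^2)^2] for
    each coordinate [X], with [C] independent of the cube; together with
    tightness this bounds the second moments over all cubes
    ([second_moment_le]), and dominated convergence transfers the Laplace
    transform bound to the law of [Z] ([exp_moment_law]). *)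

(** * Inner products and positive matrices *)

Section inner_product.
Context (R : realType) (n : nat).
Implicit Types (x y z : 'cV[R]_n) (A B : 'M[R]_n).

Lemma innerE x y : inner x y = (x^T *m y) ord0 ord0.
Proof. by rewrite mxE; apply: eq_bigr => i _; rewrite mxE. Qed.

Lemma innerC x y : inner x y = inner y x.
Proof. by apply: eq_bigr => i _; rewrite mulrC. Qed.

Lemma innerDl x y z : inner (x + y) z = inner x z + inner y z.
Proof. by rewrite -big_split; apply: eq_bigr => i _; rewrite mxE mulrDl. Qed.

Lemma innerNl x y : inner (- x) y = - inner x y.
Proof. by rewrite -sumrN; apply: eq_bigr => i _; rewrite mxE mulNr. Qed.

Lemma innerZl c x y : inner (c *: x) y = c * inner x y.
Proof. by rewrite mulr_sumr; apply: eq_bigr => i _; rewrite mxE mulrA. Qed.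

Lemma innerBl x y z : inner (x - y) z = inner x z - inner y z.
Proof. by rewrite innerDl innerNl. Qed.

Lemma innerDr x y z : inner z (x + y) = inner z x + inner z y.
Proof. by rewrite innerC innerDl !(innerC z). Qed.

Lemma innerNr x y : inner y (- x) = - inner y x.
Proof. by rewrite innerC innerNl innerC. Qed.

Lemma innerZr c x y : inner y (c *: x) = c * inner y x.
Proof. by rewrite innerC innerZl innerC. Qed.

Lemma innerBr x y z : inner z (x - y) = inner z x - inner z y.
Proof. by rewrite innerDr innerNr. Qed.

Lemma inner0l x : inner 0 x = 0.
Proof. by rewrite -(scale0r 0) innerZl mul0r. Qed.

Lemma inner0r x : inner x 0 = 0.
Proof. by rewrite innerC inner0l. Qed.

Lemma inner_ge0 x : 0 <= inner x x.
Proof. by apply: sumr_ge0 => i _; rewrite -expr2 sqr_ge0. Qed.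

Lemma inner_eq0 x : (inner x x == 0) = (x == 0).
Proof.
apply/idP/eqP => [|->]; last by rewrite inner0l.
rewrite psumr_eq0 => [/allP h|i _]; last by rewrite -expr2 sqr_ge0.
apply/colP => i; rewrite mxE; apply/eqP.
by have := h i (mem_index_enum _); rewrite -expr2 sqrf_eq0.
Qed.

Lemma inner_mull A x y : inner (A *m x) y = inner x (A^T *m y).
Proof. by rewrite !innerE trmx_mul mulmxA. Qed.

Lemma inner_sym A x y : A^T = A -> inner (A *m x) y = inner (A *m y) x.
Proof. by move=> sA; rewrite inner_mull sA innerC. Qed.

Lemma inner_mulmxE A x y :
  inner (A *m x) y = \sum_i \sum_j A i j * x j ord0 * y i ord0.
Proof. by apply: eq_bigr => i _; rewrite mxE mulr_suml. Qed.

Lemma mxtrace_mulE A B : \tr (A *m B) = \sum_i \sum_j A i j * B j i.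
Proof. by apply: eq_bigr => i _; rewrite mxE. Qed.

End inner_product.

Section positive_matrices.
Context (R : realType).

Definition psd n (A : 'M[R]_n) :=
  A^T = A /\ forall w : 'cV[R]_n, 0 <= inner (A *m w) w.

Definition posdef n (A : 'M[R]_n) :=
  A^T = A /\ forall w : 'cV[R]_n, w != 0 -> 0 < inner (A *m w) w.

Lemma posdef_psd n (A : 'M[R]_n) : posdef A -> psd A.
Proof.
case=> sA hA; split=> // w; have [->|w0] := eqVneq w 0; last exact/ltW/hA.
by rewrite mulmx0 inner0l.
Qed.

Lemma posdef1 n : posdef (1%:M : 'M[R]_n).
Proof.
split=> [|w w0]; first by rewrite trmx1.
by rewrite mul1mx lt_neqAle eq_sym inner_eq0 w0 inner_ge0.
Qed.

Lemma posdefD n (A B : 'M[R]_n) : posdef A -> psd B -> posdef (A + B).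
Proof.
move=> [sA hA] [sB hB]; split=> [|w w0]; first by rewrite linearD/= sA sB.
by rewrite mulmxDl innerDl ltr_pwDl// hA.
Qed.

Lemma psdZ n c (A : 'M[R]_n) : 0 <= c -> psd A -> psd (c *: A).
Proof.
move=> c0 [sA hA]; split=> [|w]; first by rewrite linearZ/= sA.
by rewrite -scalemxAl innerZl mulr_ge0.
Qed.

Lemma psd_congr m n (A : 'M[R]_n) (B : 'M[R]_(n, m)) :
  psd A -> psd (B^T *m A *m B).
Proof.
move=> [sA hA]; split=> [|w].
  by rewrite !trmx_mul trmxK sA mulmxA.
rewrite (_ : inner _ _ = inner (A *m (B *m w)) (B *m w)) ?hA//.
by rewrite !innerE !trmx_mul !trmxK !mulmxA.
Qed.

Lemma psd_trace_ge0 n (A : 'M[R]_n) : psd A -> 0 <= \tr A.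
Proof.
move=> [_ hA]; apply: sumr_ge0 => i _.
have := hA (delta_mx i ord0); rewrite inner_mulmxE (bigD1 i)//= (bigD1 i)//=.
rewrite !mxE !eqxx !mulr1 [X in _ + X + _]big1 => [|j ji]; last first.
  by rewrite !mxE (negbTE ji) mulr0 mul0r.
rewrite [X in _ + X]big1 ?addr0// => j ji.
by rewrite big1// => k _; rewrite !mxE (negbTE ji) mulr0.
Qed.

(** A triangular square root is what makes the change of variables below a
    Fubini argument.  By induction on the dimension, through the Schur
    complement of the first diagonal entry. *)
Lemma posdef_Cholesky n (A : 'M[R]_n) : posdef A ->
  exists L : 'M[R]_n, [/\ is_trig_mx L, forall i, 0 < L i i & A = L *m L^T].
Proof.
elim: n A => [|n ih] A [sA hA].
  exists A; split; [by apply/is_trig_mxP => -[]|by case|].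
  by apply/matrixP => -[].
rewrite -[n.+1]/(1 + n)%N in A sA hA *.
pose a : R := A ord0 ord0; pose v : 'cV[R]_n := dlsubmx A; pose B := drsubmx A.
have ulA : ulsubmx A = a%:M.
  by apply/matrixP => i j; rewrite !ord1 !mxE/= mulr1n; congr (A _ _); apply/val_inj.
have urA : ursubmx A = v^T by rewrite /v trmx_dlsub sA.
have sB : B^T = B by rewrite /B trmx_drsub sA.
have AE : A = block_mx a%:M v^T v B by rewrite -ulA -urA submxK.
have qE (t : R) (w : 'cV[R]_n) :
    inner (A *m col_mx t%:M w) (col_mx t%:M w) =
    a * t ^+ 2 + 2 * t * inner v w + inner (B *m w) w.
  rewrite innerC innerE AE mul_block_col tr_col_mx mul_row_col.
  rewrite tr_scalar_mx !mul_scalar_mx !mulmxDr mul_mx_scalar -scalemxAr.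
  have addE (X Y : 'M[R]_1) : (X + Y) ord0 ord0 = X ord0 ord0 + Y ord0 ord0.
    by rewrite mxE.
  have scaleE c (X : 'M[R]_1) : (c *: X) ord0 ord0 = c * X ord0 ord0 by rewrite mxE.
  rewrite !(addE, scaleE) -!innerE mxE eqxx mulr1n (innerC w v) (innerC w).
  by ring.
have a0 : 0 < a.
  have := hA (col_mx 1%:M 0); rewrite qE inner0r mulmx0 inner0l !addr0 expr1n mulr1 mulr0 addr0.
  apply; apply/eqP => /(congr1 (fun M : 'cV_(1 + n) => usubmx M ord0 ord0)).
  by rewrite col_mxKu linear0 !mxE/= => /eqP; rewrite oner_eq0.
have pS : posdef (B - a^-1 *: (v *m v^T)).
  split=> [|w w0].
    by rewrite linearB/= linearZ/= sB trmx_mul trmxK.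
  have := hA (col_mx (- a^-1 * inner v w)%:M w); rewrite qE => hq.
  have {hq} := hq _; rewrite mulmxBl innerBl -scalemxAl innerZl.
  have -> : inner (v *m v^T *m w) w = inner v w ^+ 2.
    rewrite innerE !trmx_mul trmxK -!mulmxA mulmxA mxE big_ord1 -!innerE.
    by rewrite innerC expr2.
  set x := inner v w; set y := inner (B *m w) w => hq.
  have -> : y - a^-1 * x ^+ 2 =
     a * (- a^-1 * x) ^+ 2 + 2 * (- a^-1 * x) * x + y by field; rewrite gt_eqF.
  apply: hq; apply: contra w0 => /eqP/(congr1 (@dsubmx _ 1 n 1)).
  by rewrite col_mxKd linear0 => ->.
have [L [tL dL SE]] := ih _ pS.
exists (block_mx (Num.sqrt a)%:M 0 ((Num.sqrt a)^-1 *: v) L); split.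
- apply/is_trig_mxP => i j.
  case: (split_ordP i) => i' ->; case: (split_ordP j) => j' -> /=; rewrite ?ord1/=.
  + by [].
  + by rewrite block_mxEur mxE.
  + by [].
  + rewrite block_mxEdr ltn_add2l => ij.
    exact: (is_trig_mxP tL).
- move=> i; case: (split_ordP i) => i' ->.
    by rewrite ord1 block_mxEul mxE eqxx mulr1n sqrtr_gt0.
  by rewrite block_mxEdr.
- rewrite tr_block_mx mulmx_block AE linear0 !mulmx0 !mul0mx !addr0.
  rewrite tr_scalar_mx linearZ/= !mul_scalar_mx !mul_mx_scalar !scalerA.
  rewrite mulfV ?gt_eqF ?sqrtr_gt0// !scale1r scale_scalar_mx -expr2 sqr_sqrtr ?ltW//.
  rewrite -scalemxAl -scalemxAr scalerA -expr2 exprVn sqr_sqrtr ?ltW//.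
  by rewrite -SE addrC subrK.
Qed.

Lemma posdef_det_gt0 n (A : 'M[R]_n) : posdef A -> 0 < \det A.
Proof.
move=> /posdef_Cholesky[L [tL dL ->]].
by rewrite det_mulmx det_tr -expr2 exprn_gt0// det_trig// prodr_gt0.
Qed.

(** * The resolvent of two positive matrices *)

Section resolvent.
Context (n : nat) (A B : 'M[R]_n) (d : R).
Hypotheses (pA : posdef A) (pB : psd B) (d0 : 0 < d).

Let Q : 'M[R]_n := 1%:M + d *: (B *m A).

(** This is [(B^-1 + d A)^-1], written without inverting [B], which may be
    singular; it is the direction in which the potential below is followed. *)
Definition resolvent : 'M[R]_n := invmx Q *m B.

(** With [A = L L^T], the determinant equals that of the symmetric matrix
    [1 + d L^T B L]. *)
Lemma resolvent_det_gt0 : 0 < \det Q.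
Proof.
have [L [tL dL AE]] := posdef_Cholesky pA.
have dL0 : 0 < \det L by rewrite det_trig// prodr_gt0.
have h : \det L^T * \det Q = \det (1%:M + d *: (L^T *m B *m L)) * \det L^T.
  rewrite -!det_mulmx; congr (\det _).
  by rewrite mulmxDr mulmxDl mulmx1 mul1mx -scalemxAr -scalemxAl AE !mulmxA.
have : 0 < \det (1%:M + d *: (L^T *m B *m L)).
  by apply/posdef_det_gt0/posdefD; [exact: posdef1|exact/psdZ/psd_congr/pB/ltW].
move: h; rewrite det_tr mulrC => /(mulIf (lt0r_neq0 dL0)) -> //.
Qed.

Let uQ : Q \in unitmx.
Proof. by rewrite unitmxE unitfE gt_eqF// resolvent_det_gt0. Qed.

Let uQT : Q^T \in unitmx. Proof. by rewrite unitmx_tr. Qed.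

Let QTE : Q^T = 1%:M + d *: (A *m B).
Proof. by rewrite linearD linearZ/= trmx1 trmx_mul pA.1 pB.1. Qed.

Let resolventE : resolvent = B *m invmx Q^T.
Proof.
have QB : Q *m B = B *m Q^T.
  by rewrite QTE mulmxDr mulmx1 mulmxDl mul1mx -scalemxAl -scalemxAr !mulmxA.
by rewrite /resolvent -[in LHS](mulmxK uQT B) -QB -!mulmxA mulKmx.
Qed.

(* Every vector is of the form [Q^T *m v], and then [N *m w = B *m v]. *)
Let resolvent_mul (v : 'cV[R]_n) : resolvent *m (Q^T *m v) = B *m v.
Proof. by rewrite resolventE -mulmxA mulKmx. Qed.

Lemma resolvent_psd : psd resolvent.
Proof.
split=> [|w].
  by rewrite {1}resolventE trmx_mul -trmx_inv trmxK pB.1.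
rewrite -(mulKVmx uQT w); set v := invmx _ *m w.
rewrite resolvent_mul QTE mulmxDl mul1mx -scalemxAl innerDr innerZr.
rewrite addr_ge0// ?pB.2// mulr_ge0 ?(ltW d0)// innerC -mulmxA.
exact: (posdef_psd pA).2.
Qed.

Lemma resolvent_le : psd (B - resolvent).
Proof.
split=> [|w]; first by rewrite linearB/= pB.1 resolvent_psd.1.
rewrite -(mulKVmx uQT w); set v := invmx _ *m w.
rewrite mulmxBl resolvent_mul QTE mulmxDl mul1mx mulmxDr [_ + _ - _]addrAC subrr add0r.
rewrite -!scalemxAl -!scalemxAr -!mulmxA innerZl innerDr innerZr.
rewrite mulr_ge0 ?(ltW d0)// addr_ge0//; last by rewrite mulr_ge0 ?(ltW d0)// pB.2.
rewrite inner_mull pB.1; exact: (posdef_psd pA).2.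
Qed.

(** Both traces come from the derivative of the potential, the first from the
    normalising constant and the second from the determinant; their difference
    is the term that the variance of the quadratic form has to beat. *)
Lemma resolvent_trace :
  \tr (resolvent *m A) - \tr (invmx Q *m (resolvent *m A)) =
  d * \tr (resolvent *m A *m resolvent *m A).
Proof.
rewrite -linearB/= -[X in X - _]mul1mx -mulmxBl.
have -> : 1%:M - invmx Q = d *: (resolvent *m A).
  rewrite -[X in X - _](mulVmx uQ) -[X in _ - X]mulmx1 -mulmxBr /Q addrAC subrr add0r.
  by rewrite -scalemxAr mulmxA.
by rewrite -scalemxAl linearZ/= !mulmxA.
Qed.

(** The trace is the squared Hilbert-Schmidt norm of [L^T N L], where
    [A = L L^T] and [N] is the resolvent. *)
Lemma resolvent_trace_gt0 :
  B != 0 -> 0 < \tr (resolvent *m A *m resolvent *m A).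
Proof.
have [L [tL dL AE]] := posdef_Cholesky pA.
have uL : L \in unitmx.
  by rewrite unitmxE unitfE gt_eqF// det_trig// prodr_gt0.
move=> B0; pose Y := L^T *m resolvent *m L.
have sY : Y^T = Y.
  by rewrite trmx_mul [(L^T *m _)^T]trmx_mul trmxK resolvent_psd.1 mulmxA.
have -> : \tr (resolvent *m A *m resolvent *m A) = \tr (Y *m Y).
  by rewrite AE /Y !mulmxA mxtrace_mulC !mulmxA.
have YE : \tr (Y *m Y) = \sum_i \sum_j Y i j ^+ 2.
  rewrite mxtrace_mulE; apply: eq_bigr => i _; apply: eq_bigr => j _.
  have : Y j i = Y i j by rewrite -[in LHS]sY mxE.
  by move=> ->; rewrite expr2.
rewrite YE lt_neqAle sumr_ge0 ?andbT; last first.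
  by move=> i _; apply: sumr_ge0 => j _; exact: sqr_ge0.
apply: contra B0; rewrite eq_sym psumr_eq0; last first.
  by move=> i _; apply: sumr_ge0 => j _; exact: sqr_ge0.
move=> /allP Y0.
have {}Y0 : Y = 0.
  apply/matrixP => i j; have := Y0 i (mem_index_enum _).
  rewrite implyTb psumr_eq0 => [/allP/(_ j (mem_index_enum _))|k _]; last exact: sqr_ge0.
  by rewrite implyTb sqrf_eq0 => /eqP ->; rewrite [RHS]mxE.
have : Q *m (invmx L^T *m Y *m invmx L) = B.
  rewrite /Y !mulmxA mulmxK// -[X in X *m _ *m _]mulmxA.
  by rewrite -!mulmxA mulKmx ?unitmx_tr// mulKVmx.
by rewrite Y0 mulmx0 mul0mx mulmx0 => <-.
Qed.

End resolvent.

End positive_matrices.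

(** * Derivatives of real functions and of determinants *)

(** The usual rules in pointwise form, so that they compose by unification. *)
Section real_derivatives.
Context (R : realType).
Implicit Types (f g : R -> R) (a b c t : R).

Lemma is_derive1D f g t a b : is_derive t 1 f a -> is_derive t 1 g b ->
  is_derive t 1 (fun x => f x + g x) (a + b).
Proof. exact: is_deriveD. Qed.

Lemma is_derive1B f g t a b : is_derive t 1 f a -> is_derive t 1 g b ->
  is_derive t 1 (fun x => f x - g x) (a - b).
Proof. exact: is_deriveB. Qed.

Lemma is_derive1M f g t a b : is_derive t 1 f a -> is_derive t 1 g b ->
  is_derive t 1 (fun x => f x * g x) (a * g t + f t * b).
Proof.
move=> df dg; apply: is_derive_eq (is_deriveM df dg) _.
by rewrite addrC [_ *: a]mulrC.
Qed.

Lemma is_derive1Z f c t a : is_derive t 1 f a ->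
  is_derive t 1 (fun x => c * f x) (c * a).
Proof. exact: is_deriveZ. Qed.

Lemma is_derive1C c t : is_derive t 1 (fun _ : R => c) 0.
Proof. exact: is_derive_cst. Qed.

Lemma is_derive1I t : is_derive t 1 (fun x : R => x) 1.
Proof. exact: is_derive_id. Qed.

Lemma is_derive1_sum (I : Type) (s : seq I) (F : I -> R -> R) (dF : I -> R) t :
  (forall i, is_derive t 1 (F i) (dF i)) ->
  is_derive t 1 (fun x => \sum_(i <- s) F i x) (\sum_(i <- s) dF i).
Proof.
move=> h; elim: s => [|i s ih].
  under eq_fun do rewrite big_nil.
  by rewrite big_nil; exact: is_derive1C.
under eq_fun do rewrite big_cons.
by rewrite big_cons; exact: is_derive1D.
Qed.

Lemma is_derive1_prod n (F : 'I_n -> R -> R) (dF : 'I_n -> R) t :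
  (forall i, is_derive t 1 (F i) (dF i)) ->
  is_derive t 1 (fun x => \prod_i F i x)
    (\sum_i \prod_j (if j == i then dF i else F j t)).
Proof.
elim: n F dF => [|n ih] F dF h.
  under eq_fun do rewrite big_ord0.
  by rewrite big_ord0; exact: is_derive1C.
under eq_fun do rewrite big_ord_recl.
have dg := ih (fun i => F (lift ord0 i)) _ (fun i => h (lift ord0 i)).
refine (is_derive_eq (is_derive1M (h ord0) dg) _).
rewrite [RHS]big_ord_recl; congr (_ + _).
  by rewrite big_ord_recl eqxx.
rewrite mulr_sumr; apply: eq_bigr => i _.
by rewrite [RHS]big_ord_recl.
Qed.

End real_derivatives.

Section determinant.
Context (R : realType).

(* At the identity only the identity permutation contributes: any other one
   moves at least two indices, and one of its two zero factors survives. *)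
Let is_derive_det1 n (E : R -> 'M[R]_n) (dE : 'M[R]_n) (t : R) :
  (forall i j, is_derive t 1 (fun x => E x i j) (dE i j)) -> E t = 1%:M ->
  is_derive t 1 (fun x => \det (E x)) (\tr dE).
Proof.
move=> h E1.
refine (is_derive_eq (is_derive1_sum _ (fun s : 'S_n => is_derive1Z _
  (is_derive1_prod (fun i => h i (s i))))) _).
rewrite /= (bigD1 (1%g : 'S_n))//= odd_perm1 expr0 mul1r [X in _ + X]big1 ?addr0.
  apply: eq_bigr => i _; rewrite perm1 (bigD1 i)//= eqxx big1 ?mulr1// => j ji.
  by rewrite (negbTE ji) E1 perm1 mxE eqxx.
move=> s s1; have [i0 si0] : exists i0, s i0 != i0.
  apply/existsP; apply: contraR s1; rewrite negb_exists => /forallP h1.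
  by apply/eqP/permP => i; rewrite perm1; apply/eqP; have := h1 i; rewrite negbK.
rewrite big1 ?mulr0// => i _.
have zero j : j != i -> s j != j -> \prod_k (if k == i then dE i (s i) else E t k (s k)) = 0.
  move=> ji sj; rewrite (bigD1 j)//= (negbTE ji) E1 mxE eq_sym (negbTE sj).
  by rewrite mul0r.
have [ii0|ii0] := eqVneq i0 i; last exact: (zero i0).
apply: (zero (s i0)); first by rewrite -ii0.
by rewrite (inj_eq perm_inj).
Qed.

(** Jacobi's formula: multiplying by [invmx (M t)] reduces it to a derivative at
    the identity matrix, which is the trace. *)
Lemma is_derive_det n (M : R -> 'M[R]_n) (dM : 'M[R]_n) (t : R) :
  (forall i j, is_derive t 1 (fun x => M x i j) (dM i j)) ->
  M t \in unitmx ->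
  is_derive t 1 (fun x => \det (M x)) (\det (M t) * \tr (invmx (M t) *m dM)).
Proof.
move=> h uM.
have -> : (fun x => \det (M x)) = (fun x => \det (M t) * \det (invmx (M t) *m M x)).
  by apply/funext => x; rewrite -det_mulmx mulKVmx.
apply: is_derive1Z; apply: is_derive_det1; last exact: mulVmx.
move=> i j; under eq_fun do rewrite mxE.
by rewrite mxE; apply: is_derive1_sum => k; apply: is_derive1Z.
Qed.

Lemma continuous_det (T : topologicalType) n (M : T -> 'M[R]_n) :
  (forall i j, continuous (fun x => M x i j)) ->
  continuous (fun x => \det (M x)).
Proof.
move=> h; rewrite /determinant.
apply: (@continuous_big R _ +%R 0 xpredT (@add_continuous R) T (index_enum {perm 'I_n})
  (fun s x => (-1) ^+ s * \prod_i M x i (s i))) => s _.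
have hp : continuous (fun x => \prod_i M x i (s i)).
  exact: (@continuous_big R _ *%R 1 xpredT (@mul_continuous R) T _
    (fun i x => M x i (s i))).
by move=> x; apply: cvgM; [exact: cvg_cst|exact: hp].
Qed.

Lemma det_le n (M : 'M[R]_n) c : (forall i j, `|M i j| <= c) ->
  \det M <= c ^+ n *+ #|{perm 'I_n}|.
Proof.
move=> h; rewrite -sumr_const; apply: ler_sum => s _.
apply: (le_trans (ler_norm _)); rewrite normrM normr_sign mul1r normr_prod.
rewrite -[n in c ^+ n]card_ord -prodr_const.
by apply: ler_prod => i _; rewrite normr_ge0 h.
Qed.

(** Along [s |-> 1 + s A] the logarithmic derivative of the determinant is
    [tr (A (1 + s A)^-1)], and the Cauchy-Schwarz inequality for the trace
    bounds it below by [m^2 / (m + s q)], [m = tr A], [q = tr A^2]; the left-hand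
    side has exactly this derivative. *)
Lemma ln_det_ge n (A : 'M[R]_n) (s : R) : psd A -> 0 < \tr A -> 0 < \tr (A *m A) ->
  0 <= s ->
  \tr A ^+ 2 / \tr (A *m A) * ln (1 + s * (\tr (A *m A) / \tr A)) <=
  ln (\det (1%:M + s *: A)).
Proof.
move=> pA m0 q0 s0; set m := \tr A in m0 *; set q := \tr (A *m A) in q0 *.
have posQ (t : R) : 0 <= t -> posdef (1%:M + t *: A).
  by move=> t0; apply: posdefD; [exact: posdef1|exact: psdZ].
have pos1 (t : R) : 0 <= t -> 0 < 1 + t * (q / m).
  by move=> t0; rewrite ltr_wpDr// mulr_ge0// divr_ge0// ltW.
pose F t := ln (\det (1%:M + t *: A)) - m ^+ 2 / q * ln (1 + t * (q / m)).
pose dF t := \tr (invmx (1%:M + t *: A) *m A) -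
             m ^+ 2 / q * ((1 + t * (q / m))^-1 * (q / m)).
have dFE (t : R) : 0 <= t -> is_derive t 1 F (dF t).
  move=> t0; have dt := posdef_det_gt0 (posQ t t0).
  have uQ : 1%:M + t *: A \in unitmx by rewrite unitmxE unitfE gt_eqF.
  have d1 : is_derive t 1 (fun x => 1 + x * (q / m)) (q / m).
    refine (is_derive_eq (is_derive1D (is_derive1C _ _)
      (is_derive1M (is_derive1I _) (is_derive1C _ _))) _).
    by rewrite mulr0 addr0 add0r mul1r.
  have d2 : is_derive t 1 (fun x => \det (1%:M + x *: A))
     (\det (1%:M + t *: A) * \tr (invmx (1%:M + t *: A) *m A)).
    apply: (is_derive_det (M := fun x => 1%:M + x *: A)) => // i j.
    under eq_fun do rewrite !mxE.
    refine (is_derive_eq (is_derive1D (is_derive1C _ _)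
      (is_derive1M (is_derive1I _) (is_derive1C _ _))) _).
    by rewrite mulr0 addr0 add0r mul1r.
  apply: is_derive1B.
    refine (is_derive_eq (is_derive1_comp (is_derive1_ln dt) d2) _).
    by rewrite mulrA mulVf ?mul1r// gt_eqF.
  apply: is_derive1Z.
  exact: (is_derive1_comp (f := @ln R) (g := fun x => 1 + x * (q / m)) (is_derive1_ln (pos1 _ t0)) d1).
have dF0 (t : R) : 0 <= t -> 0 <= dF t.
  move=> t0; have dt := posdef_det_gt0 (posQ t t0).
  set Q := 1%:M + t *: A in dt *.
  have uQ : Q \in unitmx by rewrite unitmxE unitfE gt_eqF.
  have sQ : Q^T = Q by case: (posQ t t0).
  have sA := pA.1.
  have AQ : A *m Q = Q *m A.
    by rewrite /Q mulmxDr mulmxDl mulmx1 mul1mx -scalemxAr -scalemxAl.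
  pose W := invmx Q *m A.
  have pW : psd W.
    have -> : W = (invmx Q)^T *m (A + t *: (A *m A)) *m invmx Q.
      have -> : A + t *: (A *m A) = Q *m A by rewrite /Q mulmxDl mul1mx -scalemxAl.
      by rewrite trmx_inv sQ -AQ mulmxA mulmxK.
    apply: psd_congr; split.
      by rewrite linearD linearZ/= trmx_mul sA.
    move=> w; rewrite mulmxDl innerDl -scalemxAl innerZl addr_ge0 ?pA.2//.
    by rewrite mulr_ge0// -mulmxA inner_mull sA inner_ge0.
  pose c := (1 + t * (q / m))^-1.
  have c0 : 0 < c by rewrite invr_gt0 pos1.
  (* Cauchy-Schwarz in discriminant form; this [c] is the optimal one. *)
  have : 0 <= \tr ((1%:M - c *: Q)^T *m W *m (1%:M - c *: Q)).
    by apply: psd_trace_ge0; exact: psd_congr.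
  have -> : (1%:M - c *: Q)^T *m W *m (1%:M - c *: Q) =
      W - (2 * c) *: A + (c ^+ 2) *: (A + t *: (A *m A)).
    have -> : A + t *: (A *m A) = A *m Q by rewrite /Q mulmxDr mulmx1 -scalemxAr.
    have -> : (1%:M - c *: Q)^T = 1%:M - c *: Q by rewrite linearB linearZ/= trmx1 sQ.
    have QW : Q *m W = A by rewrite mulKVmx.
    have WQ : W *m Q = A by rewrite -mulmxA AQ mulKmx.
    rewrite mulmxBl mul1mx -scalemxAl QW mulmxBr mulmx1 -scalemxAr mulmxBl WQ.
    rewrite -scalemxAl scalerBr scalerA -expr2 opprB addrA addrAC.
    by rewrite mulr_natl mulr2n scalerDl opprD addrA addrAC.
  rewrite mxtraceD raddfB/= !mxtraceZ mxtraceD mxtraceZ -/m -/q.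
  have cE : c * (m + t * q) = m.
    have -> : m + t * q = c^-1 * m by rewrite invrK; field; rewrite gt_eqF.
    by rewrite mulVKf// gt_eqF.
  have c2E : c ^+ 2 * (m + t * q) = c * m by rewrite expr2 -mulrA cE.
  rewrite c2E /dF -/c -/Q -/W => h.
  have -> : m ^+ 2 / q * (c * (q / m)) = c * m by field; rewrite !gt_eqF.
  suff : \tr W - 2 * c * m + c * m = \tr W - c * m by move=> <-.
  by ring.
have [||x xs] := @MVT_segment _ F dF _ _ s0.
- by move=> x xs; apply: dFE; rewrite ltW// (itvP xs).
- apply: derivable_within_continuous => x xs.
  have x0 : 0 <= x by rewrite (itvP xs).
  exact: (@ex_derive _ _ _ _ _ _ _ (dFE x x0)).
have x0 : 0 <= x by rewrite (itvP xs).
rewrite subr0 {2}/F scale0r addr0 det1 ln1 mul0r addr0 ln1 mulr0 subrr subr0.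
move=> FE; rewrite -subr_ge0 -/(F s) FE mulr_ge0// dF0//.
Qed.

End determinant.

Section real_estimates.
Context (R : realType).
Implicit Types (f : R -> R) (c y e K : R).

(** Differentiability at [0] from a quadratic error term, in the form in which
    integrals of exponentials provide it. *)
Lemma is_derive_quadratic f c K e : 0 < e ->
  (forall h, `|h| < e -> `|f h - f 0 - h * c| <= K * h ^+ 2) -> is_derive (0 : R) 1 f c.
Proof.
move=> e0 hf; apply/is_derive1_caratheodory.
exists (fun h => if h == 0 then c else (f h - f 0) / h); split.
- move=> h; rewrite subr0; case: eqP => [->|/eqP h0]; first by rewrite mulr0 subrr.
  by rewrite divfK.
- apply/cvgrPdist_le => r r0; rewrite eqxx.
  have rK : 0 < r / (`|K| + 1) by rewrite divr_gt0// ltr_wpDl.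
  near=> h; case: eqP => [_|/eqP h0]; first by rewrite subrr normr0 ltW.
  have hr : `|h| < r / (`|K| + 1) by near: h; exact: (@nbhs0_lt R R).
  have he : `|h| < e by near: h; exact: (@nbhs0_lt R R).
  have -> : c - (f h - f 0) / h = - ((f h - f 0 - h * c) / h) by field.
  rewrite normrN normrM normfV ler_pdivrMr ?normr_gt0//.
  apply: (le_trans (hf _ he)); rewrite -real_normK ?num_real// expr2 mulrA.
  rewrite ler_pM2r ?normr_gt0//.
  have /le_trans -> // : K * `|h| <= (`|K| + 1) * `|h|.
    by rewrite ler_wpM2r// (le_trans (ler_norm _))// lerDl.
  by rewrite mulrC -ler_pdivlMr ?ltr_wpDl// ltW.
- by rewrite eqxx.
Unshelve. all: by end_near. Qed.

Lemma is_derive_max_le0 f c e : 0 < e -> is_derive (0 : R) 1 f c ->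
  (forall h, 0 < h < e -> f h <= f 0) -> c <= 0.
Proof.
move=> e0 /is_derive1_caratheodory[g [fE cg <-]] hf.
rewrite leNgt; apply/negP => g0.
have : \forall h \near 0, 0 < g h by exact: (cvgr_gt (g 0) cg).
case/nbhs_ballP => r /= r0 hr.
pose h := Num.min (r / 2) (e / 2).
have h0 : 0 < h by rewrite lt_min !divr_gt0.
have hre : h < r /\ h < e.
  by split; rewrite gt_min; apply/orP; [left|right]; rewrite gtr_pMr// invf_lt1 ?ltr1n.
have := hf h; rewrite h0 hre.2 => /(_ isT).
rewrite -subr_le0 fE subr0 leNgt mulr_gt0//.
by apply: hr; rewrite /ball/= sub0r normrN gtr0_norm// hre.1.
Qed.

Lemma is_derive_max_eq0 f c e : 0 < e -> is_derive (0 : R) 1 f c ->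
  (forall h, `|h| < e -> f h <= f 0) -> c = 0.
Proof.
move=> e0 df hf; apply/eqP; rewrite eq_le; apply/andP; split.
  by apply: (is_derive_max_le0 e0 df) => h /andP[h0 he]; rewrite hf// gtr0_norm.
have dN : is_derive (0 : R) 1 (fun h => f (0 - h)) (- c).
  have d0 : is_derive (0 : R) 1 (fun h : R => 0 - h) (-1).
    by refine (is_derive_eq (is_derive1B (is_derive1C _ _) (is_derive1I _)) _); rewrite sub0r.
  have df' : is_derive (0 - 0 : R) 1 f c by rewrite subr0.
  by refine (is_derive_eq (is_derive1_comp (f := f) (g := fun h : R => 0 - h) df' d0) _); rewrite mulrN1.
rewrite -oppr_le0; apply: (is_derive_max_le0 e0 dN) => h /andP[h0 he].
by rewrite subr0 hf// sub0r normrN gtr0_norm.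
Qed.

Lemma expR_quadratic y : `|y| <= 1 / 2 -> `|expR y - 1 - y| <= 2 * y ^+ 2.
Proof.
rewrite ler_norml => /andP[y1 y2].
have e1 := expR_ge1Dx y; have e2 := expR_ge1Dx (- y).
have yy := sqr_ge0 y.
rewrite ger0_norm; last by lra.
have : expR y * (1 - y) <= 1.
  by rewrite -[leRHS](expRxMexpNx_1 y) ler_wpM2l ?expR_ge0.
have : 0 <= (expR y) by exact: expR_ge0.
move: (expR y) => E E0 h.
have : (1 + y + 2 * y ^+ 2) * (1 - y) >= 1 by nra.
move=> h2.
have : E * (1 - y) <= (1 + y + 2 * y ^+ 2) * (1 - y) by exact: le_trans h2.
rewrite ler_pM2r; lra.
Qed.

End real_estimates.

(** * Integrals of bounded functions over a fixed set *)

Section bounded_functions.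
Context d (T : measurableType d) (R : realType) (P : probability T R) (D : set T).
Hypotheses (mD : measurable D).
Implicit Types (f g : T -> R).

(** Measurable everywhere but bounded only on [D]: on this class integrals over
    [D] behave like finite sums, and polynomials and exponentials of bounded
    functions stay in it. *)
Definition nice f :=
  measurable_fun [set: T] f /\ exists M, forall x, D x -> `|f x| <= M.

Lemma nice_bound f : nice f -> exists2 M, 0 < M & forall x, D x -> `|f x| <= M.
Proof.
move=> [_ [M hM]]; exists (`|M| + 1); first by rewrite ltr_wpDl.
by move=> x Dx; rewrite (le_trans (hM _ Dx))// (le_trans (ler_norm _))// lerDl.
Qed.

Lemma nice_cst c : nice (fun=> c).
Proof. by split; [exact: measurable_cst|exists `|c|]. Qed.

Lemma niceD f g : nice f -> nice g -> nice (fun x => f x + g x).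
Proof.
move=> [mf [M hM]] [mg [N hN]]; split; first exact: measurable_funD.
by exists (M + N) => x Dx; rewrite (le_trans (ler_normD _ _))// lerD ?hM ?hN.
Qed.

Lemma niceM f g : nice f -> nice g -> nice (fun x => f x * g x).
Proof.
move=> [mf [M hM]] [mg [N hN]]; split; first exact: measurable_funM.
by exists (M * N) => x Dx; rewrite normrM ler_pM ?hM ?hN.
Qed.

Lemma niceN f : nice f -> nice (fun x => - f x).
Proof.
move=> [mf [M hM]]; split; first exact: measurableT_comp.
by exists M => x Dx; rewrite normrN hM.
Qed.

Lemma niceB f g : nice f -> nice g -> nice (fun x => f x - g x).
Proof. by move=> hf hg; exact/niceD/niceN. Qed.

Lemma niceX f k : nice f -> nice (fun x => f x ^+ k).
Proof.
move=> hf; elim: k => [|k ih]; first exact: nice_cst.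
by under eq_fun do rewrite exprS; exact: niceM.
Qed.

Lemma nice_expR f : nice f -> nice (fun x => expR (f x)).
Proof.
move=> [mf [M hM]]; split; first exact: measurableT_comp.
exists (expR M) => x Dx; rewrite ger0_norm ?expR_ge0// ler_expR.
exact/(le_trans (ler_norm _))/hM.
Qed.

Lemma nice_sum (I : Type) (r : seq I) (F : I -> T -> R) :
  (forall i, nice (F i)) -> nice (fun x => \sum_(i <- r) F i x).
Proof.
move=> hF; elim: r => [|i r ih].
  by under eq_fun do rewrite big_nil; exact: nice_cst.
by under eq_fun do rewrite big_cons; exact: niceD.
Qed.

Definition J f : R := \int[P]_(x in D) f x.

Lemma nice_integrable f : nice f -> P.-integrable D (EFin \o f).
Proof.
move=> [mf [M hM]]; apply: measurable_bounded_integrable => //.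
- by rewrite (le_lt_trans (probability_le1 P mD))// ltry.
- exact: measurable_funTS.
- exists M; split => [|N MN x Dx]; first exact: num_real.
  exact/(le_trans (hM _ Dx))/ltW.
Qed.

Lemma JD f g : nice f -> nice g -> J (fun x => f x + g x) = J f + J g.
Proof. by move=> hf hg; apply: RintegralD => //; exact: nice_integrable. Qed.

Lemma JZ c f : nice f -> J (fun x => c * f x) = c * J f.
Proof. by move=> hf; apply: RintegralZl => //; exact: nice_integrable. Qed.

Lemma JN f : nice f -> J (fun x => - f x) = - J f.
Proof.
by move=> hf; rewrite -mulN1r -JZ//; congr J; apply/funext => x; rewrite mulN1r.
Qed.

Lemma JB f g : nice f -> nice g -> J (fun x => f x - g x) = J f - J g.
Proof. by move=> hf hg; rewrite JD ?JN//; exact: niceN. Qed.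

Lemma le_J f g : nice f -> nice g -> (forall x, D x -> f x <= g x) -> J f <= J g.
Proof. by move=> hf hg; apply: le_Rintegral => //; exact: nice_integrable. Qed.

Lemma eq_J f g : (forall x, D x -> f x = g x) -> J f = J g.
Proof. by move=> fg; apply: eq_Rintegral => x /set_mem; exact: fg. Qed.

Lemma J_cst c : J (fun=> c) = c * J (fun=> 1).
Proof. by rewrite /J !Rintegral_cst// mul1r. Qed.

Lemma J_ge0 f : (forall x, D x -> 0 <= f x) -> 0 <= J f.
Proof. exact: Rintegral_ge0. Qed.

Lemma le_normr_J f : nice f -> `|J f| <= J (fun x => `|f x|).
Proof. by move=> hf; apply: le_normr_Rintegral => //; exact: nice_integrable. Qed.

Lemma nice_norm f : nice f -> nice (fun x => `|f x|).
Proof.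
move=> [mf [M hM]]; split; first exact: measurableT_comp.
by exists M => x Dx; rewrite normr_id hM.
Qed.

Lemma J_dist f g M c : nice f -> nice g -> nice M ->
  (forall x, D x -> `|f x - g x| <= c * M x) -> `|J f - J g| <= c * J M.
Proof.
move=> hf hg hM h; rewrite -JB//; apply: (le_trans (le_normr_J (niceB hf hg))).
rewrite -JZ//; apply: le_J => //; first exact/nice_norm/niceB.
by apply: niceM => //; exact: nice_cst.
Qed.

(** Differentiation under the integral sign: as [v] is bounded, [expR] differs
    from its first-order expansion by a quadratic term that is uniform in [x]. *)
Lemma is_derive_J u v f : nice u -> nice v -> nice f ->
  is_derive (0 : R) 1 (fun h => J (fun x => expR (u x + h * v x) * f x))
    (J (fun x => expR (u x) * (v x * f x))).
Proof.
move=> hu hv hf; have [M M0 hM] := nice_bound hv.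
have nE h : nice (fun x => expR (u x + h * v x) * f x).
  by apply: niceM => //; apply: nice_expR; apply: niceD => //; apply: niceM => //; exact: nice_cst.
have nU : nice (fun x => expR (u x)) by exact: nice_expR.
have nV : nice (fun x => expR (u x) * (v x * f x)) by apply: niceM => //; exact: niceM.
have nK : nice (fun x => 2 * (expR (u x) * (v x ^+ 2 * `|f x|))).
  apply: niceM; first exact: nice_cst.
  by apply: niceM => //; apply: niceM; [exact: niceX|exact: nice_norm].
have e0 : 0 < 1 / 2 / M by rewrite !divr_gt0.
apply: (is_derive_quadratic (e := 1 / 2 / M)
   (K := J (fun x => 2 * (expR (u x) * (v x ^+ 2 * `|f x|))))) => // h hh.
rewrite -JZ// [_ * _ ^+ 2]mulrC -addrA -opprD -JD; last 2 first.
- exact: nE.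
- by apply: niceM => //; exact: nice_cst.
apply: J_dist => //; first by apply: niceD => //; apply: niceM => //; exact: nice_cst.
move=> x Dx; rewrite mul0r addr0 expRD.
have -> : expR (u x) * expR (h * v x) * f x -
   (expR (u x) * f x + h * (expR (u x) * (v x * f x))) =
   expR (u x) * ((expR (h * v x) - 1 - h * v x) * f x) by ring.
rewrite !normrM ger0_norm ?expR_ge0//.
have -> : h ^+ 2 * (2 * (expR (u x) * (v x ^+ 2 * `|f x|))) =
  expR (u x) * (2 * (h * v x) ^+ 2 * `|f x|) by ring.
rewrite ler_wpM2l ?expR_ge0// ler_wpM2r// expR_quadratic// normrM.
have := hM _ Dx; move: hh; rewrite ltr_pdivlMr// => /ltW hh hv'.
by apply: le_trans hh; rewrite ler_wpM2l.
Qed.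

(** The weights used below are linear in their parameters, with bounded
    coefficients, so that a small change of the parameters changes [expR] by a
    factor uniformly close to [1]. *)
Lemma continuous_J (X : topologicalType) (K : finType) (c : K -> X -> R)
    (v : K -> T -> R) u f :
  (forall k, continuous (c k)) -> (forall k, nice (v k)) -> nice u -> nice f ->
  continuous (fun t => J (fun x => expR (u x + \sum_k c k t * v k x) * f x)).
Proof.
move=> cc hv hu hf t.
have nS s : nice (fun x => u x + \sum_k c k s * v k x).
  by apply: niceD => //; apply: nice_sum => k; apply: niceM => //; exact: nice_cst.
have [M M0 hM] : exists2 M, 0 < M & forall k x, D x -> `|v k x| <= M.
  have h k : exists M, 0 < M /\ forall x, D x -> `|v k x| <= M.
    by have [M ? ?] := nice_bound (hv k); exists M.
  have [N hN] := choice h.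
  exists (1 + \sum_k N k).
    by rewrite ltr_wpDr// sumr_ge0// => k _; rewrite ltW// (hN k).1.
  move=> k x Dx; rewrite (le_trans ((hN k).2 _ Dx))// (bigD1 k)//= addrCA lerDl.
  by rewrite addr_ge0// sumr_ge0// => j _; rewrite ltW// (hN j).1.
pose G x := 2 * (expR (u x + \sum_k c k t * v k x) * `|f x|).
have nG : nice G.
  apply: niceM; first exact: nice_cst.
  by apply: niceM; [exact: nice_expR|exact: nice_norm].
pose dl s := (\sum_k `|c k s - c k t|) * M.
have dl0 : dl s @[s --> t] --> 0.
  rewrite -(mul0r M); apply: cvgM; last exact: cvg_cst.
  rewrite [X in _ --> X](_ : 0 = \sum_(k : K) 0); last by rewrite big1.
  apply: (@cvg_big R _ +%R 0 xpredT (@add_continuous R) _ _ _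
    (fun k s => `|c k s - c k t|)) => k _.
  rewrite -(@normr0 _ R); apply: cvg_norm; rewrite -[X in _ --> X](subrr (c k t)).
  by apply: cvgB; [exact: cc|exact: cvg_cst].
have hJ : 0 <= J G.
  by apply: J_ge0 => x _; rewrite mulr_ge0// mulr_ge0// expR_ge0.
apply/cvgrPdist_le => /= e e0.
have eJ : 0 < e / (J G + 1) by rewrite divr_gt0// ltr_wpDl.
near=> s.
have ds : dl s <= 1 / 2.
  by near: s; apply: (cvgr_le 0 dl0).
have dse : dl s * J G <= e.
  have : dl s <= e / (J G + 1).
    by near: s; exact: (cvgr_le 0 dl0).
  rewrite ler_pdivlMr ?ltr_wpDl// => h; apply: le_trans h.
  have dl_ge0 : 0 <= dl s by rewrite mulr_ge0 ?sumr_ge0// ltW.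
  by rewrite ler_wpM2l// lerDl.
apply: le_trans dse; apply: J_dist => //; try by apply: niceM => //; exact: nice_expR.
move=> x Dx; rewrite -mulrBl normrM.
pose y := \sum_k (c k s - c k t) * v k x.
have -> : u x + \sum_k c k s * v k x = (u x + \sum_k c k t * v k x) + y.
  rewrite -addrA -big_split/=; congr (_ + _); apply: eq_bigr => k _.
  by rewrite mulrBl addrC subrK.
have yd : `|y| <= dl s.
  rewrite (le_trans (ler_norm_sum _ _ _))// /dl mulr_suml ler_sum// => k _.
  by rewrite normrM ler_wpM2l// hM.
rewrite /G; set A := u x + _ in |- *.
rewrite expRD -[X in X - _]mulr1 -mulrBr normrM ger0_norm ?expR_ge0//.
have : `|1 - expR y| <= 2 * dl s.
  have y2 : `|y| <= 1 / 2 by exact: le_trans ds.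
  rewrite distrC; have h := expR_quadratic y2; rewrite -real_normK ?num_real// in h.
  have -> : expR y - 1 = (expR y - 1 - y) + y by ring.
  apply: (le_trans (ler_normD _ _)).
  have := normr_ge0 y; nra.
move: (expR A) (expR_ge0 A) => E E0 h.
have -> : dl s * (2 * (E * `|f x|)) = E * (2 * dl s) * `|f x| by ring.
by rewrite ler_wpM2r// ler_wpM2l.
Unshelve. all: by end_near. Qed.

End bounded_functions.

Ltac nice := repeat match goal with
  | |- nice _ (fun _ => ?c) => exact: nice_cst
  | |- nice _ (fun _ => _ + _) => apply: niceD
  | |- nice _ (fun _ => _ - _) => apply: niceB
  | |- nice _ (fun _ => - _) => apply: niceN
  | |- nice _ (fun _ => _ * _) => apply: niceM
  | |- nice _ (fun _ => _ ^+ _) => apply: niceX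
  | |- nice _ (fun _ => expR _) => apply: nice_expR
  | |- nice _ (fun _ => \sum_(_ <- _) _) => apply: nice_sum => ?
  | H : nice _ ?f |- nice _ ?f => exact: H
  | |- nice _ _ => done
  end.

(** * Expectation and covariance under an exponential tilt *)

Section tilted_expectation.
Context d (T : measurableType d) (R : realType) (P : probability T R) (D : set T).
Hypotheses (mD : measurable D) (PD : (0 < P D)%E).
Implicit Types (u v f g : T -> R).

Local Notation J := (J P D).
Local Notation nice := (nice D).

Lemma J1_gt0 : 0 < J (fun=> 1).
Proof.
rewrite /J Rintegral_cst// mul1r fine_gt0// PD.
by rewrite (le_lt_trans (probability_le1 P mD))// ltry.
Qed.

Lemma J_expR_gt0 u : nice u -> 0 < J (fun x => expR (u x)).
Proof.
move=> hu; have [M M0 hM] := nice_bound hu.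
apply: (@lt_le_trans _ _ (J (fun=> expR (- M)))).
  by rewrite J_cst// mulr_gt0 ?expR_gt0// J1_gt0.
apply: le_J => //; [exact: nice_cst|exact: nice_expR|].
by move=> x Dx; rewrite ler_expR; have := hM _ Dx; rewrite ler_norml => /andP[].
Qed.

(** Expectation under [P] restricted to [D] and tilted by [expR u]. *)
Definition Ex u f : R := J (fun x => expR (u x) * f x) / J (fun x => expR (u x)).

Definition Cv u f g : R := Ex u (fun x => f x * g x) - Ex u f * Ex u g.

Section fixed_weight.
Variable u : T -> R.
Hypothesis hu : nice u.

Let Z0 : J (fun x => expR (u x)) != 0.
Proof. by rewrite gt_eqF// J_expR_gt0. Qed.

Let nw f : nice f -> nice (fun x => expR (u x) * f x).
Proof. by move=> hf; nice. Qed.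

Lemma Ex_cst c : Ex u (fun=> c) = c.
Proof.
rewrite /Ex -[in X in X / _](_ : (fun x => c * expR (u x)) = fun x => expR (u x) * c).
  by rewrite JZ ?mulfK//; nice.
by apply/funext => x; rewrite mulrC.
Qed.

Lemma ExD f g : nice f -> nice g -> Ex u (fun x => f x + g x) = Ex u f + Ex u g.
Proof.
move=> hf hg; rewrite /Ex -mulrDl -JD//; do 2? exact: nw.
by congr (J _ / _); apply/funext => x; rewrite mulrDr.
Qed.

Lemma ExZ c f : nice f -> Ex u (fun x => c * f x) = c * Ex u f.
Proof.
move=> hf; rewrite /Ex mulrA -JZ//; last exact: nw.
by congr (J _ / _); apply/funext => x; rewrite mulrCA.
Qed.

Lemma ExN f : nice f -> Ex u (fun x => - f x) = - Ex u f.
Proof.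
move=> hf; rewrite -mulN1r -ExZ//; congr Ex.
by apply/funext => x; rewrite mulN1r.
Qed.

Lemma ExB f g : nice f -> nice g -> Ex u (fun x => f x - g x) = Ex u f - Ex u g.
Proof. by move=> hf hg; rewrite ExD ?ExN//; exact: niceN. Qed.

Lemma Ex_sum (I : Type) (r : seq I) (F : I -> T -> R) : (forall i, nice (F i)) ->
  Ex u (fun x => \sum_(i <- r) F i x) = \sum_(i <- r) Ex u (F i).
Proof.
move=> hF; elim: r => [|i r ih].
  by under eq_fun do rewrite big_nil; rewrite big_nil Ex_cst.
under eq_fun do rewrite big_cons.
by rewrite big_cons ExD ?ih//; nice.
Qed.

Lemma le_Ex f g : nice f -> nice g -> (forall x, D x -> f x <= g x) ->
  Ex u f <= Ex u g.
Proof.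
move=> hf hg fg; rewrite /Ex ler_pM2r ?invr_gt0 ?J_expR_gt0//.
by apply: le_J => //; try exact: nw; move=> x Dx; rewrite ler_wpM2l ?expR_ge0 ?fg.
Qed.

Lemma Ex_ge0 f : nice f -> (forall x, D x -> 0 <= f x) -> 0 <= Ex u f.
Proof. by move=> hf f0; rewrite -(Ex_cst 0); apply: le_Ex => //; exact: nice_cst. Qed.

Lemma CvC f g : Cv u f g = Cv u g f.
Proof.
rewrite /Cv [_ * Ex u g]mulrC; congr (Ex u _ - _).
by apply/funext => x; rewrite mulrC.
Qed.

Lemma CvDl f g h : nice f -> nice g -> nice h ->
  Cv u (fun x => f x + g x) h = Cv u f h + Cv u g h.
Proof.
move=> hf hg hh; rewrite /Cv ExD// mulrDl.
under eq_fun do rewrite mulrDl.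
by rewrite ExD; [ring|nice|nice].
Qed.

Lemma CvZl c f h : nice f -> nice h -> Cv u (fun x => c * f x) h = c * Cv u f h.
Proof.
move=> hf hh; rewrite /Cv ExZ//.
under eq_fun do rewrite -mulrA.
by rewrite ExZ; [ring|nice].
Qed.

Lemma Cv_cst c h : nice h -> Cv u (fun=> c) h = 0.
Proof. by move=> hh; rewrite /Cv ExZ// Ex_cst subrr. Qed.

Lemma CvDr f g h : nice f -> nice g -> nice h ->
  Cv u h (fun x => f x + g x) = Cv u h f + Cv u h g.
Proof. by move=> hf hg hh; rewrite CvC CvDl// ![Cv u h _]CvC. Qed.

Lemma CvZr c f h : nice f -> nice h -> Cv u h (fun x => c * f x) = c * Cv u h f.
Proof. by move=> hf hh; rewrite CvC CvZl// CvC. Qed.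

Lemma Cv_suml (I : Type) (r : seq I) (F : I -> T -> R) h :
  (forall i, nice (F i)) -> nice h ->
  Cv u (fun x => \sum_(i <- r) F i x) h = \sum_(i <- r) Cv u (F i) h.
Proof.
move=> hF hh; elim: r => [|i r ih].
  by under eq_fun do rewrite big_nil; rewrite big_nil Cv_cst.
under eq_fun do rewrite big_cons.
by rewrite big_cons CvDl ?ih//; nice.
Qed.

Lemma CvE f : nice f -> Cv u f f = Ex u (fun x => (f x - Ex u f) ^+ 2).
Proof.
move=> hf; set m := Ex u f.
have -> : (fun x => (f x - m) ^+ 2) = (fun x => f x * f x + (- (2 * m) * f x + m ^+ 2)).
  by apply/funext => x; ring.
rewrite ExD; [|nice|nice]; rewrite ExD; [|nice|nice].
by rewrite ExZ// Ex_cst /Cv -/m; ring.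
Qed.

Lemma Cv_ge0 f : nice f -> 0 <= Cv u f f.
Proof.
by move=> hf; rewrite CvE//; apply: Ex_ge0 => [|x _]; [nice|exact: sqr_ge0].
Qed.

Lemma Ex_expR_ge f : nice f -> 1 + Ex u f <= Ex u (fun x => expR (f x)).
Proof.
move=> hf; rewrite -{1}(Ex_cst 1) -ExD//; last exact: nice_cst.
by apply: le_Ex => [||x _]; [nice|nice|exact: expR_ge1Dx].
Qed.

(** Tilting in the direction [v] differentiates an expectation into a
    covariance with [v]; every derivative of the potential follows from this. *)
Lemma is_derive_Ex v f : nice v -> nice f ->
  is_derive (0 : R) 1 (fun h => Ex (fun x => u x + h * v x) f) (Cv u f v).
Proof.
move=> hv hf.
have d1 := is_derive_J P mD hu hv hf.
have d2 : is_derive (0 : R) 1 (fun h => J (fun x => expR (u x + h * v x)))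
    (J (fun x => expR (u x) * v x)).
  have := is_derive_J P mD hu hv (nice_cst D 1).
  under eq_fun do under eq_fun do rewrite mulr1.
  by under [X in J X]eq_fun do rewrite mulr1.
have E0 : (fun x => expR (u x + 0 * v x)) = (fun x => expR (u x)).
  by apply/funext => x; rewrite mul0r addr0.
have Z00 : J (fun x => expR (u x + 0 * v x)) != 0 by rewrite E0.
have d3 := is_deriveV Z00 d2.
refine (is_derive_eq (is_derive1M d1 d3) _).
have -> : (fun x => expR (u x + 0 * v x) * f x) = (fun x => expR (u x) * f x).
  by apply/funext => x; rewrite mul0r addr0.
rewrite E0 /Cv /Ex.
have -> : (fun x => expR (u x) * (v x * f x)) = (fun x => expR (u x) * (f x * v x)).
  by apply/funext => x; rewrite [v x * _]mulrC.
rewrite /GRing.scale/=.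
by field.
Qed.

Lemma is_derive_lnJ v : nice v ->
  is_derive (0 : R) 1 (fun h => ln (J (fun x => expR (u x + h * v x)))) (Ex u v).
Proof.
move=> hv.
have d2 : is_derive (0 : R) 1 (fun h => J (fun x => expR (u x + h * v x)))
    (J (fun x => expR (u x) * v x)).
  have := is_derive_J P mD hu hv (nice_cst D 1).
  under eq_fun do under eq_fun do rewrite mulr1.
  by under [X in J X]eq_fun do rewrite mulr1.
have E0 : (fun x => expR (u x + 0 * v x)) = (fun x => expR (u x)).
  by apply/funext => x; rewrite mul0r addr0.
have Z00 : 0 < J (fun x => expR (u x + 0 * v x)) by rewrite E0 J_expR_gt0.
refine (is_derive_eq (is_derive1_comp (f := @ln R) (is_derive1_ln Z00) d2) _).
by rewrite E0 mulrC.
Qed.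

End fixed_weight.

Section random_vector.
Context (n : nat) (z : T -> 'cV[R]_n).
Hypothesis nz : forall i, nice (fun x => z x i ord0).

Lemma nice_inner c : nice (fun x => inner c (z x)).
Proof. by apply: nice_sum => i; nice. Qed.

Lemma nice_quad (M : 'M[R]_n) : nice (fun x => inner (M *m z x) (z x)).
Proof.
by under eq_fun do rewrite inner_mulmxE; do 2 (apply: nice_sum => ?); nice.
Qed.

Lemma nice_norm2 : nice (fun x => inner (z x) (z x)).
Proof. by apply: nice_sum => i; nice. Qed.

Definition mn u : 'cV[R]_n := \col_i Ex u (fun x => z x i ord0).

Definition cv u : 'M[R]_n :=
  \matrix_(i, j) Cv u (fun x => z x i ord0) (fun x => z x j ord0).

Variable u : T -> R.
Hypothesis hu : nice u.

Lemma cv_sym : (cv u)^T = cv u.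
Proof. by apply/matrixP => i j; rewrite !mxE CvC. Qed.

Lemma Ex_inner c : Ex u (fun x => inner c (z x)) = inner c (mn u).
Proof.
rewrite /inner Ex_sum//; last by move=> i; nice.
by apply: eq_bigr => i _; rewrite ExZ// mxE.
Qed.

Lemma Cv_inner c f : nice f ->
  Cv u (fun x => inner c (z x)) f = \sum_i c i ord0 * Cv u (fun x => z x i ord0) f.
Proof.
move=> hf; rewrite Cv_suml//; last by move=> i; nice.
by apply: eq_bigr => i _; rewrite CvZl.
Qed.

Lemma Cv_quad (M : 'M[R]_n) f : nice f ->
  Cv u (fun x => inner (M *m z x) (z x)) f =
  \sum_i \sum_j M i j * Cv u (fun x => z x j ord0 * z x i ord0) f.
Proof.
move=> hf; under eq_fun do rewrite inner_mulmxE.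
rewrite Cv_suml//; last by move=> i; nice.
apply: eq_bigr => i _; rewrite Cv_suml//; last by move=> j; nice.
apply: eq_bigr => j _; under eq_fun do rewrite -mulrA.
by rewrite CvZl//; nice.
Qed.

Lemma Cv_inner2 c e :
  Cv u (fun x => inner c (z x)) (fun x => inner e (z x)) = inner (cv u *m e) c.
Proof.
rewrite Cv_inner; last exact: nice_inner.
apply: eq_bigr => i _; rewrite CvC Cv_inner// mxE mulrC; congr (_ * _).
by apply: eq_bigr => j _; rewrite mxE mulrC CvC.
Qed.

Lemma Ex_quad (M : 'M[R]_n) : Ex u (fun x => inner (M *m z x) (z x)) =
  \tr (M *m cv u) + inner (M *m mn u) (mn u).
Proof.
under eq_fun do rewrite inner_mulmxE.
rewrite Ex_sum//; last by move=> i; nice.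
rewrite mxtrace_mulE inner_mulmxE -big_split; apply: eq_bigr => i _ /=.
rewrite Ex_sum//; last by move=> j; nice.
rewrite -big_split; apply: eq_bigr => j _ /=.
under eq_fun do rewrite -mulrA.
by rewrite ExZ//; [rewrite /cv /mn !mxE /Cv; ring|nice].
Qed.

End random_vector.

End tilted_expectation.

(** * The potential *)

Section potential.
Context d (T : measurableType d) (R : realType) (P : probability T R) (D : set T).
Hypotheses (mD : measurable D) (PD : (0 < P D)%E).
Context (n : nat) (z : T -> 'cV[R]_n).
Hypothesis nz : forall i, nice D (fun x => z x i ord0).
Variables (s k : R) (g : 'cV[R]_n).
Implicit Types (b c : 'cV[R]_n) (B M N : 'M[R]_n).

Local Notation J := (J P D).
Local Notation nice := (nice D).
Local Notation Ex := (Ex P D).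
Local Notation Cv := (Cv P D).
Local Notation mn := (mn P D z).
Local Notation cv := (cv P D z).

Definition wt b B x : R :=
  inner b (z x) - s * inner (z x) (z x) + inner (B *m z x) (z x).

(** The part of the weight that is linear in the parameters. *)
Definition dwt b B x : R := inner b (z x) + inner (B *m z x) (z x).

Lemma nice_wt b B : nice (wt b B).
Proof.
apply: niceD; last exact: nice_quad.
by apply: niceB; [exact: nice_inner|apply: niceM; [exact: nice_cst|exact: nice_norm2]].
Qed.

Lemma nice_dwt b B : nice (dwt b B).
Proof. by apply: niceD; [exact: nice_inner|exact: nice_quad]. Qed.

Lemma wt_line b B c M h x :
  wt (b + h *: c) (B + h *: M) x = wt b B x + h * dwt c M x.
Proof.
by rewrite /wt /dwt innerDl innerZl mulmxDl -scalemxAl innerDl innerZl; ring.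
Qed.

(** Logarithm of the first factor of the potential; [g] will be the mean of [z]
    for the weight at [b = 0], [B = 0].  With [a] fixed, the derivatives of
    [<b,g>] and [2 <Ba,g>] cancel in the direction [(2 N a, - N)] that matters
    below. *)
Definition lin b B : R :=
  let a := mn (wt b B) in
  inner b g + 2 * inner (B *m a) g - inner (B *m a) a -
  ln (J (fun x => expR (wt b B x))).

Definition Phi b B : R :=
  expR (k * lin b B) * \det (1%:M + k *: (B *m cv (wt b B))).

Section direction.
Variables (b c : 'cV[R]_n) (B M : 'M[R]_n) (u v : T -> R).
Hypotheses (sB : B^T = B) (nu : nice u) (nv : nice v).
Let u_ h := wt (b + h *: c) (B + h *: M).
Hypothesis u_E : forall h, u_ h = fun x => u x + h * v x.

Let a := mn u.
Let A := cv u.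
Let a' : 'cV[R]_n := \col_i Cv u (fun x => z x i ord0) v.

Let inner_a' e : inner e a' = Cv u (fun x => inner e (z x)) v.
Proof. by rewrite Cv_inner//; apply: eq_bigr => i _; rewrite mxE. Qed.

Let d_mn i : is_derive (0 : R) 1 (fun h => mn (u_ h) i ord0) (a' i ord0).
Proof.
rewrite mxE; under eq_fun do rewrite mxE u_E.
exact: is_derive_Ex.
Qed.

Let d_line x y : is_derive (0 : R) 1 (fun h => x + h * y) y.
Proof.
refine (is_derive_eq (is_derive1D (is_derive1C x 0)
  (is_derive1M (is_derive1I 0) (is_derive1C y 0))) _).
by rewrite mulr0 addr0 add0r mul1r.
Qed.

Let u_0 : u_ 0 = u.
Proof. by rewrite u_E; apply/funext => x; rewrite mul0r addr0. Qed.

Let d_bilin (p q : R -> 'cV[R]_n) (p' q' : 'cV[R]_n) :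
  (forall i, is_derive (0 : R) 1 (fun h => p h i ord0) (p' i ord0)) ->
  (forall i, is_derive (0 : R) 1 (fun h => q h i ord0) (q' i ord0)) ->
  is_derive (0 : R) 1 (fun h => inner ((B + h *: M) *m p h) (q h))
    (inner (M *m p 0) (q 0) + inner (B *m p') (q 0) + inner (B *m p 0) q').
Proof.
move=> dp dq.
under eq_fun do rewrite inner_mulmxE.
have dB i j : is_derive (0 : R) 1 (fun h => (B + h *: M) i j) (M i j).
  by under eq_fun do rewrite !mxE; exact: d_line.
refine (is_derive_eq (is_derive1_sum _ (fun i => is_derive1_sum _ (fun j =>
  is_derive1M (is_derive1M (dB i j) (dp j)) (dq i)))) _).
rewrite !inner_mulmxE -!big_split; apply: eq_bigr => i _ /=.
rewrite -!big_split; apply: eq_bigr => j _ /=.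
by rewrite !mxE; ring.
Qed.

Lemma is_derive_lin :
  is_derive (0 : R) 1 (fun h => lin (b + h *: c) (B + h *: M))
    (inner c g + 2 * inner (M *m a) g - inner (M *m a) a - Ex u v
     + 2 * Cv u (fun x => inner (B *m (g - a)) (z x)) v).
Proof.
have d1 : is_derive (0 : R) 1 (fun h => inner (b + h *: c) g) (inner c g).
  by under eq_fun do rewrite innerDl innerZl; exact: d_line.
have dg i : is_derive (0 : R) 1 (fun=> g i ord0) ((0 : 'cV[R]_n) i ord0).
  by rewrite mxE; exact: is_derive1C.
have d2 := d_bilin d_mn dg.
have d3 := d_bilin d_mn d_mn.
have d4 := is_derive_lnJ mD PD nu nv.
rewrite /lin.
have E4 : (fun h => ln (J (fun x => expR (u x + h * v x)))) =
    (fun h => ln (J (fun x => expR (u_ h x)))).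
  by apply/funext => h; rewrite u_E.
rewrite E4 in d4.
refine (is_derive_eq (is_derive1B (is_derive1B (is_derive1D d1 (is_derive1Z 2 d2)) d3) d4) _).
rewrite u_0 -/a inner0r -inner_a' mulmxBr innerBl.
rewrite (inner_sym a' _ sB) (inner_sym a' _ sB) (innerC (B *m a) a').
rewrite ![inner (B *m _) a']innerC !(innerC a').
by ring.
Qed.

Let d_cv i j : is_derive (0 : R) 1 (fun h => cv (u_ h) i j)
  (Cv u (fun x => z x i ord0 * z x j ord0) v -
   (a' i ord0 * a j ord0 + a i ord0 * a' j ord0)).
Proof.
under eq_fun do rewrite mxE /Cv u_E.
have nij : nice (fun x => z x i ord0 * z x j ord0) by nice.
have dd l := is_derive_Ex mD PD nu nv (nz l).
refine (is_derive_eq (is_derive1B (is_derive_Ex mD PD nu nv nij)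
  (is_derive1M (dd i) (dd j))) _).
have -> : (fun x => u x + 0 * v x) = u by apply/funext => x; rewrite mul0r addr0.
by rewrite [a' i _]mxE [a' j _]mxE [a i _]mxE [a j _]mxE.
Qed.

Hypotheses (k0 : 0 < k) (pA : posdef A) (pB : psd B).
Let N := resolvent A B k.
Let Q := 1%:M + k *: (B *m A).

(** In the last two terms Jacobi's formula is applied to [1 + k B A]: the
    derivative of the covariance [A] in the direction [v] is the covariance of
    [(z - a) (z - a)^T] with [v], and [B] times the inverse of [1 + k B A] is the
    resolvent. *)
Lemma is_derive_Phi :
  is_derive (0 : R) 1 (fun h => Phi (b + h *: c) (B + h *: M))
    (k * (expR (k * lin b B) * \det (1%:M + k *: (B *m A))) *
     (inner c g + 2 * inner (M *m a) g - inner (M *m a) a - Ex u v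
      + 2 * Cv u (fun x => inner (B *m (g - a)) (z x)) v
      + \tr (invmx Q *m (M *m A))
      + Cv u (fun x => inner (N *m (z x - a)) (z x - a)) v)).
Proof.
pose A' : 'M[R]_n := \matrix_(i, j)
  (Cv u (fun x => z x i ord0 * z x j ord0) v -
   (a' i ord0 * a j ord0 + a i ord0 * a' j ord0)).
have A'E i j : A' i j = Cv u (fun x => z x i ord0 * z x j ord0) v -
   (a' i ord0 * a j ord0 + a i ord0 * a' j ord0) by rewrite mxE.
have sN : N^T = N := (resolvent_psd pA pB k0).1.
have dA i j : is_derive (0 : R) 1 (fun h => cv (u_ h) i j) (A' i j).
  by rewrite A'E; exact: d_cv.
have addE (X Y : 'M[R]_n) i j : (X + Y) i j = X i j + Y i j by rewrite mxE.
have scaleE (r : R) (X : 'M[R]_n) i j : (r *: X) i j = r * X i j by rewrite mxE.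
have mulE (X Y : 'M[R]_n) i j : (X *m Y) i j = \sum_l X i l * Y l j by rewrite mxE.
have dQ i j : is_derive (0 : R) 1
    (fun h => (1%:M + k *: ((B + h *: M) *m cv (u_ h))) i j)
    ((k *: (M *m A + B *m A')) i j).
  under eq_fun do rewrite addE scaleE mulE.
  have dBA l : is_derive (0 : R) 1 (fun h => (B + h *: M) i l * cv (u_ h) l j)
      (M i l * A l j + B i l * A' l j).
    have dB : is_derive (0 : R) 1 (fun h => (B + h *: M) i l) (M i l).
      by under eq_fun do rewrite addE scaleE; exact: d_line.
    refine (is_derive_eq (is_derive1M dB (dA l j)) _).
    by rewrite u_0 -/A scale0r addr0.
  refine (is_derive_eq (is_derive1D (is_derive1C _ _) (is_derive1Z k (is_derive1_sum _ dBA))) _).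
  by rewrite add0r scaleE addE !mulE big_split.
have Q0 : 1%:M + k *: ((B + 0 *: M) *m cv (u_ 0)) = Q by rewrite scale0r addr0 u_0.
have uQ : 1%:M + k *: ((B + 0 *: M) *m cv (u_ 0)) \in unitmx.
  by rewrite Q0 unitmxE unitfE; exact: (lt0r_neq0 (resolvent_det_gt0 pA pB k0)).
have b00 : b + 0 *: c = b by rewrite scale0r addr0.
have B00 : B + 0 *: M = B by rewrite scale0r addr0.
have dl := is_derive_lin.
set L := (L in is_derive _ _ _ L) in dl *.
have d1 : is_derive (0 : R) 1 (fun h => expR (k * lin (b + h *: c) (B + h *: M)))
    (expR (k * lin b B) * (k * L)).
  have dk := is_derive1Z k dl.
  refine (is_derive_eq (is_derive1_comp (f := @expR R) (is_derive_expR _) dk) _).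
  by rewrite b00 B00.
pose t := \tr (invmx Q *m (M *m A)).
pose w := Cv u (fun x => inner (N *m (z x - a)) (z x - a)) v.
have trE : \tr (invmx Q *m (k *: (M *m A + B *m A'))) = k * (t + w).
  rewrite -scalemxAr mxtraceZ mulmxDr mxtraceD [invmx Q *m (B *m _)]mulmxA -[invmx Q *m B]/N.
  congr (_ * (_ + _)); rewrite /w.
  have -> : \tr (N *m A') = Cv u (fun x => inner (N *m z x) (z x)) v
     - 2 * inner (N *m a) a'.
    rewrite (Cv_quad mD PD nz nu N nv).
    have inE : inner (N *m a) a' = \sum_i \sum_j N i j * (a j ord0 * a' i ord0).
      rewrite inner_mulmxE; apply: eq_bigr => i _; apply: eq_bigr => j _.
      by rewrite mulrA.
    have sw : \sum_i \sum_j N i j * (a' j ord0 * a i ord0) = inner (N *m a) a'.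
      rewrite inE exchange_big; apply: eq_bigr => i _; apply: eq_bigr => j _.
      by rewrite [a j _ * _]mulrC; congr (_ * _); rewrite -[in LHS]sN mxE.
    have trS : \tr (N *m A') =
      \sum_i \sum_j N i j * Cv u (fun x => z x j ord0 * z x i ord0) v
      - \sum_i \sum_j N i j * (a' j ord0 * a i ord0)
      - \sum_i \sum_j N i j * (a j ord0 * a' i ord0).
      rewrite mxtrace_mulE -!sumrB; apply: eq_bigr => i _.
      by rewrite -!sumrB; apply: eq_bigr => j _; rewrite A'E; ring.
    by rewrite trS sw -inE; ring.
  rewrite inner_a'.
  have -> : (fun x => inner (N *m (z x - a)) (z x - a)) =
    (fun x => inner (N *m z x) (z x) + (- 2 * inner (N *m a) (z x) + inner (N *m a) a)).
    apply/funext => x; rewrite mulmxBr !innerBl !innerBr (inner_sym (z x) a sN).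
    by ring.
  have n1 := nice_quad nz N; have n2 := nice_inner nz (N *m a).
  have n3 : nice (fun x => - 2 * inner (N *m a) (z x)) by nice.
  have n4 : nice (fun=> inner (N *m a) a) by exact: nice_cst.
  rewrite (CvDl P mD nu n1 (niceD n3 n4) nv) (CvDl P mD nu n3 n4 nv).
  rewrite (CvZl P mD nu _ n2 nv) (Cv_cst mD PD nu _ nv).
  by ring.
have d2 : is_derive (0 : R) 1
   (fun h => \det (1%:M + k *: ((B + h *: M) *m cv (u_ h)))) (\det Q * (k * (t + w))).
  rewrite -trE.
  exact: (is_derive_eq (is_derive_det dQ uQ) (f_equal (fun X : 'M[R]_n =>
    \det X * \tr (invmx X *m (k *: (M *m A + B *m A')))) Q0)).
have f0 : expR (k * lin (b + 0 *: c) (B + 0 *: M)) = expR (k * lin b B).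
  by rewrite b00 B00.
have alg (e e' D0 D1 : R) : e' = e -> D1 = D0 ->
    e * (k * L) * D1 + e' * (D0 * (k * (t + w))) = k * (e * D0) * (L + t + w).
  by move=> -> ->; ring.
apply: (is_derive_eq (is_derive1M d1 d2)).
exact: (alg _ _ _ _ f0 (f_equal (fun X : 'M[R]_n => \det X) Q0)).
Qed.

End direction.

End potential.

Section increase.
Context d (T : measurableType d) (R : realType) (P : probability T R) (D : set T).
Hypotheses (mD : measurable D) (PD : (0 < P D)%E).
Context (n : nat) (z : T -> 'cV[R]_n).
Hypothesis nz : forall i, nice D (fun x => z x i ord0).
Variables (s k k' : R) (g : 'cV[R]_n).
Hypotheses (k0 : 0 < k) (k'k : k' < k).

Local Notation nice := (nice D).
Local Notation Ex := (Ex P D).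
Local Notation Cv := (Cv P D).
Local Notation wt := (wt z s).
Local Notation Phi := (Phi P D z s k g).

Variables (b : 'cV[R]_n) (B : 'M[R]_n).
Let u := wt b B.
Let a := mn P D z u.
Let A := cv P D z u.
Hypotheses (pB : psd B) (pA : posdef A).
Let N := resolvent A B k.
Let q x := inner (N *m (z x - a)) (z x - a).
Hypothesis varq : Cv u q q <= k' * \tr (N *m A *m N *m A).

Let nu : nice u. Proof. exact: nice_wt. Qed.
Let sN : N^T = N. Proof. exact: (resolvent_psd pA pB k0).1. Qed.

Let qE x : q x = inner (N *m z x) (z x) + (- 2 * inner (N *m a) (z x) + inner (N *m a) a).
Proof.
rewrite /q mulmxBr !innerBl !innerBr (inner_sym (z x) a sN).
by ring.
Qed.

Let nNz := nice_quad nz N.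
Let nNa := nice_inner nz (N *m a).

Let nq : nice q.
Proof.
have -> : q = fun x => inner (N *m z x) (z x) + (- 2 * inner (N *m a) (z x) + inner (N *m a) a).
  by apply/funext => x; exact: qE.
by nice.
Qed.

Let be := B *m (g - a).
Let v1 := dwt z be 0.
Let v2 := dwt z (2 *: (N *m a)) (- N).

Let v1E : v1 = fun x => inner be (z x).
Proof. by apply/funext => x; rewrite /v1 /dwt mul0mx inner0l addr0. Qed.

Let v2E : v2 = fun x => - 1 * q x + inner (N *m a) a.
Proof.
by apply/funext => x; rewrite qE /v2 /dwt innerZl mulNmx innerNl; ring.
Qed.

Let nv1 : nice v1. Proof. exact: nice_dwt. Qed.
Let nv2 : nice v2. Proof. exact: nice_dwt. Qed.

Let Cv_v2 f : nice f -> Cv u f v2 = - Cv u f q.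
Proof.
move=> hf; rewrite v2E.
have n1 : nice (fun x => - 1 * q x) by nice.
have n2 : nice (fun=> inner (N *m a) a) by exact: nice_cst.
rewrite (CvDr P mD nu n1 n2 hf) (CvZr P mD nu _ nq hf) (CvC P D u f (fun=> inner (N *m a) a)) (Cv_cst mD PD nu _ hf).
by rewrite addr0 mulN1r.
Qed.

(* The computation of the two derivatives, up to the common positive factor.
   Here [W = tr (N A N A)], [Vq] is the variance of [q], [Vb] that of
   [<be, z>], [C] their covariance, and [Y - X = k W]. *)
Let alg (X Y W Vq Vb C ig ia p1 p2 : R) :
  Y - X = k * W -> Vq <= k' * W -> 0 <= Vb -> 0 <= ig - ia ->
  ig + 2 * 0 - 0 - ia + 2 * Vb + 0 + C = 0 -> 0 < (k - k') * W ->
  0 < 2 * p2 + 2 * - p2 - - p1 - (p1 - Y) + 2 * - C + - X + - Vq.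
Proof. lra. Qed.

(** The heart of the argument: the potential can be stationary in the linear
    direction [B (g - a)] only if it strictly increases when the quadratic part
    is decreased by [N], the linear part being adjusted so that the increment of
    the weight is, up to a constant, a quadratic form centred at the mean. *)
Lemma Phi_increase : B != 0 ->
  exists c1 c2 : R,
  [/\ is_derive (0 : R) 1 (fun h => Phi (b + h *: be) (B + h *: 0)) c1,
      is_derive (0 : R) 1 (fun h => Phi (b + h *: (2 *: (N *m a))) (B + h *: - N)) c2
    & c1 = 0 -> 0 < c2].
Proof.
move=> B0.
have u_E1 h : wt (b + h *: be) (B + h *: 0) = fun x => u x + h * v1 x.
  by apply/funext => x; exact: wt_line.
have u_E2 h : wt (b + h *: (2 *: (N *m a))) (B + h *: - N) = fun x => u x + h * v2 x.
  by apply/funext => x; exact: wt_line.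
have d1 := is_derive_Phi mD PD nz g pB.1 nu nv1 u_E1 k0 pA pB.
have d2 := is_derive_Phi mD PD nz g pB.1 nu nv2 u_E2 k0 pA pB.
eexists _, _; split; [exact: d1|exact: d2|].
set e := k * _; have e0 : 0 < e.
  rewrite mulr_gt0// mulr_gt0 ?expR_gt0//; exact: (resolvent_det_gt0 pA pB k0).
have nbe := nice_inner nz be.
have E1 : Ex u v1 = inner be a by rewrite v1E (Ex_inner mD PD nz nu).
have E2 : Ex u v2 = inner (N *m a) a - \tr (N *m A).
  have v2E' : v2 = fun x => 2 * inner (N *m a) (z x) + - inner (N *m z x) (z x).
    by apply/funext => x; rewrite /v2 /dwt innerZl mulNmx innerNl.
  have n1 : nice (fun x => 2 * inner (N *m a) (z x)) by nice.
  rewrite v2E' (ExD P mD nu n1 (niceN nNz)) (ExZ P mD nu _ nNa) (ExN P mD nu nNz).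
  by rewrite (Ex_inner mD PD nz nu) (Ex_quad mD PD nz nu); ring.
have h1 := Cv_v2 nbe.
have h2 := Cv_v2 nq.
have h3 : Cv u (fun x => inner be (z x)) v1 = Cv u v1 v1 by rewrite v1E.
have h4 : Cv u q v1 = Cv u (fun x => inner be (z x)) q by rewrite CvC v1E.
have h5 : 0 <= Cv u v1 v1 by exact: (Cv_ge0 mD PD nu nv1).
have h6 : 0 <= inner be (g - a) by exact: pB.2.
have h7 := resolvent_trace pA pB k0.
have h8 := resolvent_trace_gt0 pA pB k0 B0.
rewrite -/be -/q -/a -/A -/N in h7 h8 *.
rewrite E1 E2 h1 h2 h3 h4.
rewrite mul0mx !inner0l mul0mx mulmx0 mxtrace0 innerZl.
have trN (Z : 'M[R]_n) : \tr (- Z) = - \tr Z by rewrite raddfN.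
rewrite !mulNmx !innerNl mulmxN trN innerBr in h6 *.
move: h7 h8 varq h5 h6; rewrite -/a -/A -/N.
set X := \tr (invmx _ *m _); set Y := \tr (N *m A); set W := \tr (_ *m _ *m _ *m _).
set Vq := Cv u q q; set Vb := Cv u v1 v1; set C := Cv u _ q.
set ig := inner be g; set ia := inner be a.
set p1 := inner (N *m a) a; set p2 := inner (N *m a) g.
move=> h7 h8 hv h5 h6 /eqP; rewrite mulf_eq0 gt_eqF//= => /eqP st.
rewrite pmulr_rgt0//.
have kW : 0 < (k - k') * W by rewrite mulr_gt0// subr_gt0.
exact: (@alg X Y W Vq Vb C ig ia p1 p2 h7 hv h5 h6 st kW).
Qed.

End increase.

(** * Bounds on matrices and coercivity of the potential *)

Section quadratic_form_bounds.
Context (R : realType).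

Lemma posdef_coercive n (A : 'M[R]_n) : posdef A -> exists2 c, 0 < c &
  forall b : 'cV[R]_n, c * (\sum_i `|b i ord0|) ^+ 2 <= inner (A *m b) b.
Proof.
move=> pA; have [L [tL dL AE]] := posdef_Cholesky pA.
have uLT : L^T \in unitmx.
  by rewrite unitmx_tr unitmxE unitfE gt_eqF// det_trig// prodr_gt0.
pose C := \sum_i \sum_j `|invmx L^T i j|.
have C0 : 0 <= C by apply: sumr_ge0 => i _; apply: sumr_ge0.
exists ((C + 1) ^- 2); first by rewrite invr_gt0 exprn_gt0// ltr_wpDl.
move=> b; pose w := L^T *m b.
have qE : inner (A *m b) b = inner w w.
  by rewrite AE -mulmxA inner_mull.
rewrite qE mulrC ler_pdivrMr ?exprn_gt0 ?ltr_wpDl//.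
have w1 i : `|w i ord0| <= Num.sqrt (inner w w).
  rewrite -sqrtr_sqr ler_sqrt ?inner_ge0// /inner (bigD1 i)//= -expr2 lerDl.
  by apply: sumr_ge0 => j _; rewrite -expr2 sqr_ge0.
have hb : \sum_i `|b i ord0| <= (C + 1) * Num.sqrt (inner w w).
  apply: (@le_trans _ _ (C * Num.sqrt (inner w w))); last first.
    by rewrite ler_wpM2r ?sqrtr_ge0// lerDl.
  rewrite mulr_suml; apply: ler_sum => i _.
  rewrite -(mulKmx uLT b) -/w mxE mulr_suml.
  apply: (le_trans (ler_norm_sum _ _ _)); apply: ler_sum => j _.
  by rewrite normrM ler_wpM2l.
rewrite mulrC -[X in _ * X]sqr_sqrtr ?inner_ge0// -exprMn.
by rewrite ler_pXn2r// nnegrE ?sumr_ge0// mulr_ge0 ?sqrtr_ge0 ?addr_ge0.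
Qed.

Definition between n (s : R) (B : 'M[R]_n) := psd B /\ psd (s%:M - B).

Lemma between_le n s (B : 'M[R]_n) (w : 'cV[R]_n) : between s B ->
  0 <= inner (B *m w) w <= s * inner w w.
Proof.
move=> [[_ h1] [_ h2]]; rewrite h1/= -subr_ge0.
by have := h2 w; rewrite mulmxBl innerBl mul_scalar_mx innerZl.
Qed.

Lemma between_entry n s (B : 'M[R]_n) i j : between s B -> `|B i j| <= s.
Proof.
move=> hB; have sB := hB.1.1.
pose e (k : 'I_n) : 'cV[R]_n := delta_mx k ord0.
have eE k l : inner (B *m e k) (e l) = B l k.
  rewrite /inner (bigD1 l)//= big1 ?addr0 => [|m ml]; last first.
    by rewrite [e l _ _]mxE (negbTE ml) mulr0.
  rewrite [e l _ _]mxE !eqxx mulr1 mxE (bigD1 k)//= big1 ?addr0 => [|m mk]; last first.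
    by rewrite [e k _ _]mxE (negbTE mk) mulr0.
  by rewrite [e k _ _]mxE !eqxx mulr1.
have e1 k l : inner (e k) (e l) = (k == l)%:R.
  rewrite /inner (bigD1 l)//= big1 ?addr0 => [|m ml]; last first.
    by rewrite [e l _ _]mxE (negbTE ml) mulr0.
  by rewrite [e l _ _]mxE !eqxx mulr1 mxE eqxx andbT eq_sym.
have Bji : B j i = B i j by rewrite -[in LHS]sB mxE.
have /andP[h1 h2] := between_le (e i + e j) hB.
have /andP[h3 h4] := between_le (e i - e j) hB.
have s0 : 0 <= s.
  have /andP[h5 h6] := between_le (e i) hB.
  by have := le_trans h5 h6; rewrite e1 eqxx mulr1.
move: h1 h2 h3 h4; rewrite !(mulmxDr, mulmxBr, mulmxN, innerDl, innerBl, innerDr, innerBr, innerNl, innerNr).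
rewrite !eE !e1 !eqxx Bji [j == i]eq_sym.
by rewrite ler_norml; case: (i == j) => /=; rewrite ?mulr1n ?mulr0n => h1 h2 h3 h4; lra.
Qed.

(** Positivity of [B] at [a - g], and the upper bound of [B] at [g]. *)
Lemma between_polar n s (B : 'M[R]_n) (a g : 'cV[R]_n) : between s B ->
  2 * inner (B *m a) g - inner (B *m a) a <= s * inner g g.
Proof.
move=> hB.
have /andP[h1 _] := between_le (a - g) hB.
have /andP[_ h2] := between_le g hB.
move: h1; rewrite mulmxBr !innerBl !innerBr (inner_sym g a hB.1.1) => h1.
by lra.
Qed.

End quadratic_form_bounds.

Section coercivity.
Context d (T : measurableType d) (R : realType) (P : probability T R) (D : set T).
Hypotheses (mD : measurable D) (PD : (0 < P D)%E).
Context (n : nat) (z : T -> 'cV[R]_n).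
Hypothesis nz : forall i, nice D (fun x => z x i ord0).
Variables (s k : R).
Hypotheses (s0 : 0 < s) (k0 : 0 < k).

Local Notation nice := (nice D).
Local Notation J := (J P D).
Local Notation Ex := (Ex P D).
Local Notation Cv := (Cv P D).
Local Notation wt := (wt z s).

Let nwt b B : nice (wt b B). Proof. exact: nice_wt. Qed.

Hypothesis pcv : forall b B, between s B -> posdef (cv P D z (wt b B)).

Let g := mn P D z (wt 0 0).
Local Notation Phi := (Phi P D z s k g).

Lemma Ex_le_bound u f M : nice u -> nice f -> (forall x, D x -> `|f x| <= M) ->
  `|Ex u f| <= M.
Proof.
move=> hu hf hM; rewrite ler_norml; apply/andP; split.
  rewrite -(Ex_cst mD PD hu (- M)); apply: (le_Ex mD PD hu) => //.
    exact: nice_cst.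
  by move=> x /hM; rewrite ler_norml => /andP[].
rewrite -[leRHS](Ex_cst mD PD hu M); apply: (le_Ex mD PD hu) => //.
  exact: nice_cst.
by move=> x /hM; rewrite ler_norml => /andP[].
Qed.

Lemma z_bound : exists2 M, 0 < M & forall i x, D x -> `|z x i ord0| <= M.
Proof.
have h i : exists M, 0 < M /\ forall x, D x -> `|z x i ord0| <= M.
  by have [M ? ?] := nice_bound (nz i); exists M.
have [N hN] := choice h.
exists (1 + \sum_i N i).
  by rewrite ltr_wpDr// sumr_ge0// => i _; rewrite ltW// (hN i).1.
move=> i x Dx; rewrite (le_trans ((hN i).2 _ Dx))// (bigD1 i)//= addrCA lerDl.
by rewrite addr_ge0// sumr_ge0// => j _; rewrite ltW// (hN j).1.
Qed.

Lemma det_bound : exists2 C, 0 < C & forall b B, between s B ->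
  \det (1%:M + k *: (B *m cv P D z (wt b B))) <= C.
Proof.
have [M M0 hM] := z_bound.
pose c := 1 + k * (\sum_(i < n) s * (2 * M ^+ 2)).
have c0 : 0 < c.
  rewrite ltr_wpDr// mulr_ge0 ?(ltW k0)// sumr_ge0// => i _.
  by rewrite mulr_ge0 ?(ltW s0)// mulr_ge0// sqr_ge0.
exists (c ^+ n *+ #|{perm 'I_n}|).
  rewrite pmulrn_lgt0 ?exprn_gt0//; apply/card_gt0P; by exists 1%g.
move=> b B hB; apply: det_le => i j.
have cvb l m : `|cv P D z (wt b B) l m| <= 2 * M ^+ 2.
  rewrite mxE /Cv; apply: (le_trans (ler_normB _ _)).
  have nlm : nice (fun x => z x l ord0 * z x m ord0) by nice.
  have h1 : `|Ex (wt b B) (fun x => z x l ord0 * z x m ord0)| <= M ^+ 2.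
    apply: Ex_le_bound => // x Dx.
    by rewrite normrM expr2 ler_pM// hM.
  have h2 : `|Ex (wt b B) (fun x => z x l ord0) * Ex (wt b B) (fun x => z x m ord0)| <= M ^+ 2.
    rewrite normrM expr2 ler_pM//; exact: Ex_le_bound (hM _).
  by rewrite mulr2n mulrDl mul1r lerD.
have -> : (1%:M + k *: (B *m cv P D z (wt b B))) i j =
   (i == j)%:R + k * (\sum_l B i l * cv P D z (wt b B) l j).
  have addE (X Y : 'M[R]_n) : (X + Y) i j = X i j + Y i j by rewrite mxE.
  have scaleE (X : 'M[R]_n) : (k *: X) i j = k * X i j by rewrite mxE.
  have mulE (X Y : 'M[R]_n) : (X *m Y) i j = \sum_l X i l * Y l j by rewrite mxE.
  by rewrite addE scaleE mulE mxE.
apply: (le_trans (ler_normD _ _)); rewrite lerD//.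
  by rewrite ger0_norm ?ler0n// lern1; case: (i == j).
rewrite normrM gtr0_norm// ler_wpM2l ?(ltW k0)//.
apply: (le_trans (ler_norm_sum _ _ _)); apply: ler_sum => l _.
by rewrite normrM ler_pM// between_entry.
Qed.

Let u0 := wt 0 0.
Let Z0 := J (fun x => expR (u0 x)).
Let A0 := cv P D z u0.

Lemma between0 : between s (0 : 'M[R]_n).
Proof.
have p1 : psd (s%:M : 'M[R]_n).
  split=> [|w]; first by rewrite tr_scalar_mx.
  by rewrite mul_scalar_mx innerZl mulr_ge0 ?inner_ge0// ltW.
split; last by rewrite subr0.
by split=> [|w]; [rewrite linear0|rewrite mul0mx inner0l].
Qed.

Lemma between_s : between s (s%:M : 'M[R]_n).
Proof.
have [h1 h2] := between0; rewrite subr0 in h2.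
by split=> //; rewrite subrr.
Qed.

(* A quadratic lower bound that is valid on a whole interval: its curvature
   decreases like the inverse of the length of the interval. *)
Let expR_ge_quadratic (M y : R) : 1 <= M -> `|y| <= M -> y + y ^+ 2 / (4 * M) <= expR y.
Proof.
move=> M1; rewrite ler_norml => /andP[y1 y2].
have M0 : 0 < M by lra.
have y2M : y ^+ 2 / (4 * M) * (4 * M) = y ^+ 2 by rewrite divfK// gt_eqF//; lra.
have [y0|y0] := leP 0 y.
  have h : 1 + y / 2 <= expR (y / 2) by exact: expR_ge1Dx.
  have -> : expR y = expR (y / 2) ^+ 2.
    by rewrite expr2 -expRD; congr expR; field.
  have : (1 + y / 2) ^+ 2 <= expR (y / 2) ^+ 2 by rewrite ler_pXn2r ?nnegrE ?expR_ge0//; lra.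
  have : y ^+ 2 / (4 * M) <= y ^+ 2 / 4.
    by rewrite ler_wpM2l ?sqr_ge0// lef_pV2 ?posrE; lra.
  by move=> h1 h2; apply: le_trans h2; have := sqr_ge0 y; nra.
apply: le_trans (expR_ge0 _).
have : y ^+ 2 / (4 * M) <= - y / 4.
  rewrite ler_pdivrMr; last lra.
  nra.
lra.
Qed.

(** A centred linear functional [Y] bounded by a multiple of [|b|] has a variance
    of order [|b|^2], so that [E exp Y] is at least of order [|b|]. *)
Lemma Ex_expR_coercive : exists2 c, 0 < c &
  forall b : 'cV[R]_n, 1 <= \sum_i `|b i ord0| ->
    c * (\sum_i `|b i ord0|) <= Ex u0 (fun x => expR (inner b (z x - g))).
Proof.
have [M M0 hM] := z_bound.
have [c c0 hc] := posdef_coercive (pcv 0 between0).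
pose G := 1 + M + \sum_i `|g i ord0|.
have G1 : 1 <= G by rewrite /G -addrA lerDl addr_ge0 ?(ltW M0)// sumr_ge0.
exists (c / (4 * G)).
  by rewrite divr_gt0// mulr_gt0// (lt_le_trans _ G1).
move=> b; set be := \sum_i _ => b1.
have hu0 := nwt 0 0.
pose Y x := inner b (z x - g).
have YE : Y = fun x => inner b (z x) + (- inner b g).
  by apply/funext => x; rewrite /Y innerBr.
have nb := nice_inner nz b.
have nY : nice Y by rewrite YE; apply: niceD => //; exact: nice_cst.
have EY : Ex u0 Y = 0.
  rewrite YE (ExD P mD hu0 nb (nice_cst _ _)) (Ex_cst mD PD hu0).
  by rewrite (Ex_inner mD PD nz hu0) subrr.
have EY2 : Ex u0 (fun x => Y x ^+ 2) = inner (A0 *m b) b.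
  have h : Cv u0 Y Y = Cv u0 (fun x => inner b (z x)) (fun x => inner b (z x)).
    have nc : nice (fun=> - inner b g) by exact: nice_cst.
    rewrite {1}YE (CvDl P mD hu0 nb nc nY) (Cv_cst mD PD hu0 _ nY) addr0.
    rewrite {1}YE (CvDr P mD hu0 nb nc nb) [X in _ + X](CvC P D).
    by rewrite (Cv_cst mD PD hu0 _ nb) addr0.
  rewrite -(Cv_inner2 mD PD nz hu0) -h /Cv EY mulr0 subr0.
  by congr (Ex _ _); apply/funext => x; rewrite expr2.
have M1 : 1 <= be * G by rewrite -[leLHS]mulr1 ler_pM.
have Yb x : D x -> `|Y x| <= be * G.
  move=> Dx; apply: (le_trans (ler_norm_sum _ _ _)); rewrite /be mulr_suml.
  apply: ler_sum => i _; rewrite normrM ler_wpM2l// [(z x - g) i _]mxE [(- g) i _]mxE.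
  apply: (le_trans (ler_normB _ _)).
  have hg : `|g i ord0| <= \sum_i `|g i ord0|.
    by rewrite [leRHS](bigD1 i)//= lerDl sumr_ge0.
  apply: (le_trans (lerD (hM i x Dx) hg)).
  by rewrite /G -addrA lerDr.
have nY2 : nice (fun x => (4 * (be * G))^-1 * Y x ^+ 2) by nice.
have h1 : Ex u0 (fun x => Y x + (4 * (be * G))^-1 * Y x ^+ 2) <= Ex u0 (fun x => expR (Y x)).
  apply: (le_Ex mD PD hu0); [nice|nice|] => x Dx.
  by rewrite [_^-1 * _]mulrC; apply: expR_ge_quadratic (Yb _ Dx).
apply: le_trans h1; have nYY : nice (fun x => Y x ^+ 2) by nice.
rewrite (ExD P mD hu0 nY nY2) EY add0r (ExZ P mD hu0 _ nYY) EY2.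
have be0 : 0 < be by rewrite (lt_le_trans _ b1).
have G0 : 0 < G by rewrite (lt_le_trans _ G1).
rewrite [leRHS]mulrC ler_pdivlMr ?mulr_gt0//.
apply: le_trans (hc b); rewrite -/be le_eqVlt; apply/orP; left; apply/eqP.
by field; rewrite !gt_eqF.
Qed.

Let alg1 (p q r t : R) : 0 <= t -> q + (0 - r + 0 + (p - q)) <= p - r + t.
Proof. lra. Qed.

Let ln3 (x y c l : R) : 0 < x -> 0 < y -> x * y * expR c <= l ->
  ln x + ln y + c <= ln l.
Proof.
move=> x0 y0 h; have xyc : 0 < x * y * expR c by rewrite !mulr_gt0// expR_gt0.
rewrite -[X in _ + X](expRK c) -!lnM ?posrE ?mulr_gt0 ?expR_gt0//.
by rewrite ler_ln// posrE// (lt_le_trans xyc).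
Qed.

Let alg3 (p0 l C x : R) : 0 < p0 -> 0 < C -> p0 <= expR (k * (l - x)) * C ->
  x <= l - ln (p0 / C) / k.
Proof.
move=> p00 C0; rewrite -ler_pdivrMr// => h.
have pC : 0 < p0 / C by rewrite divr_gt0.
have : ln (p0 / C) <= k * (l - x) by rewrite -[leRHS]expRK ler_ln ?posrE// expR_gt0.
rewrite [leRHS]mulrC -ler_pdivrMr// => h1.
by rewrite lerBrDr addrC -lerBrDr.
Qed.

Let alg2 (ig Bag Baa sg z0 x l : R) :
  2 * Bag - Baa <= sg -> z0 + x + ig <= l ->
  ig + 2 * Bag - Baa - l <= sg - z0 - x.
Proof. lra. Qed.

(** For large [b] the logarithm of the normalising constant exceeds [<b,g>] by at
    least a constant plus [ln |b|], while the determinant and the quadratic terms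
    of [lin] stay bounded; so the potential tends to [0]. *)
Lemma Phi_coercive : exists2 rho, 0 < rho &
  forall b B, between s B -> Phi 0 s%:M <= Phi b B -> forall i, `|b i ord0| < rho.
Proof.
have [C C0 hC] := det_bound; have [c c0 hc] := Ex_expR_coercive.
have Phi0 : 0 < Phi 0 s%:M.
  rewrite mulr_gt0 ?expR_gt0//.
  exact: (resolvent_det_gt0 (pcv 0 between_s) between_s.1 k0).
have Z00 : 0 < Z0 by exact: (J_expR_gt0 mD PD (nwt 0 0)).
pose C2 := s * inner g g - ln Z0 - ln (Phi 0 s%:M / C) / k.
exists (1 + expR C2 / c); first by rewrite ltr_wpDr// divr_ge0 ?expR_ge0// ltW.
move=> b B hB hP i; set be := \sum_i `|b i ord0|.
apply: (@le_lt_trans _ _ be).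
  by rewrite /be (bigD1 i)//= lerDl sumr_ge0.
have [b1|b1] := ltP be 1.
  by rewrite (lt_le_trans b1)// lerDl divr_ge0 ?expR_ge0// ltW.
rewrite ltr_pwDl// ler_pdivlMr// mulrC.
have bX : c * be <= Ex u0 (fun x => expR (inner b (z x - g))) by exact: hc.
apply: (le_trans bX).
set X := Ex _ _.
have X0 : 0 < X by apply: lt_le_trans bX; rewrite mulr_gt0// (lt_le_trans _ b1).
rewrite -[X]lnK ?posrE// ler_expR.
have hZ : Z0 * X * expR (inner b g) <= J (fun x => expR (wt b B x)).
  have -> : Z0 * X = J (fun x => expR (u0 x) * expR (inner b (z x - g))).
    by rewrite mulrC divfK// (gt_eqF Z00).
  rewrite mulrC.
  have nE := nwt 0 0; have nb := nice_inner nz b.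
  have nW : nice (fun x => inner b (z x - g)).
    have -> : (fun x => inner b (z x - g)) = fun x => inner b (z x) - inner b g.
      by apply/funext => x; rewrite innerBr.
    by nice.
  have n1 : nice (fun x => expR (u0 x) * expR (inner b (z x - g))) by nice.
  rewrite -(JZ P mD _ n1); apply: (le_J P mD); [by nice|exact/nice_expR/nwt|].
  move=> x Dx; rewrite -!expRD ler_expR /u0 /wt inner0l mul0mx inner0l innerBr.
  have /andP[h _] := between_le (z x) hB.
  exact: alg1.
have lnZ : ln Z0 + ln X + inner b g <= ln (J (fun x => expR (wt b B x))).
  exact: ln3 hZ.
have linle : lin P D z s g b B <= s * inner g g - ln Z0 - ln X.
  rewrite /lin; set a := mn _ _ _ _.
  exact: (alg2 (between_polar a g hB) lnZ).
have hle : Phi 0 s%:M <= expR (k * (s * inner g g - ln Z0 - ln X)) * C.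
  apply: (le_trans hP); apply: ler_pM; [exact: expR_ge0| | |exact: hC].
    exact/ltW/(resolvent_det_gt0 (pcv b hB) hB.1 k0).
  by rewrite ler_expR (ler_pM2l k0).
exact: alg3 hle.
Qed.

End coercivity.

(** * The maximum of the potential *)

Section maximum.
Context d (T : measurableType d) (R : realType) (P : probability T R) (D : set T).
Hypotheses (mD : measurable D) (PD : (0 < P D)%E).
Context (n : nat) (z : T -> 'cV[R]_n).
Hypothesis nz : forall i, nice D (fun x => z x i ord0).
Variables (s k k' : R).
Hypotheses (s0 : 0 < s) (k0 : 0 < k) (k'k : k' < k).

Local Notation nice := (nice D).
Local Notation J := (J P D).
Local Notation Ex := (Ex P D).
Local Notation Cv := (Cv P D).
Local Notation wt := (wt z s).

Hypothesis pcv : forall b B, between s B -> posdef (cv P D z (wt b B)).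
Hypothesis var_quad : forall b B (N : 'M[R]_n), between s B -> N^T = N ->
  let a := mn P D z (wt b B) in let A := cv P D z (wt b B) in
  let q x := inner (N *m (z x - a)) (z x - a) in
  Cv (wt b B) q q <= k' * \tr (N *m A *m N *m A).
Hypothesis mn0 : mn P D z (fun=> 0) = 0.

Let g := mn P D z (wt 0 0).
Local Notation Phi := (Phi P D z s k g).

(** The parameters [(b, B)] are packed in one row vector, whose bounded closed
    subsets are compact. *)
Local Notation X := 'rV[R]_(n + n * n).
Let bb (t : X) : 'cV[R]_n := \col_i t ord0 (lshift (n * n) i).
Let BB (t : X) : 'M[R]_n := \matrix_(i, j) t ord0 (rshift n (mxvec_index i j)).
Let pack (b : 'cV[R]_n) (B : 'M[R]_n) : X := row_mx b^T (mxvec B).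

Let bbK b B : bb (pack b B) = b.
Proof. by apply/colP => i; rewrite mxE row_mxEl mxE. Qed.

Let BBK b B : BB (pack b B) = B.
Proof. by apply/matrixP => i j; rewrite mxE row_mxEr mxvecE. Qed.

Let cbb i : continuous (fun t : X => bb t i ord0).
Proof. by move=> t; under eq_fun do rewrite mxE; exact: coord_continuous. Qed.

Let cBB i j : continuous (fun t : X => BB t i j).
Proof. by move=> t; under eq_fun do rewrite mxE; exact: coord_continuous. Qed.

Let continuousD (f h : X -> R) : continuous f -> continuous h ->
  continuous (fun t => f t + h t).
Proof. by move=> cf ch t; exact: (cvgD (cf t) (ch t)). Qed.

Let continuousM (f h : X -> R) : continuous f -> continuous h ->
  continuous (fun t => f t * h t).
Proof. by move=> cf ch t; exact: (cvgM (cf t) (ch t)). Qed.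

Let continuousN (f : X -> R) : continuous f -> continuous (fun t => - f t).
Proof. by move=> cf t; exact: (cvgN (cf t)). Qed.

Let continuousC (c : R) : continuous (fun t : X => c).
Proof. exact: cst_continuous. Qed.

Let continuous_sum (I : Type) (r : seq I) (F : I -> X -> R) :
  (forall i, continuous (F i)) -> continuous (fun t => \sum_(i <- r) F i t).
Proof.
by move=> cF; apply: (@continuous_big R _ +%R 0 xpredT (@add_continuous R) X r F).
Qed.

(* The weight is linear in the coordinates of [b] and the entries of [B]. *)
Let coef (p : 'I_n + 'I_n * 'I_n) (t : X) : R :=
  match p with inl i => bb t i ord0 | inr ij => BB t ij.1 ij.2 end.

Let monomial (p : 'I_n + 'I_n * 'I_n) (x : T) : R :=
  match p with inl i => z x i ord0 | inr ij => z x ij.2 ord0 * z x ij.1 ord0 end.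

Let wt_sum t x : wt (bb t) (BB t) x = - (s * inner (z x) (z x)) +
  \sum_p coef p t * monomial p x.
Proof.
rewrite /wt big_sumType/= [inner (BB t *m _) _]inner_mulmxE.
have -> : \sum_(p : 'I_n * 'I_n) BB t p.1 p.2 * (z x p.2 ord0 * z x p.1 ord0) =
    \sum_i \sum_j BB t i j * z x j ord0 * z x i ord0.
  by rewrite pair_bigA; apply: eq_bigr => p _; rewrite mulrA.
by rewrite addrA [- _ + _]addrC.
Qed.

Let continuous_Jwt f : nice f ->
  continuous (fun t => J (fun x => expR (wt (bb t) (BB t) x) * f x)).
Proof.
move=> hf.
have -> : (fun t => J (fun x => expR (wt (bb t) (BB t) x) * f x)) =
  (fun t => J (fun x => expR (- (s * inner (z x) (z x)) + \sum_p coef p t * monomial p x) * f x)).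
  by apply/funext => t; congr J; apply/funext => x; rewrite wt_sum.
have cc p : continuous (coef p) by case: p => [i|ij]; [exact: cbb|exact: cBB].
have cm p : nice (monomial p) by case: p => [i|[i j]] /=; [exact: nz|exact: niceM].
have n2 : nice (fun x => - (s * inner (z x) (z x))).
  by apply: niceN; apply: niceM; [exact: nice_cst|exact: nice_norm2].
exact: (continuous_J mD cc cm n2 hf).
Qed.

Let Z_gt0 t : 0 < J (fun x => expR (wt (bb t) (BB t) x)).
Proof. exact: (J_expR_gt0 mD PD (nice_wt nz _ _ _)). Qed.

Let continuous_Z : continuous (fun t => J (fun x => expR (wt (bb t) (BB t) x))).
Proof.
have := continuous_Jwt (nice_cst D 1).
by under eq_fun do under eq_fun do rewrite mulr1.
Qed.

Let continuous_Ex f : nice f -> continuous (fun t => Ex (wt (bb t) (BB t)) f).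
Proof.
move=> hf t; have Z0 : J (fun x => expR (wt (bb t) (BB t) x)) != 0.
  by rewrite gt_eqF// Z_gt0.
exact: (cvgM (@continuous_Jwt f hf t) (cvgV Z0 (@continuous_Z t))).
Qed.

Let continuous_mn i : continuous (fun t => mn P D z (wt (bb t) (BB t)) i ord0).
Proof. by under eq_fun do rewrite mxE; exact: continuous_Ex. Qed.

Let continuous_cv i j : continuous (fun t => cv P D z (wt (bb t) (BB t)) i j).
Proof.
under eq_fun do rewrite mxE /Cv.
apply: continuousD; first by apply: continuous_Ex; nice.
by apply: continuousN; apply: continuousM; exact: continuous_Ex.
Qed.

Let continuous_form (p q : X -> 'cV[R]_n) :
  (forall i, continuous (fun t => p t i ord0)) ->
  (forall i, continuous (fun t => q t i ord0)) ->
  continuous (fun t => inner (BB t *m p t) (q t)).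
Proof.
move=> cp cq; under eq_fun do rewrite inner_mulmxE.
by apply: continuous_sum => i; apply: continuous_sum => j;
  apply: continuousM => //; exact: continuousM.
Qed.

Let continuous_lin : continuous (fun t => lin P D z s g (bb t) (BB t)).
Proof.
have cg i : continuous (fun _ : X => g i ord0) by exact: continuousC.
have c1 : continuous (fun t => inner (bb t) g).
  have cp i := continuousM (@cbb i) (@cg i).
  by have := @continuous_sum _ (index_enum _) _ cp.
have c2 := continuousM (@continuousC 2) (continuous_form continuous_mn cg).
have c3 := continuousN (continuous_form continuous_mn continuous_mn).
have c4 : continuous (fun t => ln (J (fun x => expR (wt (bb t) (BB t) x)))).
  move=> t; apply: (@continuous_comp _ _ _ _ (@ln R) t (@continuous_Z t)).
  exact: (continuous_ln (Z_gt0 t)).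
exact: (continuousD (continuousD (continuousD c1 c2) c3) (continuousN c4)).
Qed.

Let continuous_Phi : continuous (fun t => Phi (bb t) (BB t)).
Proof.
rewrite /Phi; apply: continuousM.
  move=> t; apply: (@continuous_comp _ _ _ _ (@expR R) t
    (@continuousM _ _ (@continuousC k) continuous_lin t)).
  exact: continuous_expR.
apply: continuous_det => i j.
have -> : (fun t => (1%:M + k *: (BB t *m cv P D z (wt (bb t) (BB t)))) i j) =
   (fun t => (1%:M : 'M[R]_n) i j +
       k * \sum_l BB t i l * cv P D z (wt (bb t) (BB t)) l j).
  apply/funext => t.
  have addE (Y Z : 'M[R]_n) : (Y + Z) i j = Y i j + Z i j by rewrite mxE.
  have scaleE (Y : 'M[R]_n) : (k *: Y) i j = k * Y i j by rewrite mxE.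
  have mulE (Y Z : 'M[R]_n) : (Y *m Z) i j = \sum_l Y i l * Z l j by rewrite mxE.
  by rewrite addE scaleE mulE.
apply: (continuousD (@continuousC _)); apply: (continuousM (@continuousC k)).
have cp l := continuousM (@cBB i l) (@continuous_cv l j).
by have := @continuous_sum _ (index_enum _) _ cp.
Qed.

Let closed_ge0 (f : X -> R) : continuous f -> closed [set t | 0 <= f t].
Proof.
move=> cf; have := @preimage_closed _ _ f [set x | 0 <= x]; apply.
  by move=> t _; exact: cf.
exact: closed_ge.
Qed.

Let closed_eq0 (f : X -> R) : continuous f -> closed [set t | f t = 0].
Proof.
move=> cf; have := @preimage_closed _ _ f [set x | x = 0]; apply.
  by move=> t _; exact: cf.
exact: closed_eq.
Qed.

Let closed_between : closed [set t : X | between s (BB t)].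
Proof.
have -> : [set t : X | between s (BB t)] =
  (\bigcap_(ij in [set: 'I_n * 'I_n]) [set t | BB t ij.2 ij.1 - BB t ij.1 ij.2 = 0]) `&`
  ((\bigcap_(w in [set: 'cV[R]_n]) [set t | 0 <= inner (BB t *m w) w]) `&`
   (\bigcap_(w in [set: 'cV[R]_n]) [set t | 0 <= s * inner w w - inner (BB t *m w) w])).
  apply/seteqP; split=> t /=.
    move=> hB; split; last split.
    - by move=> [i j] _ /=; rewrite -[in X in X - _]hB.1.1 mxE subrr.
    - by move=> w _; exact: hB.1.2.
    - by move=> w _ /=; rewrite subr_ge0; have /andP[] := between_le w hB.
  move=> [hs [h1 h2]].
  have sB : (BB t)^T = BB t.
    by apply/matrixP => i j; rewrite mxE; apply/eqP; rewrite -subr_eq0; apply/eqP/(hs (i, j)).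
  split; split=> //.
  - by move=> w; exact: h1.
  - by rewrite linearB/= tr_scalar_mx sB.
  - by move=> w; rewrite mulmxBl innerBl mul_scalar_mx innerZl; exact: h2.
apply: closedI; last apply: closedI; apply: closed_bigI => w _.
- exact: closed_eq0 (continuousD (@cBB _ _) (continuousN (@cBB _ _))).
- by apply: closed_ge0; apply: continuous_form => i; exact: continuousC.
- apply: closed_ge0; apply: (continuousD (@continuousC _)); apply: continuousN.
  by apply: continuous_form => i; exact: continuousC.
Qed.

(* Moving by the resolvent does not leave the parameter set, as the resolvent
   is at most [B]. *)
Let resolvent_step (A B : 'M[R]_n) h : posdef A -> between s B -> 0 <= h <= 1 ->
  between s (B + h *: - resolvent A B k).
Proof.
move=> pA hB /andP[h0 h1].
have [sN hN] := resolvent_psd pA hB.1 k0; have [_ hBN] := resolvent_le pA hB.1 k0.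
set N := resolvent _ _ _ in sN hN hBN *.
have sX : (B + h *: - N)^T = B + h *: - N.
  by rewrite linearD linearZ/= linearN/= sN hB.1.1.
split; split=> //.
- move=> w; rewrite mulmxDl innerDl -scalemxAl innerZl mulNmx innerNl.
  have := hBN w; have := hN w; rewrite mulmxBl innerBl.
  by nra.
- by rewrite linearB/= tr_scalar_mx sX.
- move=> w; rewrite mulmxBl innerBl mulmxDl innerDl -scalemxAl innerZl mulNmx innerNl.
  have := hB.2.2 w; have := hN w; rewrite mulmxBl innerBl.
  by nra.
Qed.

Let wt_start x : wt 0 s%:M x = 0.
Proof. by rewrite /wt inner0l mul_scalar_mx innerZl sub0r addNr. Qed.

Let final (J1 dt z0 z1 c : R) : 0 < z0 -> 0 < dt -> z0 * expR c <= z1 ->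
  expR (k * - ln J1) * dt <= expR (k * (c - ln z1)) -> ln z0 <= ln J1 - ln dt / k.
Proof.
move=> z00 dt0 hz h.
have zc : 0 < z0 * expR c by rewrite mulr_gt0// expR_gt0.
have h1 : ln z0 + c <= ln z1.
  rewrite -[X in _ + X]expRK -lnM ?posrE ?expR_gt0//.
  by rewrite ler_ln// posrE// (lt_le_trans zc).
have h2 : k * - ln J1 + ln dt <= k * (c - ln z1).
  rewrite -[leRHS]expRK -[X in X + _]expRK -lnM ?posrE ?expR_gt0//.
  by rewrite ler_ln// posrE ?mulr_gt0 ?expR_gt0.
have h3 : ln dt / k <= c - ln z1 + ln J1.
  by rewrite ler_pdivrMr// mulrC; lra.
by lra.
Qed.

(** At a maximum of the potential [B = 0], for otherwise one of the two
    directions of [Phi_increase] would lead to larger values; Jensen's inequality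
    then compares the maximal value with the Laplace transform. *)
Lemma exp_moment_le :
  ln (J (fun x => expR (- (s * inner (z x) (z x))))) <=
  ln (J (fun=> 1)) - ln (\det (1%:M + (k * s) *: cv P D z (fun=> 0))) / k.
Proof.
have [rho rho0 hrho] := Phi_coercive mD PD nz s0 k0 pcv.
have bs := between_s n s0.
pose M := rho + s.
pose K := [set t : X | forall i, `[- M, M]%classic (t ord0 i)] `&` [set t | between s (BB t)].
have cK : compact K.
  apply: compact_closedI; last exact: closed_between.
  by apply: (@rV_compact R _ (fun=> `[- M, M]%classic)) => i; exact: segment_compact.
have inK (b : 'cV[R]_n) (B : 'M[R]_n) : between s B -> (forall i, `|b i ord0| <= rho) -> K (pack b B).
  move=> hB hb; split; last by rewrite /= BBK.
  move=> i /=; rewrite in_itv/= -ler_norml /M.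
  case: (split_ordP i) => j ->.
    by rewrite row_mxEl mxE (le_trans (hb _))// lerDl ltW.
  rewrite row_mxEr; case/mxvec_indexP: j => i1 i2; rewrite mxvecE.
  by rewrite (le_trans (between_entry _ _ hB))// lerDr ltW.
have K0 : K (pack 0 s%:M) by apply: inK => // i; rewrite mxE normr0 ltW.
have cPhi : {within K, continuous (fun t => Phi (bb t) (BB t))}.
  exact: continuous_subspaceT.
have [t tK tmax] := compact_EVT_max (ex_intro _ _ K0) cK cPhi.
have {}tmax (b : 'cV[R]_n) (B : 'M[R]_n) : between s B -> (forall i, `|b i ord0| <= rho) ->
    Phi b B <= Phi (bb t) (BB t).
  move=> hB hb; have := tmax (pack b B); rewrite bbK BBK; apply.
  by apply/mem_set; exact: inK.
have hB : between s (BB t) by case: (set_mem tK).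
set b := bb t in tmax *; set B := BB t in hB tmax *.
have rho0' i : `|(0 : 'cV[R]_n) i ord0| <= rho by rewrite mxE normr0 ltW.
have hb i : `|b i ord0| < rho.
  by apply: (hrho b B hB); exact: (tmax 0 s%:M bs rho0').
(* As [b] is interior, small moves of [b] in any direction are admissible. *)
have near_b (c : 'cV[R]_n) : exists2 e : R, 0 < e &
    forall h, `|h| < e -> forall i, `|(b + h *: c) i ord0| <= rho.
  have hpos i : 0 < (rho - `|b i ord0|) / (`|c i ord0| + 1).
    by rewrite divr_gt0 ?subr_gt0// ltr_wpDl.
  exists (\big[Num.min/1]_i ((rho - `|b i ord0|) / (`|c i ord0| + 1))).
    by apply: (big_ind (fun x : R => 0 < x)) => // x y x0 y0; rewrite lt_min x0.
  move=> h hh i; rewrite [(b + h *: c) i ord0]mxE [(h *: c) i ord0]mxE (le_trans (ler_normD _ _))// -lerBrDl normrM.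
  have : `|h| < (rho - `|b i ord0|) / (`|c i ord0| + 1).
    by apply: (lt_le_trans hh); exact: bigmin_le_cond.
  have c1 : 0 < `|c i ord0| + 1 by rewrite ltr_wpDl.
  rewrite (ltr_pdivlMr _ _ c1) => h1; apply: le_trans (ltW h1).
  by rewrite ler_wpM2l// lerDl.
have B0 : B = 0.
  apply/eqP; apply: contraT => B0.
  have pA := pcv b hB.
  have sN := (resolvent_psd pA hB.1 k0).1.
  have [c1 [c2 [d1 d2 c12]]] :=
    Phi_increase mD PD nz g k0 k'k hB.1 pA (var_quad b hB sN) B0.
  have f0 c C : Phi (b + 0 *: c) (B + 0 *: C) = Phi b B.
    by rewrite !scale0r !addr0.
  have [e1 e10 he1] := near_b (B *m (g - mn P D z (wt b B))).
  have [e2 e20 he2] := near_b (2 *: (resolvent (cv P D z (wt b B)) B k *m mn P D z (wt b B))).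
  have c10 : c1 = 0.
    apply: (is_derive_max_eq0 e10 d1) => h hh.
    have hB' : between s (B + h *: 0) by rewrite scaler0 addr0.
    by rewrite f0; exact: (tmax _ _ hB' (he1 h hh)).
  have := c12 c10; rewrite ltNge => /negP[].
  have e3 : 0 < Num.min e2 1 by rewrite lt_min e20 ltr01.
  apply: (is_derive_max_le0 e3 d2) => h /andP[h0]; rewrite lt_min => /andP[h2 h1].
  have h01 : 0 <= h <= 1 by rewrite !ltW.
  have hh : `|h| < e2 by rewrite gtr0_norm.
  by rewrite f0; exact: (tmax _ _ (resolvent_step pA hB h01) (he2 h hh)).
have hmax : Phi 0 s%:M <= Phi b 0 by rewrite -B0; exact: (tmax 0 s%:M bs rho0').
have ws : wt 0 s%:M = fun=> 0 by apply/funext => x; exact: wt_start.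
have E1 : Phi 0 s%:M = expR (k * - ln (J (fun=> 1))) *
    \det (1%:M + (k * s) *: cv P D z (fun=> 0)).
  rewrite /Phi /lin ws mn0 mulmx0 !inner0l mulr0 addr0 subr0 sub0r.
  have -> : (fun x : T => expR 0) = (fun=> 1 : R) by apply/funext => x; rewrite expR0.
  by rewrite mul_scalar_mx scalerA.
have E2 : Phi b 0 = expR (k * (inner b g - ln (J (fun x => expR (wt b 0 x))))).
  by rewrite /Phi /lin !mul0mx scaler0 addr0 det1 mulr1 !inner0l mulr0 addr0 subr0.
have u0E : wt 0 0 = fun x => - (s * inner (z x) (z x)).
  by apply/funext => x; rewrite /wt inner0l mul0mx inner0l addr0 sub0r.
have hu0 := nice_wt nz s 0 0.
have nb := nice_inner nz b.
have nbg : nice (fun x => inner b (z x) - inner b g).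
  by apply: niceB => //; exact: nice_cst.
have Z00 := J_expR_gt0 mD PD hu0.
have hJ : J (fun x => expR (wt 0 0 x)) * expR (inner b g) <= J (fun x => expR (wt b 0 x)).
  have := Ex_expR_ge mD PD hu0 nbg.
  have -> : Ex (wt 0 0) (fun x => inner b (z x) - inner b g) = 0.
    rewrite (ExB P mD hu0 nb (nice_cst _ _)) (Ex_cst mD PD hu0).
    by rewrite (Ex_inner mD PD nz hu0) subrr.
  rewrite (addr0 1) (ler_pdivlMr _ _ Z00) mul1r => h.
  rewrite mulrC -ler_pdivlMl ?expR_gt0// -expRN; apply: (le_trans h).
  rewrite -(JZ P mD _ (nice_expR (nice_wt nz s b 0))).
  rewrite le_eqVlt; apply/orP; left; apply/eqP; apply: eq_J => x Dx.
  by rewrite -!expRD /wt !mul0mx !inner0l; congr expR; ring.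
move: hmax; rewrite E1 E2.
have d0 := resolvent_det_gt0 (pcv 0 bs) bs.1 k0.
have {}d0 : 0 < \det (1%:M + (k * s) *: cv P D z (fun=> 0)).
  by move: d0; rewrite ws mul_scalar_mx scalerA.
have -> : (fun x => expR (- (s * inner (z x) (z x)))) = (fun x => expR (wt 0 0 x)).
  by rewrite u0E.
move=> hm; exact: (final Z00 d0 hJ hm).
Qed.

End maximum.

(** * Lebesgue measure under triangular affine maps *)

Section affine_lebesgue.
Context (R : realType).
Local Notation leb := (@lebesgue_measure R).
Local Open Scope ereal_scope.

Section affine_real.
Variables (l c : R).
Hypothesis l0 : (0 < l)%R.

Let phi : R -> measurableTypeR R := fun r => (l * r + c)%R.

Let mphi : measurable_fun [set: measurableTypeR R] phi.
Proof.
rewrite /phi; apply: (@measurable_funD _ (measurableTypeR R)) => //.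
Qed.

Let push : {measure set (measurableTypeR R) -> \bar R} :=
  measure_function_pushforward__canonical__measure_function_Measure leb mphi.

Let nnl : {nonneg R} := NngNum (ltW l0).

Let lebE A : measurable A -> leb A = mscale nnl push A.
Proof.
move=> mA; apply: lebesgue_measure_unique => // _ [[a b] /= _ <-].
rewrite /mscale/= /pushforward.
have -> : phi @^-1` `]a, b] = `]((a - c) / l)%R, ((b - c) / l)%R]%classic.
  apply/seteqP; split=> r /=; rewrite !in_itv/= ltr_pdivrMr// ler_pdivlMr//;
    by rewrite ltrBlDr lerBrDr mulrC.
rewrite !lebesgue_measure_itv/= !lte_fin ltr_pM2r ?invr_gt0// ltrD2r.
case: ifPn => _; last by rewrite mule0.
by rewrite -!EFinB -EFinM; congr EFin; field; rewrite gt_eqF.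
Qed.

Lemma integral_affine_real (f : R -> \bar R) :
  measurable_fun [set: measurableTypeR R] f -> (forall r, 0 <= f r) ->
  \int[leb]_r f r = l%:E * \int[leb]_r f (l * r + c)%R.
Proof.
move=> mf f0.
rewrite (eq_measure_integral (mscale nnl push)); last by move=> A mA _; exact: lebE.
rewrite ge0_integral_mscale//=; congr (_ * _).
by rewrite (ge0_integral_pushforward mphi)// preimage_setT.
Qed.

End affine_real.

Lemma integral_cons_cV n (f : 'cV[R]_n.+1 -> \bar R) :
  measurable_fun setT f -> (forall x, 0 <= f x) ->
  \int[lebesgue_cV R n.+1]_x f x =
  \int[leb]_r \int[lebesgue_cV R n]_x f (cons_cV (r, x)).
Proof.
move=> mf f0.
have mfc : measurable_fun [set: measurableTypeR R * 'cV[R]_n] (f \o @cons_cV R n).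
  exact: measurableT_comp mf (@measurable_cons_cV R n).
rewrite /= /lebesgue_cons (ge0_integral_pushforward (@measurable_cons_cV R n))//.
rewrite preimage_setT; exact: (@fubini_tonelli1 _ _ _ _ R leb (lebesgue_cV R n) _ mfc (fun x => f0 _)).
Qed.

Lemma measurable_integral_cons n (f : 'cV[R]_n.+1 -> \bar R) :
  measurable_fun setT f -> (forall x, 0 <= f x) ->
  measurable_fun [set: measurableTypeR R]
    (fun r => \int[lebesgue_cV R n]_x f (cons_cV (r, x))).
Proof.
move=> mf f0.
have mfc : measurable_fun [set: measurableTypeR R * 'cV[R]_n] (f \o @cons_cV R n).
  exact: measurableT_comp mf (@measurable_cons_cV R n).
apply: (measurable_fun_fubini_tonelli_F (m2 := lebesgue_cV R n) (f \o @cons_cV R n) mfc).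
by move=> x; exact: f0.
Qed.

Lemma measurable_affine m n (L : 'M[R]_(m, n)) (c : 'cV[R]_m) :
  measurable_fun [set: 'cV[R]_n] (fun x => L *m x + c)%R.
Proof.
apply: measurable_fun_cVP => i.
under eq_fun do rewrite mxE [(L *m _) _ _]mxE.
apply: measurable_funD => //; apply: measurable_sum => j.
by apply: measurable_funM => //; exact: measurable_coord_cV.
Qed.

(** Change of variables for triangular maps, by Fubini: the first coordinate of
    [L x + c] depends only on the first coordinate of [x], and for a fixed value
    of the latter the others undergo a triangular map of smaller dimension. *)
Lemma integral_triangular n (L : 'M[R]_n) (c : 'cV[R]_n) (f : 'cV[R]_n -> \bar R) :
  is_trig_mx L -> (forall i, 0 < L i i)%R ->
  measurable_fun setT f -> (forall x, 0 <= f x) ->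
  \int[lebesgue_cV R n]_x f x =
  (\det L)%:E * \int[lebesgue_cV R n]_x f (L *m x + c)%R.
Proof.
elim: n L c f => [|n ih] L c f tL dL mf f0.
  rewrite det_mx00 mul1e; apply: eq_integral => x _; congr f.
  by apply/colP => -[].
pose l := L ord0 ord0; pose v : 'cV[R]_n := (\col_i L (lift ord0 i) ord0)%R.
pose L' : 'M[R]_n := (\matrix_(i, j) L (lift ord0 i) (lift ord0 j))%R.
pose c' : 'cV[R]_n := (\col_i c (lift ord0 i) ord0)%R.
have tL' : is_trig_mx L'.
  apply/is_trig_mxP => i j ij; rewrite mxE; apply: (is_trig_mxP tL).
  by rewrite !lift0 ltnS.
have dL' i : (0 < L' i i)%R by rewrite mxE.
have detL : \det L = (l * \det L')%R.
  rewrite !det_trig// big_ord_recl; congr (_ * _)%R.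
  by apply: eq_bigr => i _; rewrite mxE.
have LE r x : (L *m cons_cV (r, x) + c =
    cons_cV (l * r + c ord0 ord0, L' *m x + (r *: v + c')))%R.
  apply/colP => i; rewrite mxE [(L *m _) _ _]mxE big_ord_recl !mxE unlift_none/=.
  case: (unliftP ord0 i) => [j ->|->].
    rewrite addrA mulrC /= !mxE; congr (_ + _)%R; rewrite addrC; congr (_ + _)%R.
    by apply: eq_bigr => k _; rewrite !mxE liftK/=.
  rewrite /= big1 ?addr0// => k _; rewrite (is_trig_mxP tL) ?mul0r//.
have mfL : measurable_fun setT (fun x => f (L *m x + c)%R).
  exact: measurableT_comp mf (measurable_affine L c).
rewrite integral_cons_cV// (integral_affine_real (l := l) (c ord0 ord0))//; last 3 first.
- exact: dL.
- exact: measurable_integral_cons.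
- by move=> r; exact: integral_ge0.
rewrite [in RHS]integral_cons_cV// detL EFinM -muleA; congr (_ * _).
rewrite -ge0_integralZl//; last 3 first.
- exact: (measurable_integral_cons mfL).
- by move=> r _; exact: integral_ge0.
- by rewrite lee_fin det_trig// prodr_ge0// => i _; exact: ltW.
apply: eq_integral => r _.
rewrite (ih L' (r *: v + c')%R (fun x => f (cons_cV (l * r + c ord0 ord0, x)%R)))//; last first.
  have := mf; move=> mf'; apply: (measurableT_comp mf').
  apply: (measurableT_comp (@measurable_cons_cV R n)).
  exact: measurable_pair1.
by congr (_ * _); apply: eq_integral => x _; rewrite LE.
Qed.

(** By Fubini: unless [w] is a multiple of the first basis vector, every section
    is a hyperplane of smaller dimension; otherwise all sections but one are
    empty. *)
Lemma lebesgue_hyperplane n (w : 'cV[R]_n) (c : R) : (w != 0)%R ->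
  lebesgue_cV R n [set x | inner w x = c] = 0.
Proof.
have mH m (u : 'cV[R]_m) b : measurable [set x : 'cV[R]_m | inner u x = b].
  have -> : [set x : 'cV[R]_m | inner u x = b] = (fun x => inner u x) @^-1` [set b] by [].
  rewrite -[X in measurable X]setTI; apply: (_ : measurable_fun _ _) => //.
  apply: measurable_sum => i; apply: measurable_funM => //.
  exact: measurable_coord_cV.
have intE m (A : set 'cV[R]_m) : measurable A ->
    lebesgue_cV R m A = \int[lebesgue_cV R m]_x (\1_A x)%:E.
  by move=> mA; rewrite integral_indic// setIT.
elim: n w c => [|n ih] w c w0.
  by case/eqP: w0; apply/colP => -[].
pose w' : 'cV[R]_n := (\col_i w (lift ord0 i) ord0)%R.
have inE' r x : inner w (cons_cV (r, x)) = (w ord0 ord0 * r + inner w' x)%R.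
  rewrite /inner big_ord_recl !mxE unlift_none/=; congr (_ + _)%R.
  by apply: eq_bigr => i _; rewrite !mxE liftK.
have HE : lebesgue_cV R n.+1 [set x | inner w x = c] =
    \int[leb]_r lebesgue_cV R n [set x | inner w' x = c - w ord0 ord0 * r]%R.
  rewrite (intE _ _ (mH _ w c)) integral_cons_cV//; last first.
    apply/measurable_EFinP; apply: measurable_indic. exact: mH.
  apply: eq_integral => r _; rewrite (intE _ _ (mH _ w' _)).
  apply: eq_integral => x _; congr EFin; rewrite !indicE; congr (_%:R); congr nat_of_bool.
  apply/idP/idP => /set_mem/= h; apply/mem_set => /=; move: h; rewrite inE'.
    by move=> <-; rewrite addrAC subrr add0r.
  by move=> ->; rewrite addrC subrK.
rewrite HE; have [w'0|w'0] := eqVneq w' 0%R; last first.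
  by apply: integral0_eq => r _; exact: ih.
have w00 : w ord0 ord0 != 0%R.
  apply: contra w0 => /eqP w00; apply/eqP/colP => i; rewrite [RHS]mxE.
  case: (unliftP ord0 i) => [j ->|-> //].
  by have := congr1 (fun u : 'cV[R]_n => u j ord0) w'0; rewrite !mxE.
pose r0 := (c / w ord0 ord0)%R.
have E r : lebesgue_cV R n [set x | inner w' x = c - w ord0 ord0 * r]%R =
    ((fun=> lebesgue_cV R n setT) \_ [set r0]) r.
  rewrite patchE; case: ifPn => [/set_mem/= rr0|/negP rr0].
    congr (lebesgue_cV R n _); apply/seteqP; split=> // x _ /=.
    by rewrite w'0 inner0l rr0 /r0 mulrC divfK// subrr.
  rewrite (_ : [set x | _] = set0) ?measure0//.
  apply/seteqP; split=> // x /=; rewrite w'0 inner0l => /eqP.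
  rewrite eq_sym subr_eq0 => /eqP cE; apply: rr0; apply/mem_set => /=.
  by rewrite /r0 cE mulrAC mulfV ?mul1r.
under eq_integral do rewrite E.
by rewrite -integral_mkcond integral_set1.
Qed.

End affine_lebesgue.

(** * Measures given by a density *)

Section densities.
Context d (T : measurableType d) (R : realType).
Variable m : {measure set T -> \bar R}.
Local Open Scope ereal_scope.

Lemma density_probability (p : T -> R) :
  measurable_fun setT p -> (forall x, 0 <= p x)%R -> \int[m]_x (p x)%:E = 1 ->
  exists mu : probability T R,
    forall A, measurable A -> mu A = \int[m]_(x in A) (p x)%:E.
Proof.
move=> mp p0 p1.
pose M (A : set T) := \int[m]_(x in A) (p x)%:E.
have M0 : M set0 = 0 by rewrite /M integral_set0.
have M_ge0 A : 0 <= M A by apply: integral_ge0 => x _; rewrite lee_fin.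
have M_additive : semi_sigma_additive M.
  move=> F mF tF mUF; rewrite /M ge0_integral_bigcup//; last first.
  - by move=> x _; rewrite lee_fin.
  - exact/measurable_EFinP/measurable_funTS.
  by apply: is_cvg_ereal_nneg_natsum_cond => n _ _; exact: M_ge0.
pose M1 : {measure set T -> \bar R} :=
  HB.pack M (isMeasure.Build _ _ _ M M0 M_ge0 M_additive).
pose mu : probability T R :=
  HB.pack M (Measure.class M1) (Measure_isProbability.Build _ _ _ M1 p1).
by exists mu.
Qed.

Import HBNNSimple.

(** By monotone approximation from simple functions. *)
Lemma integral_density (nu : {measure set T -> \bar R}) (p : T -> R) :
  measurable_fun setT p -> (forall x, 0 <= p x)%R ->
  (forall A, measurable A -> nu A = \int[m]_(x in A) (p x)%:E) ->
  forall f : T -> \bar R, measurable_fun setT f -> (forall x, 0 <= f x) ->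
  \int[nu]_x f x = \int[m]_x (f x * (p x)%:E).
Proof.
move=> mp p0 nuE f mf f0; pose f_ := nnsfun_approx measurableT mf.
have cvgf x : (f_ n x)%:E @[n --> \oo] --> f x by exact: cvg_nnsfun_approx.
have ndf x a b : (a <= b)%N -> (f_ a x <= f_ b x)%R.
  by move=> ab; exact/lefP/nd_nnsfun_approx.
transitivity (limn (fun n => \int[nu]_x (f_ n x)%:E)).
  rewrite -monotone_convergence//.
  - by apply: eq_integral => x _; apply/esym/cvg_lim.
  - by move=> n; exact/measurable_EFinP.
  - by move=> n x _; rewrite lee_fin.
  - by move=> x _ a b ab; rewrite lee_fin ndf.
transitivity (limn (fun n => \int[m]_x ((f_ n x)%:E * (p x)%:E))); last first.
  rewrite -monotone_convergence//.
  - apply: eq_integral => x _; apply/cvg_lim => //.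
    by apply: cvgeZr => //; exact: cvgf.
  - by move=> n; apply: emeasurable_funM; exact/measurable_EFinP.
  - by move=> n x _; rewrite mule_ge0// lee_fin.
  - by move=> x _ a b ab; rewrite lee_wpmul2r ?lee_fin// ndf.
congr (limn _); apply/funext => n.
have mA r : measurable (f_ n @^-1` [set r]) by [].
transitivity (\sum_(r \in range (f_ n)) r%:E * nu (f_ n @^-1` [set r])).
  under eq_integral do rewrite fimfunE -fsumEFin//.
  rewrite ge0_integral_fsum//; last 2 first.
  - by move=> r; exact/measurable_EFinP/measurable_funM.
  - by move=> r x _; rewrite nnfun_muleindic_ge0.
  apply: eq_fsbigr => r _; rewrite integralZl_indic_nnsfun//.
  by rewrite integral_indic// setIT.
have mfp r : measurable_fun setT
    (fun x => r%:E * ((\1_(f_ n @^-1` [set r]) x)%:E * (p x)%:E)).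
  apply: emeasurable_funM => //; apply: emeasurable_funM; exact/measurable_EFinP.
transitivity (\int[m]_x \sum_(r \in range (f_ n))
    (r%:E * ((\1_(f_ n @^-1` [set r]) x)%:E * (p x)%:E))); last first.
  apply: eq_integral => x _; rewrite fimfunE -fsumEFin// ge0_mule_fsuml//.
    by apply: eq_fsbigr => r _; rewrite EFinM muleA.
  by move=> r; rewrite nnfun_muleindic_ge0.
rewrite ge0_integral_fsum//; last first.
  move=> r x _; rewrite muleA; apply: mule_ge0; last by rewrite lee_fin.
  exact: nnfun_muleindic_ge0.
apply: eq_fsbigr => r /set_mem[x _ rE].
rewrite nuE// ge0_integralZl//; last 3 first.
- by apply: emeasurable_funM; exact/measurable_EFinP.
- by move=> y _; rewrite mule_ge0// lee_fin.
- by rewrite lee_fin -rE.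
congr (_ * _); rewrite integral_mkcond; apply: eq_integral => y _.
rewrite patchE indicE; case: ifPn => yA; first by rewrite mul1e.
by rewrite mul0e.
Qed.

End densities.

(** * Standardised tilts of a log-concave law *)

Section normalized_law.
Context (R : realType) (n : nat).
Variables (P : probability 'cV[R]_n R) (f : 'cV[R]_n -> R) (D : set 'cV[R]_n).
Hypotheses (dP : is_density P f) (cf : concave_ereal (fun x => lne (f x)%:E)).
Hypotheses (mD : measurable D) (PD : (0 < P D)%E).
Hypothesis cD : forall x y (t : R), 0 <= t <= 1 -> D x -> D y ->
  D ((1 - t) *: x + t *: y).
Variable u : 'cV[R]_n -> R.
Hypotheses (hu : nice D u) (cu : forall x y (t : R), 0 <= t <= 1 ->
  (1 - t) * u x + t * u y <= u ((1 - t) *: x + t *: y)).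
Variables (L : 'M[R]_n) (a : 'cV[R]_n).
Hypotheses (tL : is_trig_mx L) (dL : forall i, 0 < L i i).

Let lam := lebesgue_cV R n.
Let mf : measurable_fun setT f. Proof. by case: dP. Qed.
Let f0 x : 0 <= f x. Proof. by case: dP. Qed.
Let mu' : measurable_fun setT u. Proof. by case: hu. Qed.
Let Z := J P D (fun x => expR (u x)).
Let Z0 : 0 < Z. Proof. exact: (J_expR_gt0 mD PD hu). Qed.
Let detL0 : 0 < \det L. Proof. by rewrite det_trig// prodr_gt0. Qed.
Let uL : L \in unitmx. Proof. by rewrite unitmxE unitfE gt_eqF. Qed.

Let w x := \1_D x * expR (u x).
Let w0 x : 0 <= w x. Proof. by rewrite mulr_ge0 ?expR_ge0// indicE ler0n. Qed.
Let mw : measurable_fun setT w.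
Proof. by apply: measurable_funM; [exact: measurable_indic|exact: measurableT_comp]. Qed.

Let p x := \det L / Z * (w (L *m x + a) * f (L *m x + a)).

Let p0 x : 0 <= p x.
Proof. by rewrite mulr_ge0 ?divr_ge0 ?(ltW detL0) ?(ltW Z0)// mulr_ge0. Qed.

Let mp : measurable_fun setT p.
Proof.
apply: measurable_funM => //.
have mL := measurable_affine L a.
apply: measurable_funM; first exact: measurableT_comp mw mL.
exact: measurableT_comp mf mL.
Qed.

Let ZE : (\int[P]_x (w x)%:E)%E = Z%:E.
Proof.
rewrite /Z /J /Rintegral fineK; last first.
  by apply: integrable_fin_num => //; apply: (nice_integrable P mD (nice_expR hu)).
rewrite [RHS]integral_mkcond; apply: eq_integral => x _.
rewrite patchE /w indicE; case: ifPn => xD; first by rewrite mul1r.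
by rewrite mul0r.
Qed.

Let T x := invmx L *m (x - a).

Let TE y : T (L *m y + a) = y.
Proof. by rewrite /T addrK mulKmx. Qed.

Let mT : measurable_fun setT T.
Proof.
have -> : T = fun x => invmx L *m x + (- (invmx L *m a)).
  by apply/funext => x; rewrite /T mulmxBr.
exact: measurable_affine.
Qed.

Let integral_p (h : 'cV[R]_n -> \bar R) : measurable_fun setT h -> (forall x, (0 <= h x)%E) ->
  (\int[lam]_y (h y * (p y)%:E) = (Z^-1)%:E * \int[P]_x (h (T x) * (w x)%:E))%E.
Proof.
move=> mh h0.
have mhT : measurable_fun setT (h \o T) by exact: measurableT_comp.
have mhw : measurable_fun setT (fun x => (h (T x) * (w x)%:E)%E).
  by apply: emeasurable_funM => //; exact/measurable_EFinP.
have hw0 x : (0 <= h (T x) * (w x)%:E)%E by rewrite mule_ge0// lee_fin.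
have mhwf : measurable_fun setT (fun x => (h (T x) * (w x)%:E * (f x)%:E)%E).
  by apply: emeasurable_funM => //; exact/measurable_EFinP.
have [_ _ PE] := dP.
rewrite (integral_density mf f0 PE mhw hw0).
rewrite (integral_triangular a tL dL mhwf) => [|x]; last by rewrite mule_ge0// lee_fin.
rewrite muleA -EFinM -ge0_integralZl//; last 3 first.
- exact: (measurableT_comp mhwf (measurable_affine L a)).
- by move=> x _; rewrite mule_ge0// lee_fin.
- by rewrite lee_fin mulr_ge0// ltW// invr_gt0.
apply: eq_integral => y _; rewrite TE /p -muleA -EFinM muleCA -EFinM.
by rewrite [Z^-1 * _]mulrC.
Qed.

Let p1 : (\int[lam]_y (p y)%:E = 1)%E.
Proof.
have := @integral_p (cst 1%E) (measurable_cst _) (fun x => lee01).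
under eq_integral do rewrite mul1e.
under [in X in _ = X -> _]eq_integral do rewrite mul1e.
by rewrite ZE -EFinM mulVf// gt_eqF.
Qed.

(* Where it is positive, [p] is the exponential of a concave function, because
   [D] is convex and [u] and the logarithm of [f] are concave. *)
Let concave_p : concave_ereal (fun x => lne (p x)%:E).
Proof.
move=> x y t t01; have /andP[t0 t1] := t01.
have [->|tn0] := eqVneq t 0.
  by rewrite subr0 mul1e mul0e adde0 scale1r scale0r addr0.
have [->|tn1] := eqVneq t 1.
  by rewrite subrr mul0e mul1e add0e scale0r scale1r add0r.
have {}t0 : 0 < t by rewrite lt_neqAle eq_sym tn0.
have {}t1 : 0 < 1 - t by rewrite subr_gt0 lt_neqAle tn1.
have lne0 : lne (0%:E : \bar R) = -oo%E by rewrite le0_lneNy.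
have [px|px] := eqVneq (p x) 0.
  by rewrite px lne0 gt0_muleNy ?lte_fin// leNye.
have [py|py] := eqVneq (p y) 0.
  by rewrite py lne0 [X in (_ + X)%E]gt0_muleNy ?lte_fin// addeNy leNye.
pose X := L *m x + a; pose Y := L *m y + a.
have XYE : L *m ((1 - t) *: x + t *: y) + a = (1 - t) *: X + t *: Y.
  rewrite mulmxDr -!scalemxAr !scalerDr addrACA -scalerDl subrK scale1r.
  by [].
have pos v : p v != 0 -> D (L *m v + a) /\ 0 < f (L *m v + a).
  rewrite /p !mulf_eq0 !negb_or => /andP[_ /andP[/andP[h1 _] h2]]; split.
    by move: h1; rewrite indicE; case: (boolP (_ \in D)) => [/set_mem//|_]; rewrite eqxx.
  by rewrite lt_neqAle eq_sym h2 f0.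
have [DX fX] := pos _ px; have [DY fY] := pos _ py.
have DXY : D ((1 - t) *: X + t *: Y) by exact: cD.
have lnE (r : R) : 0 < r -> lne r%:E = (ln r)%:E.
  exact: lne_EFin.
have hf : ((1 - t)%:E * lne (f X)%:E + t%:E * lne (f Y)%:E <=
    lne (f ((1 - t) *: X + t *: Y))%:E)%E := cf X Y t01.
rewrite (lnE (f X) fX) (lnE (f Y) fY) -!EFinM -EFinD in hf.
have fXY : 0 < f ((1 - t) *: X + t *: Y).
  rewrite lt_neqAle f0 andbT eq_sym; apply: contraTneq hf => ->.
  by rewrite lne0.
rewrite lnE// lee_fin in hf.
have pE v : D (L *m v + a) -> p v = \det L / Z * (expR (u (L *m v + a)) * f (L *m v + a)).
  by move=> Dv; rewrite /p /w indicE mem_set// mul1r.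
have K0 : 0 < \det L / Z by rewrite divr_gt0.
have lnp v : D (L *m v + a) -> 0 < f (L *m v + a) ->
    lne (p v)%:E = (ln (\det L / Z) + (u (L *m v + a) + ln (f (L *m v + a))))%:E.
  move=> Dv fv; rewrite pE// lnE; last by rewrite mulr_gt0// mulr_gt0 ?expR_gt0.
  have e0 := expR_gt0 (u (L *m v + a)).
  by rewrite (lnM K0 (mulr_gt0 e0 fv)) (lnM e0 fv) expRK.
rewrite (lnp x)// (lnp y)// lnp ?XYE// -!EFinM -EFinD lee_fin.
have := cu X Y t01; rewrite -/X -/Y.
move: hf; set l := ln (_ / _).
move: (ln (f (_ + _))) (u (_ + _)) (ln (f X)) (ln (f Y)) (u X) (u Y) l => fxy uxy fx fy ux uy l hf hu'.
have -> : (1 - t) * (l + (ux + fx)) + t * (l + (uy + fy)) =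
  l + (((1 - t) * ux + t * uy) + ((1 - t) * fx + t * fy)) by ring.
by rewrite lerD2l lerD.
Qed.

(** The affine map [x |-> L^-1 (x - a)] transports the tilted law on [D] to a
    log-concave probability measure; expectations under the latter are tilted
    expectations. *)
Lemma normalized_law : exists mu : probability 'cV[R]_n R,
  log_concave mu /\
  forall h : 'cV[R]_n -> R, measurable_fun setT h ->
    nice D (fun x => h (invmx L *m (x - a))) ->
    ('E_mu[h] = (Ex P D u (fun x => h (invmx L *m (x - a))))%:E)%E.
Proof.
have [mu muE] := density_probability mp p0 p1.
exists mu; split; first by exists p => //; split=> //; exact: muE.
have ge0_case (h : 'cV[R]_n -> R) : measurable_fun setT h -> (forall x, 0 <= h x) -> nice D (h \o T) ->
    (\int[mu]_y (h y)%:E)%E = (Ex P D u (h \o T))%:E.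
  move=> mh h0 nh.
  have mh' : measurable_fun setT (EFin \o h) by exact/measurable_EFinP.
  rewrite (integral_density mp p0 muE mh') => [|x]; last by rewrite lee_fin.
  rewrite (integral_p mh') => [|x]; last by rewrite lee_fin.
  rewrite /Ex mulrC EFinM; congr (_ * _)%E.
  have nn : nice D (fun x => expR (u x) * (h \o T) x) by apply: niceM => //; exact: nice_expR.
  rewrite /J /Rintegral fineK; last first.
    by apply: integrable_fin_num => //; exact: (nice_integrable P mD nn).
  rewrite [RHS]integral_mkcond; apply: eq_integral => x _.
  rewrite patchE /w indicE -EFinM; case: ifPn => xD /=.
    by rewrite mul1r mulrC.
  by rewrite mul0r mulr0.
move=> h mh nh.
pose hp x := Num.max (h x) 0; pose hn x := Num.max (- h x) 0.
have mhp : measurable_fun setT hp by exact: measurable_funrpos.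
have mhn : measurable_fun setT hn by exact: measurable_funrneg.
have hE x : h x = hp x - hn x.
  rewrite /hp /hn; case: (leP (h x) 0) => hx; case: (leP (- h x) 0) => hx'; lra.
have hp0 x : 0 <= hp x by rewrite le_max lexx orbT.
have hn0 x : 0 <= hn x by rewrite le_max lexx orbT.
have [M hM] := nh.2.
have nhp : nice D (hp \o T).
  split; first exact: measurableT_comp.
  exists M => x /hM hx; rewrite [`|_|]ger0_norm ?hp0// /hp /= ge_max.
  by rewrite (le_trans (ler_norm _) hx) (le_trans _ hx).
have nhn : nice D (hn \o T).
  split; first exact: measurableT_comp.
  exists M => x /hM hx; rewrite [`|_|]ger0_norm ?hn0// /hn /= ge_max.
  by rewrite (le_trans _ hx) ?(le_trans _ hx)// -normrN ler_norm.
rewrite unlock.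
have -> : (\int[mu]_x (h x)%:E = \int[mu]_x (hp x)%:E - \int[mu]_x (hn x)%:E)%E.
  by rewrite integralE; congr (_ - _)%E; apply: eq_integral => x _;
   rewrite ?funeposE ?funenegE -EFin_max.
rewrite !ge0_case// -EFinB; congr EFin.
by rewrite -(ExB P mD hu nhp nhn); congr Ex; apply/funext => x /=; rewrite hE.
Qed.

End normalized_law.

Lemma measurable_inner (R : realType) n (w : 'cV[R]_n) :
  measurable_fun [set: 'cV[R]_n] (inner w).
Proof.
apply: measurable_sum => i; apply: measurable_funM => //.
exact: measurable_coord_cV.
Qed.

Lemma measurable_quad (R : realType) n (M : 'M[R]_n) :
  measurable_fun [set: 'cV[R]_n] (fun x => inner (M *m x) x).
Proof.
under eq_fun do rewrite inner_mulmxE.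
apply: measurable_sum => i; apply: measurable_sum => j.
apply: measurable_funM; last exact: measurable_coord_cV.
by apply: measurable_funM => //; exact: measurable_coord_cV.
Qed.

Section centred_covariance.
Context d (T : measurableType d) (R : realType) (P : probability T R) (D : set T).
Hypotheses (mD : measurable D) (PD : (0 < P D)%E).
Variables u g h : T -> R.
Hypotheses (hu : nice D u) (hg : nice D g) (hh : nice D h).

Lemma Ex_centred : Ex P D u (fun x => (g x - Ex P D u g) * (h x - Ex P D u h)) = Cv P D u g h.
Proof.
rewrite /Cv; set a := Ex P D u g; set b := Ex P D u h.
have ngh : nice D (fun x => g x * h x) by exact: niceM.
have -> : (fun x => (g x - a) * (h x - b)) =
    (fun x => g x * h x + (- b * g x + (- a * h x + a * b))).
  by apply/funext => x; ring.
have n1 : nice D (fun x => - b * g x) by apply: niceM => //; exact: nice_cst.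
have n2 : nice D (fun x => - a * h x) by apply: niceM => //; exact: nice_cst.
have n3 : nice D (fun x => - a * h x + a * b) by apply: niceD => //; exact: nice_cst.
rewrite (ExD P mD hu ngh (niceD n1 n3)) (ExD P mD hu n1 n3).
rewrite (ExD P mD hu n2 (nice_cst D _)) (ExZ P mD hu _ hg) (ExZ P mD hu _ hh).
by rewrite (Ex_cst mD PD hu) -/a -/b; ring.
Qed.

Lemma Cv_shift a b : Cv P D u (fun x => g x + a) (fun x => h x + b) = Cv P D u g h.
Proof.
have na := nice_cst D a; have nb := nice_cst D b.
have nhb : nice D (fun x => h x + b) by exact: niceD.
rewrite (CvDl P mD hu hg na nhb) (Cv_cst mD PD hu a nhb) addr0.
rewrite (CvDr P mD hu hh nb hg) [X in _ + X]CvC (Cv_cst mD PD hu b hg).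
exact: addr0.
Qed.

End centred_covariance.

Section tilted_laws.
Context (R : realType) (n : nat).
Variables (P : probability 'cV[R]_n R) (f : 'cV[R]_n -> R) (D : set 'cV[R]_n).
Hypotheses (dP : is_density P f) (cf : concave_ereal (fun x => lne (f x)%:E)).
Hypotheses (mD : measurable D) (PD : (0 < P D)%E).
Hypothesis cD : forall x y (t : R), 0 <= t <= 1 -> D x -> D y ->
  D ((1 - t) *: x + t *: y).
Variable c : 'cV[R]_n.
Let z (x : 'cV[R]_n) := x - c.
Hypothesis nz : forall i, nice D (fun x => z x i ord0).
Variables (s : R) (b : 'cV[R]_n) (B : 'M[R]_n).
Hypothesis sB : psd (s%:M - B).

Let u := wt z s b B.
Let hu : nice D u. Proof. exact: nice_wt. Qed.

Let uE x : u x = inner b (z x) - inner ((s%:M - B) *m z x) (z x).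
Proof. by rewrite mulmxBl innerBl mul_scalar_mx innerZl /u /wt; ring. Qed.

Let cu x y (t : R) : 0 <= t <= 1 ->
  (1 - t) * u x + t * u y <= u ((1 - t) *: x + t *: y).
Proof.
move=> /andP[t0 t1]; rewrite !uE.
have -> : z ((1 - t) *: x + t *: y) = (1 - t) *: z x + t *: z y.
  by rewrite /z !scalerBr addrACA -opprD -scalerDl subrK scale1r.
move: sB (z x) (z y); set S := s%:M - B => -[sS hS] v w.
have h : 0 <= inner (S *m v) v - 2 * inner (S *m v) w + inner (S *m w) w.
  have := hS (v - w); rewrite mulmxBr innerBl !innerBr (inner_sym w v sS).
  by move=> /le_trans; apply; rewrite le_eqVlt; apply/orP; left; apply/eqP; ring.
have {}h : 0 <= t * (1 - t) * (inner (S *m v) v - 2 * inner (S *m v) w + inner (S *m w) w).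
  by apply: mulr_ge0 => //; apply: mulr_ge0 => //; rewrite subr_ge0.
rewrite -subr_ge0; apply: (le_trans h); rewrite le_eqVlt; apply/orP; left; apply/eqP.
rewrite mulmxDr -!scalemxAr !(innerDl, innerDr, innerZl, innerZr) (inner_sym w v sS).
by ring.
Qed.

(** If the variance of [<w, z>] vanished, [D] would be contained, up to a null
    set, in a hyperplane, which a measure with a density does not charge. *)
Lemma posdef_cv : posdef (cv P D z u).
Proof.
split=> [|w w0]; first exact: cv_sym.
rewrite -(Cv_inner2 mD PD nz hu).
have nw : nice D (fun x => inner w (z x)) by exact: nice_inner.
rewrite lt_neqAle (Cv_ge0 mD PD hu nw) andbT eq_sym.
rewrite (CvE mD PD hu nw); set e := Ex _ _ _ (fun x => inner w (z x)).
rewrite /Ex; apply: mulf_neq0; last first.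
  by rewrite invr_neq0// gt_eqF// (J_expR_gt0 mD PD hu).
have nq : nice D (fun x => expR (u x) * (inner w (z x) - e) ^+ 2).
  by apply: niceM; [exact: nice_expR|apply: niceX; apply: niceB => //; exact: nice_cst].
apply/eqP => J0.
have q0 x : 0 <= expR (u x) * (inner w (z x) - e) ^+ 2.
  by rewrite mulr_ge0 ?expR_ge0 ?sqr_ge0.
have i0 : (\int[P]_(x in D) `|(expR (u x) * (inner w (z x) - e) ^+ 2)%:E| = 0)%E.
  under eq_integral do rewrite gee0_abs ?lee_fin//.
  rewrite -[LHS]fineK; first by rewrite [X in X%:E]J0.
  by apply: integrable_fin_num => //; exact: (nice_integrable P mD nq).
have mq : measurable_fun D (fun x => (expR (u x) * (inner w (z x) - e) ^+ 2)%:E).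
  by apply/measurable_EFinP; apply: measurable_funTS; exact: nq.1.
have [N [mN N0 hN]] := (ae_eq_integral_abs P mD mq).1 i0.
pose H := [set x | inner w x = e + inner w c].
have mH : measurable H.
  rewrite -[H]setTI; exact: (measurable_inner w measurableT (measurable_set1 (e + inner w c))).
have PH : P H = 0%E.
  have [mf _ ->//] := dP.
  apply: null_set_integral => //; last exact: lebesgue_hyperplane.
  by apply/measurable_EFinP; exact: measurable_funTS.
have : (P D <= P N + P H)%E.
  apply: (@le_trans _ _ (P (N `|` H))); last exact: measureU2.
  apply: le_measure; [exact/mem_set|exact/mem_set/measurableU|].
  move=> x Dx; have [xN|xN] := pselect (N x); [by left|right].
  have : (expR (u x) * (inner w (z x) - e) ^+ 2)%:E = 0%E.
    by apply: contrapT => h; apply: xN; apply: hN => /(_ Dx).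
  move=> [] /eqP; rewrite mulf_eq0 gt_eqF ?expR_gt0//= sqrf_eq0 subr_eq0 => /eqP.
  by rewrite /z innerBr => xe; rewrite /H/= -xe subrK.
by rewrite N0 PH adde0 leNgt PD.
Qed.

Variable K : R.
Hypothesis hyp : forall (mu : probability 'cV[R]_n R) (M : 'M[R]_n),
      isotropic mu -> log_concave mu -> M^T = M ->
      ('V_mu[fun y : 'cV[R]_n => inner (M *m y) y]
         <= (K * \tr (M ^+ 2))%:E)%E.

(** With [A = L L^T] the tilted law becomes isotropic under
    [x |-> L^-1 (z - m)], which turns the quadratic form of [N] into that of
    [L^T N L]. *)
Lemma var_quad_tilted (N : 'M[R]_n) : N^T = N ->
  let A := cv P D z u in let m := mn P D z u in
  let q x := inner (N *m (z x - m)) (z x - m) in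
  Cv P D u q q <= K * \tr (N *m A *m N *m A).
Proof.
move=> sN; cbv zeta; set A := cv P D z u; set m := mn P D z u.
set q : 'cV[R]_n -> R := fun x => _.
have [L [tL dL AE]] := posdef_Cholesky posdef_cv.
have uL : L \in unitmx by rewrite unitmxE unitfE gt_eqF// det_trig// prodr_gt0.
have uLT : L^T \in unitmx by rewrite unitmx_tr.
pose T x := invmx L *m (x - (c + m)).
have [mu [lmu Emu]] := normalized_law dP cf mD PD cD hu cu (c + m) tL dL.
have TE x : T x = invmx L *m (z x - m) by rewrite /T /z opprD addrA.
pose r i : 'cV[R]_n := (row i (invmx L))^T.
have rE i v : inner (r i) v = (invmx L *m v) i ord0.
  by rewrite mxE; apply: eq_bigr => j _; rewrite /r mxE mxE.
have TiE i : (fun x => T x i ord0) = (fun x => inner (r i) (z x) - inner (r i) m).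
  by apply/funext => x; rewrite TE -rE innerBr.
have nr i : nice D (fun x => inner (r i) (z x)) by exact: nice_inner.
have nT i : nice D (fun x => T x i ord0).
  by rewrite TiE; apply: niceB => //; exact: nice_cst.
have covE g h : measurable_fun setT g -> measurable_fun setT h ->
    nice D (fun x => g (T x)) -> nice D (fun x => h (T x)) ->
    covariance mu g h = (Cv P D u (fun x => g (T x)) (fun x => h (T x)))%:E.
  move=> mg mh ng nh; rewrite covariance.unlock.
  rewrite (Emu g mg ng) (Emu h mh nh) /=.
  rewrite -(Ex_centred mD PD hu ng nh).
  set eg := Ex P D u (fun x => g (T x)); set eh := Ex P D u (fun x => h (T x)).
  apply: (Emu (fun y => (g y - eg) * (h y - eh))).
    by apply: measurable_funM; apply: measurable_funB.
  by apply: niceM; [exact: niceB ng (nice_cst D eg)|exact: niceB nh (nice_cst D eh)].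
have iso : isotropic mu.
  split.
    apply/colP => i; rewrite mxE [RHS]mxE.
    rewrite (Emu (fun y => y i ord0) (measurable_coord_cV i) (nT i)).
    rewrite /= -/(T _) TiE (ExB P mD hu (nr i) (nice_cst D _)).
    by rewrite (Ex_cst mD PD hu) (Ex_inner mD PD nz hu) subrr.
  apply/matrixP => i j; rewrite mxE covE//; try exact: measurable_coord_cV.
  rewrite /= !TiE (Cv_shift mD PD hu (nr i) (nr j)).
  rewrite (Cv_inner2 mD PD nz hu) -/A innerC rE.
  have -> : invmx L *m (A *m r j) = col j (invmx L *m A *m (invmx L)^T).
    by rewrite /r tr_row !colE !mulmxA.
  by rewrite mxE /A AE mulmxA mulVmx// mul1mx trmx_inv mulmxV.
have sM : (L^T *m N *m L)^T = L^T *m N *m L.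
  by rewrite !trmx_mul trmxK sN mulmxA.
have := hyp iso lmu sM.
have qE : (fun x => inner (L^T *m N *m L *m T x) (T x)) = q.
  apply/funext => x; rewrite TE /q -!mulmxA mulKVmx//.
  by rewrite inner_mull trmxK mulKVmx.
have nq : nice D q.
  have n1 i : nice D (fun x => (z x - m) i ord0).
    under eq_fun do rewrite mxE [in X in _ + X]mxE.
    exact: niceB (nz i) (nice_cst D _).
  exact: (nice_quad n1 N).
rewrite /variance covE; try exact: measurable_quad; try by rewrite qE.
rewrite qE lee_fin => /le_trans; apply; rewrite le_eqVlt; apply/orP; left.
apply/eqP; congr (_ * _).
have -> : (L^T *m N *m L) ^+ 2 = L^T *m (N *m L *m L^T *m N *m L).
  transitivity ((L^T *m N *m L) *m (L^T *m N *m L)) => //.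
  by rewrite !mulmxA.
by rewrite mxtrace_mulC /A AE !mulmxA.
Qed.

End tilted_laws.

(** * Moment bounds on a bounded convex set *)

Section bounded_convex_domain.
Context (R : realType) (n : nat).
Variables (P : probability 'cV[R]_n R) (f : 'cV[R]_n -> R) (D : set 'cV[R]_n).
Hypotheses (dP : is_density P f) (cf : concave_ereal (fun x => lne (f x)%:E)).
Hypotheses (mD : measurable D) (PD : (0 < P D)%E).
Hypothesis cD : forall x y (t : R), 0 <= t <= 1 -> D x -> D y ->
  D ((1 - t) *: x + t *: y).
Hypothesis nx : forall i, nice D (fun x : 'cV[R]_n => x i ord0).
Variable K : R.
Hypothesis hyp : forall (mu : probability 'cV[R]_n R) (M : 'M[R]_n),
      isotropic mu -> log_concave mu -> M^T = M ->
      ('V_mu[fun y : 'cV[R]_n => inner (M *m y) y]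
         <= (K * \tr (M ^+ 2))%:E)%E.

Let o (x : 'cV[R]_n) : R := 0.
Let c := mn P D id o.
Let A := cv P D id o.
Let z (x : 'cV[R]_n) := x - c.
Let no : nice D o. Proof. exact: nice_cst. Qed.

Let zE i : (fun x => z x i ord0) = (fun x => x i ord0 + - c i ord0).
Proof. by apply/funext => x; rewrite /z mxE [in X in _ + X]mxE. Qed.

Let nz i : nice D (fun x => z x i ord0).
Proof. rewrite zE; exact: niceD (nx i) (nice_cst D _). Qed.

Let mn0 : mn P D z o = 0.
Proof.
apply/colP => i; rewrite [LHS]mxE [RHS]mxE zE.
rewrite (ExD P mD no (nx i) (nice_cst D _)) (Ex_cst mD PD no).
by rewrite /c [in X in _ - X]mxE subrr.
Qed.

Let cvE : cv P D z o = A.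
Proof.
apply/matrixP => i j; rewrite [LHS]mxE [RHS]mxE !zE.
exact: Cv_shift.
Qed.

(* The untilted law is the member [b = 0], [B = s] of the family. *)
Let wt_start s : wt z s 0 s%:M = o.
Proof.
apply/funext => x; rewrite /wt inner0l mul_scalar_mx innerZl sub0r addNr.
by [].
Qed.

Let ratio (a b l d m q : R) (k : R) : 0 < k -> 0 < q ->
  a <= b - d / k -> m / q * l <= d -> a - b <= - (m / (k * q) * l).
Proof.
move=> k0 q0 h1 h2; have : m / (k * q) * l <= d / k.
  rewrite ler_pdivlMr//; apply: le_trans h2; rewrite le_eqVlt; apply/orP; left.
  by apply/eqP; field; rewrite !gt_eqF.
by lra.
Qed.

(** The Laplace transform bound on [D], the determinant being replaced by its
    lower bound in terms of traces. *)
Lemma exp_moment_convex (s k : R) : 0 < s -> 0 < k -> K < k ->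
  0 < \tr A -> 0 < \tr (A *m A) ->
  Ex P D o (fun x => expR (- (s * inner (x - c) (x - c)))) <=
  expR (- (\tr A ^+ 2 / (k * \tr (A *m A)) * ln (1 + k * s * (\tr (A *m A) / \tr A)))).
Proof.
move=> s0 k0 Kk m0 q0.
have := @exp_moment_le _ _ _ P D mD PD n z nz s k K s0 k0 Kk.
have h1 b B : between s B -> posdef (cv P D z (wt z s b B)).
  by move=> hB; exact: (posdef_cv dP mD PD nz s b B).
have h2 b B N : between s B -> N^T = N -> _ :=
  fun hB => var_quad_tilted dP cf mD PD cD nz b hB.2 hyp (N := N).
move=> /(_ h1 h2 mn0); rewrite -/o cvE => h.
have pA : psd A.
  rewrite -cvE -(wt_start s); apply: posdef_psd; apply: h1; exact: between_s.
have hd := ln_det_ge pA m0 q0 (ltW (mulr_gt0 k0 s0)).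
have nf : nice D (fun x => - (s * inner (z x) (z x))).
  by apply: niceN; apply: niceM; [exact: nice_cst|exact: nice_norm2].
have Jf := J_expR_gt0 mD PD nf.
have J1 := J1_gt0 mD PD.
have -> : Ex P D o (fun x => expR (- (s * inner (x - c) (x - c)))) =
    J P D (fun x => expR (- (s * inner (z x) (z x)))) / J P D (fun=> 1).
  rewrite /Ex; congr (_ / _); apply: eq_J => x _; rewrite /o expR0//.
  exact: mul1r.
rewrite -ler_ln ?posrE ?divr_gt0 ?expR_gt0// expRK ln_div ?posrE//.
exact: (ratio k0 q0 h hd).
Qed.

(** The quadratic form is [<N z, z> = z_i^2], that is, [N] is the projection on
    the [i]-th coordinate. *)
Lemma fourth_moment_convex i :
  Ex P D o (fun x => (x i ord0 - c i ord0) ^+ 4) <= (1 + K) * (A i i) ^+ 2.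
Proof.
pose N : 'M[R]_n := delta_mx i i.
have sN : N^T = N by rewrite /N trmx_delta.
have b1 := between_s n (@ltr01 R).
have := var_quad_tilted dP cf mD PD cD nz 0 b1.2 hyp sN.
cbv zeta; rewrite wt_start mn0 cvE.
have -> : \tr (N *m A *m N *m A) = A i i ^+ 2.
  pose e : 'cV[R]_n := delta_mx i ord0.
  have NE : N = e *m e^T by rewrite /e trmx_delta mul_delta_mx.
  have eAe : e^T *m A *m e = (A i i)%:M.
    rewrite /e trmx_delta -rowE -colE [LHS]mx11_scalar; congr (_%:M).
    by rewrite !mxE.
  have NAN : N *m A *m N = A i i *: N.
    transitivity (e *m (e^T *m A *m e) *m e^T); first by rewrite NE !mulmxA.
    by rewrite eAe mul_mx_scalar -scalemxAl NE.
  rewrite NAN -scalemxAl mxtraceZ NE -mulmxA mxtrace_mulC eAe.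
  by rewrite mxtrace_scalar mulr1n expr2.
have qE : (fun x : 'cV[R]_n => inner (N *m (x - c - 0)) (x - c - 0)) =
    (fun x => (x i ord0 - c i ord0) ^+ 2).
  apply/funext => x; rewrite subr0 inner_mulmxE (bigD1 i)//= (bigD1 i)//=.
  rewrite big1 => [|j ji]; last by rewrite mxE (negbTE ji) ?andbF ?andFb !mul0r.
  rewrite big1 => [|j ji]; last first.
    by rewrite big1// => j' _; rewrite mxE (negbTE ji) ?andbF ?andFb !mul0r.
  by rewrite mxE !eqxx mul1r !mxE !addr0 expr2.
rewrite qE /Cv.
have -> : Ex P D o (fun x => (x i ord0 - c i ord0) ^+ 2) = A i i.
  have -> : A i i = Cv P D o (fun x => x i ord0) (fun x => x i ord0) by rewrite /A mxE.
  rewrite (CvE mD PD no (nx i)) /c; congr Ex; apply/funext => x.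
  by rewrite [in LHS]mxE.
have -> : (fun x : 'cV[R]_n => (x i ord0 - c i ord0) ^+ 2 * (x i ord0 - c i ord0) ^+ 2)
    = fun x => (x i ord0 - c i ord0) ^+ 4.
  by apply/funext => x; rewrite -exprD.
by move: (Ex _ _ _ _) (A i i) => u v; nra.
Qed.

End bounded_convex_domain.

Section truncation.
Context d (T : measurableType d) (R : realType) (P : probability T R) (D : set T).
Hypotheses (mD : measurable D) (PD : (0 < P D)%E).
Variables u X h : T -> R.
Hypotheses (hu : nice D u) (hX : nice D X) (hh : nice D h).
Variables (C r : R).
Hypotheses (C0 : 0 < C) (r0 : 0 <= r) (h0 : forall x, D x -> 0 <= h x).
Hypothesis Xh : forall x, D x -> X x ^+ 2 <= r \/ h x = 1.
Hypothesis hC : 4 * C * Ex P D u h <= 1.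
Hypothesis X4 : Ex P D u (fun x => X x ^+ 4) <= C * Ex P D u (fun x => X x ^+ 2) ^+ 2.

(** If [E X^4 <= C (E X^2)^2], the part of [E X^2] coming from an event of
    probability at most [1/(4 C)] is at most [E X^2 / 2].  So a bound [r] for
    [X^2] outside such an event bounds [E X^2]; the function [h] stands for the
    indicator of the event. *)
Lemma second_moment_le : Ex P D u (fun x => X x ^+ 2) <= 2 * r.
Proof.
have n2 : nice D (fun x => X x ^+ 2) by exact: niceX.
have n4 : nice D (fun x => X x ^+ 4) by exact: niceX.
move: X4; set w := Ex P D u (fun x => X x ^+ 2) => X4'.
have [w0|w0] := leP w 0; first by apply: (le_trans w0); apply: mulr_ge0.
(* On the exceptional event, [y <= l/2 + y^2/(2 l)] for [y = X^2]; this [l]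
   balances the two terms. *)
pose l := 2 * C * w; have l0 : 0 < l by apply: mulr_gt0 => //; apply: mulr_gt0.
have n5 : nice D (fun x => l / 2 * h x) by apply: niceM => //; exact: nice_cst.
have n6 : nice D (fun x => (2 * l)^-1 * X x ^+ 4) by apply: niceM => //; exact: nice_cst.
have nr := nice_cst D r.
have : w <= r + (l / 2 * Ex P D u h + (2 * l)^-1 * Ex P D u (fun x => X x ^+ 4)).
  rewrite -(ExZ P mD hu _ hh) -(ExZ P mD hu _ n4) -(ExD P mD hu n5 n6).
  rewrite -[X in X + _](Ex_cst mD PD hu) -(ExD P mD hu nr (niceD n5 n6)).
  apply: (le_Ex mD PD hu n2 (niceD nr (niceD n5 n6))) => x Dx.
  have x4 : X x ^+ 4 = (X x ^+ 2) ^+ 2 by rewrite -exprM.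
  have [hx|hx] := Xh Dx.
    apply: (le_trans hx); rewrite lerDl; apply: addr_ge0; apply: mulr_ge0.
    - by rewrite divr_ge0// ltW.
    - exact: h0.
    - by rewrite invr_ge0 mulr_ge0// ltW.
    - by rewrite x4 sqr_ge0.
  rewrite hx mulr1 x4; move: (X x ^+ 2) => y.
  have : 0 <= (2 * l)^-1 * (l - y) ^+ 2 by rewrite mulr_ge0 ?sqr_ge0// invr_ge0 mulr_ge0// ltW.
  have -> : (2 * l)^-1 * (l - y) ^+ 2 = l / 2 - y + (2 * l)^-1 * y ^+ 2.
    by field; rewrite gt_eqF.
  by move: ((2 * l)^-1 * y ^+ 2) (l / 2) => v m; rewrite addrAC subr_ge0 => /le_trans; apply; rewrite lerDr.
have h1 : l / 2 * Ex P D u h <= w / 4.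
  have -> : l / 2 * Ex P D u h = (w / 4) * (4 * C * Ex P D u h) by rewrite /l; field.
  by rewrite ler_piMr// divr_ge0// ltW.
have h2 : (2 * l)^-1 * Ex P D u (fun x => X x ^+ 4) <= w / 4.
  rewrite [leLHS]mulrC ler_pdivrMr; last by apply: mulr_gt0.
  apply: (le_trans X4').
  by rewrite /l le_eqVlt; apply/orP; left; apply/eqP; field.
by lra.
Qed.

End truncation.

(** * Exhaustion of the space by cubes *)

Section cubes.
Context (R : realType) (n : nat).

Definition cube (N : nat) : set 'cV[R]_n := [set x | forall i, `|x i ord0| <= N%:R].

Lemma measurable_cube N : measurable (cube N).
Proof.
have -> : cube N = \bigcap_(i in [set: 'I_n]) [set x : 'cV[R]_n | `|x i ord0| <= N%:R].
  by apply/seteqP; split => x /= h i; [move=> _; exact: h|exact: (h i I)].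
apply: fin_bigcap_measurable => [|i _]; first exact: finite_finset.
have -> : [set x : 'cV[R]_n | `|x i ord0| <= N%:R] =
   (fun x : 'cV[R]_n => x i ord0) @^-1` `[- N%:R, N%:R]%classic.
  by apply/seteqP; split=> x /=; rewrite in_itv/= ler_norml.
by rewrite -[X in measurable X]setTI; exact: measurable_coord_cV.
Qed.

Lemma convex_cube N x y (t : R) : 0 <= t <= 1 -> cube N x -> cube N y ->
  cube N ((1 - t) *: x + t *: y).
Proof.
move=> /andP[t0 t1] hx hy i; rewrite !mxE (le_trans (ler_normD _ _))// !normrM.
have t1' : 0 <= 1 - t by rewrite subr_ge0.
rewrite (ger0_norm t0) (ger0_norm t1').
have -> : N%:R = (1 - t) * N%:R + t * N%:R :> R by ring.
by apply: lerD; rewrite ler_wpM2l.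
Qed.

Lemma le_cube N M : (N <= M)%N -> cube N `<=` cube M.
Proof. by move=> NM x hx i; rewrite (le_trans (hx i))// ler_nat. Qed.

Lemma cube_near x : \forall N \near \oo, cube N x.
Proof.
exists (Num.truncn (\sum_i `|x i ord0|)).+1 => // N /= hN i.
apply: (@le_trans _ _ (\sum_i `|x i ord0|)).
  by rewrite (bigD1 i)//= lerDl sumr_ge0.
by rewrite ltW// (lt_le_trans (truncnS_gt _))// ler_nat.
Qed.

Lemma bigcup_cube : \bigcup_N cube N = setT.
Proof.
by apply/seteqP; split=> // x _; have [N _ hN] := cube_near x; exists N => //; apply: hN => /=.
Qed.

Lemma nice_coord_cube N i : nice (cube N) (fun x : 'cV[R]_n => x i ord0).
Proof. by split; [exact: measurable_coord_cV|exists N%:R => x]. Qed.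

Lemma cvg_cube (P : probability 'cV[R]_n R) : P (cube N) @[N --> \oo] --> 1%E.
Proof.
rewrite -(probability_setT P) -bigcup_cube.
apply: nondecreasing_cvg_mu => //; first exact: measurable_cube.
  by apply: bigcup_measurable => N _; exact: measurable_cube.
by move=> N M NM; apply/subsetPset/le_cube.
Qed.

Lemma cube_prob_near (P : probability 'cV[R]_n R) (e : R) : 0 < e ->
  \forall N \near \oo, ((1 - e)%:E < P (cube N))%E.
Proof.
move=> e0; have /fine_cvgP[] := @cvg_cube P.
move=> _ /(cvgr_gt 1)/(_ (1 - e)); rewrite gtrBl => /(_ e0).
apply: filterS => N /=; rewrite -lte_fin fineK//.
by apply: fin_num_measure; exact: measurable_cube.
Qed.

End cubes.

Lemma J_indic d (T : measurableType d) (R : realType) (P : probability T R)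
    (D E : set T) : measurable D -> measurable E ->
  J P D (\1_E) = fine (P (E `&` D)).
Proof. by move=> mD mE; rewrite /J /Rintegral integral_indic. Qed.

Section second_moments.
Context (R : realType) (n : nat).
Variables (P : probability 'cV[R]_n R) (f : 'cV[R]_n -> R).
Hypotheses (dP : is_density P f) (cf : concave_ereal (fun x => lne (f x)%:E)).
Variable K : R.
Hypothesis K0 : 0 <= K.
Hypothesis hyp : forall (mu : probability 'cV[R]_n R) (M : 'M[R]_n),
      isotropic mu -> log_concave mu -> M^T = M ->
      ('V_mu[fun y : 'cV[R]_n => inner (M *m y) y]
         <= (K * \tr (M ^+ 2))%:E)%E.

Let o (x : 'cV[R]_n) : R := 0.
Let mc N := @measurable_cube R n N.

Let C := 8 * (1 + K).
Let C8 : 8 <= C. Proof. by rewrite /C mulrDr mulr1 lerDl mulr_ge0. Qed.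

(* From centred moments to moments, by [y^4 <= 8 (y - a)^4 + 8 a^4]. *)
Let fourth N i : (0 < P (cube N))%E ->
  Ex P (cube N) o (fun x => x i ord0 ^+ 4) <=
  C * Ex P (cube N) o (fun x => x i ord0 ^+ 2) ^+ 2.
Proof.
move=> PN; have nx := @nice_coord_cube R n N.
have no : nice (cube N) o by exact: nice_cst.
have := fourth_moment_convex dP cf (mc N) PN (@convex_cube R n N) nx hyp i.
set a := Ex P (cube N) o (fun x => x i ord0).
set v := Cv P (cube N) o (fun x => x i ord0) (fun x => x i ord0).
have -> : mn P (cube N) id o i ord0 = a by rewrite mxE.
have -> : cv P (cube N) id o i i = v by rewrite mxE.
move=> h.
have vE : Ex P (cube N) o (fun x => x i ord0 ^+ 2) = v + a ^+ 2.
  by rewrite /v /Cv -/a (expr2 a) subrK; congr Ex.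
have v0 : 0 <= v by exact: (Cv_ge0 (mc N) PN no (nx i)).
have n1 : nice (cube N) (fun x => 8 * (x i ord0 - a) ^+ 4).
  apply: niceM; first exact: nice_cst.
  apply: niceX; exact: niceB (nx i) (nice_cst _ _).
have n2 : nice (cube N) (fun x => (x i ord0 - a) ^+ 4).
  apply: niceX; exact: niceB (nx i) (nice_cst _ _).
have : Ex P (cube N) o (fun x => x i ord0 ^+ 4) <=
    8 * Ex P (cube N) o (fun x => (x i ord0 - a) ^+ 4) + 8 * a ^+ 4.
  rewrite -(ExZ P (mc N) no _ n2) -[X in _ + X](Ex_cst (mc N) PN no).
  rewrite -(ExD P (mc N) no n1 (nice_cst _ _)).
  apply: (le_Ex (mc N) PN no (niceX 4 (nx i)) (niceD n1 (nice_cst _ _))) => x _.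
  move: (x i ord0) => y; rewrite -subr_ge0.
  have -> : 8 * (y - a) ^+ 4 + 8 * a ^+ 4 - y ^+ 4 = 4 * ((y - a) ^+ 2 - a ^+ 2) ^+ 2 +
      (y - 2 * a) ^+ 2 * (2 * ((y - a) ^+ 2 + a ^+ 2) + y ^+ 2).
    by move: (a) => b; ring.
  apply: addr_ge0; first by rewrite mulr_ge0 ?sqr_ge0.
  rewrite mulr_ge0 ?sqr_ge0// addr_ge0 ?sqr_ge0//.
  by rewrite mulr_ge0// addr_ge0 ?sqr_ge0.
rewrite vE => /le_trans; apply.
have a4 : a ^+ 4 = (a ^+ 2) ^+ 2 by rewrite -exprM.
rewrite a4; move: (Ex _ _ _ _) (a ^+ 2) (sqr_ge0 a) h => e b b0 h.
apply: (@le_trans _ _ (8 * ((1 + K) * v ^+ 2) + 8 * b ^+ 2)); first by lra.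
have -> : C * (v + b) ^+ 2 = 8 * ((1 + K) * v ^+ 2) + 8 * b ^+ 2 + (8 * K * b ^+ 2 + 2 * C * (v * b)).
  by rewrite /C; ring.
rewrite lerDl; apply: addr_ge0; first by rewrite !mulr_ge0 ?sqr_ge0.
have C0 : 0 <= C := le_trans (ler0n _ 8) C8.
by apply: mulr_ge0; apply: mulr_ge0.
Qed.

(** The constant in the comparison of fourth and second moments does not depend
    on the cube, so that the exceptional event can be the complement of one
    fixed cube of large enough probability. *)
Lemma second_moment_cube : exists B, 0 <= B /\ \forall N \near \oo,
  (0 < P (cube N))%E /\ forall i, J P (cube N) (fun x => x i ord0 ^+ 2) <= B.
Proof.
have C0 : 0 < C by rewrite (lt_le_trans _ C8).
have C80 : 0 < 8 * C by exact: mulr_gt0.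
pose dl := (8 * C)^-1; have d0 : 0 < dl by rewrite invr_gt0.
have [M _ hM] := cube_prob_near P d0.
have {}hM : ((1 - dl)%:E < P (cube M))%E by apply: hM => /=.
pose pM := fine (P (cube M)).
have fin N : P (cube N) \is a fin_num by exact: fin_num_measure.
have pM1 : 1 - dl < pM by rewrite -lte_fin fineK.
have d8 : dl <= 1 / 2.
  rewrite /dl div1r lef_pV2 ?posrE//.
  by apply: (@le_trans _ _ (8 * 8)); [lra|exact: ler_wpM2l].
exists (2 * M%:R ^+ 2); split; first by rewrite mulr_ge0 ?sqr_ge0.
exists M => // N /= MN.
have MNc := @le_cube R n M N MN.
have pMN : (P (cube M) <= P (cube N))%E.
  by apply: le_measure => //; apply/mem_set; exact: mc.
have J1E : J P (cube N) (fun=> 1) = fine (P (cube N)).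
  by rewrite /J Rintegral_cst// mul1r.
have J1M : pM <= J P (cube N) (fun=> 1) by rewrite J1E fine_le.
have J1le : J P (cube N) (fun=> 1) <= 1.
  by rewrite J1E -lee_fin fineK// probability_le1.
have PN : (0 < P (cube N))%E.
  by apply: lt_le_trans pMN; apply: le_lt_trans hM; rewrite lee_fin; lra.
split=> [//|i]; have nx := @nice_coord_cube R n N.
have no : nice (cube N) o by exact: nice_cst.
pose h (x : 'cV[R]_n) : R := 1 - \1_(@cube R n M) x.
have n1 : nice (cube N) (\1_(cube M) : 'cV[R]_n -> R).
  split; first exact: measurable_indic.
  by exists 1 => x _; rewrite indicE; case: (_ \in _); rewrite ?normr1 ?normr0.
have nh : nice (cube N) h by exact: niceB (nice_cst _ _) n1.
have JhE : J P (cube N) h <= dl.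
  rewrite (JB P (mc N) (nice_cst _ 1) n1) J_indic// setIidl// -/pM.
  by move: J1le pM1; lra.
have hE x : h x = 0 \/ h x = 1.
  by rewrite /h indicE; case: (_ \in _); rewrite ?subrr ?subr0; [left|right].
have JEx g : Ex P (cube N) o g = J P (cube N) g / J P (cube N) (fun=> 1).
  rewrite /Ex; congr (_ / _); apply: eq_J => x _; rewrite /o expR0//.
  exact: mul1r.
have J1p : 1 / 2 <= J P (cube N) (fun=> 1) by apply: le_trans J1M; lra.
have J10 : 0 < J P (cube N) (fun=> 1) by apply: lt_le_trans J1p.
have : Ex P (cube N) o (fun x => x i ord0 ^+ 2) <= 2 * M%:R ^+ 2.
  apply: (second_moment_le (mc N) PN no (nx i) nh C0 (sqr_ge0 _)).
  - by move=> x _; have [->|->] := hE x.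
  - move=> x _; rewrite /h indicE; case: (boolP (_ \in _)) => [/set_mem hx|_].
      by left; rewrite -real_normK ?num_real// ler_pXn2r ?nnegrE.
    by right; rewrite subr0.
  - rewrite JEx mulrA ler_pdivrMr// mul1r.
    apply: le_trans J1p; apply: (@le_trans _ _ (4 * C * dl)); last first.
      by rewrite /dl le_eqVlt; apply/orP; left; apply/eqP; field; rewrite gt_eqF.
    by rewrite ler_wpM2l// mulr_ge0// ltW.
  - exact: fourth.
rewrite JEx ler_pdivrMr// => /le_trans; apply.
by rewrite ler_piMr// mulr_ge0 ?sqr_ge0.
Qed.

End second_moments.

Section exhaustion.
Context (R : realType) (n : nat) (P : probability 'cV[R]_n R).
Let mc N := @measurable_cube R n N.

Lemma integrable_of_cubes (g : 'cV[R]_n -> R) (B : R) :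
  measurable_fun setT g -> (forall x, 0 <= g x) ->
  (forall N, nice (cube N) g) ->
  (\forall N \near \oo, J P (cube N) g <= B) ->
  P.-integrable setT (EFin \o g).
Proof.
move=> mg g0 ng hB.
have mEg : measurable_fun setT (EFin \o g) by exact/measurable_EFinP.
pose G N := (EFin \o g) \_ (cube N).
have GE N x : G N x = if x \in cube N then (g x)%:E else 0%E by rewrite /G patchE.
apply/integrableP; split=> //.
have mG N : measurable_fun setT (G N).
  by apply/(measurable_restrictT _ (mc N)); exact: measurable_funTS.
have G0 N x : setT x -> (0 <= G N x)%E.
  by rewrite GE; case: ifP => // _; rewrite lee_fin.
have ndG x : setT x -> {homo G ^~ x : N M / (N <= M)%N >-> (N <= M)%E}.
  move=> _ N M NM; rewrite !GE; case: ifPn => [/set_mem hN|_].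
    by rewrite mem_set//; exact: le_cube NM _ hN.
  by case: ifP => // _; rewrite lee_fin.
have GJ N : (\int[P]_x G N x = (J P (cube N) g)%:E)%E.
  rewrite /J /Rintegral fineK; first by rewrite [RHS]integral_mkcond.
  by apply: integrable_fin_num => //; exact: (nice_integrable P (mc N) (ng N)).
have := @cvg_monotone_convergence _ _ _ P setT measurableT G mG G0 ndG.
have -> : (fun x => limn (G^~ x)) = EFin \o g.
  apply/funext => x; apply/cvg_lim => //; apply: cvg_near_cst.
  by apply: filterS (cube_near x) => N hN; rewrite GE mem_set.
move=> cG; have -> : (\int[P]_x `|(EFin \o g) x| = \int[P]_x (EFin \o g) x)%E.
  by apply: eq_integral => x _; rewrite gee0_abs// lee_fin.
apply: (@le_lt_trans _ _ B%:E); last exact: ltry.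
rewrite -(cvg_lim _ cG)//; apply: lime_le; first by apply/cvg_ex; eexists; exact: cG.
by apply: filterS hB => N hN; rewrite GJ lee_fin.
Qed.

(** Dominated convergence for expectations conditioned to growing cubes. *)
Lemma cvg_Ex_cube (f_ : nat -> 'cV[R]_n -> R) (F g : 'cV[R]_n -> R) :
  (forall N, measurable_fun setT (f_ N)) ->
  P.-integrable setT (EFin \o g) ->
  (forall N x, `|f_ N x| <= g x) ->
  (forall x, f_ N x @[N --> \oo] --> F x) ->
  Ex P (cube N) (fun=> 0) (f_ N) @[N --> \oo] --> \int[P]_x F x.
Proof.
move=> mf ig fg fF.
have mF : measurable_fun setT F.
  exact: (measurable_fun_cvg mf (fun x _ => fF x)).
pose G N := (EFin \o f_ N) \_ (cube N).
have GE N x : G N x = if x \in cube N then (f_ N x)%:E else 0%E by rewrite /G patchE.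
have mG N : measurable_fun setT (G N).
  apply/(measurable_restrictT _ (mc N)); apply: measurable_funTS.
  exact/measurable_EFinP.
have cG : {ae P, forall x, setT x -> G^~ x @ \oo --> (EFin \o F) x}.
  apply: aeW => /= y _.
  have h : (EFin \o f_^~ y) N @[N --> \oo] --> (F y)%:E.
    by apply: cvg_EFin; [exact: nearW|exact: fF].
  apply: cvg_trans h; apply: near_eq_cvg.
  by apply: filterS (cube_near y) => N hN; rewrite GE mem_set.
have dG : {ae P, forall x N, setT x -> (`|G N x| <= (EFin \o g) x)%E}.
  apply: aeW => /= y N _; rewrite GE; case: ifP => _ /=; first by rewrite lee_fin.
  by rewrite normr0 lee_fin (le_trans _ (fg N y)).
have mEF : measurable_fun setT (EFin \o F) by exact/measurable_EFinP.
have [iF _ cJ] := dominated_convergence measurableT mG mEF cG ig dG.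
have {}cJ : J P (cube N) (f_ N) @[N --> \oo] --> \int[P]_x F x.
  have FE : (\int[P]_x (EFin \o F) x = (\int[P]_x F x)%:E)%E.
    by rewrite /Rintegral fineK//; exact: integrable_fin_num.
  rewrite FE in cJ.
  have -> : (fun N => J P (cube N) (f_ N)) = fine \o [sequence \int[P]_x G N x]_N%E.
    by apply/funext => N /=; rewrite /J /Rintegral [in LHS]integral_mkcond.
  exact: fine_cvg cJ.
have c1 : J P (cube N) (fun=> 1) @[N --> \oo] --> (1 : R).
  have -> : (fun N => J P (cube N) (fun=> 1)) = fine \o (fun N => P (cube N)).
    by apply/funext => N /=; rewrite /J Rintegral_cst ?mul1r//; exact: mc.
  exact: fine_cvg (cvg_cube P).
rewrite -[X in _ --> X]divr1.
have -> : (fun N => Ex P (cube N) (fun=> 0) (f_ N)) =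
   (fun N => J P (cube N) (f_ N) / J P (cube N) (fun=> 1)).
  apply/funext => N; rewrite /Ex; congr (_ / _); apply: eq_J => x _; rewrite expR0//.
  exact: mul1r.
by apply: cvgM => //; apply: cvgV => //; exact: oner_neq0.
Qed.

End exhaustion.

(** * The small-ball estimate *)

(** At [u = 1] both sides vanish, and the derivative of their difference is
    [ln x + 1/x - 1 >= 0]. *)
Lemma ln_le_ratio (R : realType) (u : R) : 0 < u <= 1 -> (1 + u) * ln u <= 2 * (u - 1).
Proof.
move=> /andP[u0 u1].
pose g (x : R) := (1 + x) * ln x - 2 * (x - 1).
have dg (x : R) : 0 < x -> is_derive x 1 g (ln x + (1 + x) / x - 2).
  move=> x0.
  have d1 := is_derive1D (is_derive1C 1 x) (is_derive1I x).
  have d2 := is_derive1M d1 (is_derive1_ln x0).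
  have d3 := is_derive1Z 2 (is_derive1B (is_derive1I x) (is_derive1C 1 x)).
  by refine (is_derive_eq (is_derive1B d2 d3) _); rewrite /=; ring.
have cg : {within `[u, 1], continuous g}.
  apply: derivable_within_continuous => x; rewrite in_itv/= => /andP[ux _].
  by have [] := dg x (lt_le_trans u0 ux).
have dg' (x : R) : x \in `]u, 1[ -> is_derive x 1 g (ln x + (1 + x) / x - 2).
  by rewrite in_itv/= => /andP[ux _]; apply: dg; exact: lt_trans ux.
have [c] := MVT_segment u1 dg' cg.
rewrite in_itv/= => /andP[uc c1] E.
have c0 : 0 < c := lt_le_trans u0 uc.
have : 0 <= g 1 - g u.
  rewrite E mulr_ge0 ?subr_ge0//.
  have := le_ln1Dx (x := c^-1 - 1); rewrite (addrC 1) subrK lnV ?posrE// => h.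
  have {}h : - ln c <= c^-1 - 1.
    by apply: h; rewrite ltrBrDr addNr invr_gt0.
  have -> : (1 + c) / c = c^-1 + 1 by rewrite mulrDl mul1r divff// gt_eqF.
  lra.
by rewrite /g ln1 subrr !mulr0 subr0 subr_ge0 subr_le0.
Qed.

Lemma cvgr_sum (R : realType) (I : Type) (r : seq I) (u : I -> nat -> R) (l : I -> R) :
  (forall i, u i N @[N --> \oo] --> l i) ->
  \sum_(i <- r) u i N @[N --> \oo] --> \sum_(i <- r) l i.
Proof.
move=> ul; elim: r => [|i r ih].
  by under eq_fun do rewrite big_nil; rewrite big_nil; exact: cvg_cst.
by under eq_fun do rewrite big_cons; rewrite big_cons; exact: cvgD.
Qed.

Lemma measurable_dist2 (R : realType) n (c : 'cV[R]_n) :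
  measurable_fun [set: 'cV[R]_n] (fun x => inner (x - c) (x - c)).
Proof.
apply: measurable_sum => i.
have h : measurable_fun setT (fun x : 'cV[R]_n => (x - c) i ord0).
  by under eq_fun do rewrite mxE; apply: measurable_funD => //; exact: measurable_coord_cV.
exact: measurable_funM.
Qed.

Section limit.
Context (R : realType) (n : nat).
Variables (P : probability 'cV[R]_n R) (f : 'cV[R]_n -> R).
Hypotheses (dP : is_density P f) (cf : concave_ereal (fun x => lne (f x)%:E)).
Variable K : R.
Hypothesis K0 : 0 <= K.
Hypothesis hyp : forall (mu : probability 'cV[R]_n R) (M : 'M[R]_n),
      isotropic mu -> log_concave mu -> M^T = M ->
      ('V_mu[fun y : 'cV[R]_n => inner (M *m y) y]
         <= (K * \tr (M ^+ 2))%:E)%E.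

Let o (x : 'cV[R]_n) : R := 0.
Let mc N := @measurable_cube R n N.
Let coord (i : 'I_n) (x : 'cV[R]_n) : R := x i ord0.
Let mcoord i : measurable_fun setT (coord i). Proof. exact: measurable_coord_cV. Qed.

Let int2 i : P.-integrable setT (EFin \o (fun x => coord i x ^+ 2)).
Proof.
have [B [_ hB]] := second_moment_cube dP cf K0 hyp.
apply: (integrable_of_cubes (B := B)).
- exact: measurable_funX.
- by move=> x; exact: sqr_ge0.
- by move=> N; exact: (niceX 2 (@nice_coord_cube R n N i)).
- by apply: filterS hB => N [_ /(_ i)].
Qed.

Let int_dom (g h : 'cV[R]_n -> R) : measurable_fun setT g ->
  P.-integrable setT (EFin \o h) -> (forall x, `|g x| <= h x) ->
  P.-integrable setT (EFin \o g).
Proof.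
move=> mg ih gh; apply: (le_integrable measurableT _ _ ih).
  exact/measurable_EFinP.
by move=> x _ /=; rewrite lee_fin (le_trans (gh x))// ler_norm.
Qed.

Let int1c : P.-integrable setT (EFin \o (fun=> 1 : R)).
Proof. by apply: finite_measure_integrable_cst. Qed.

Let int1 i : P.-integrable setT (EFin \o (fun x => `|coord i x|)).
Proof.
apply: (@int_dom _ (fun x => 1 + coord i x ^+ 2)).
- exact: measurableT_comp.
- exact: (integrableD measurableT int1c (int2 i)).
- move=> x; rewrite normr_id -(real_normK (num_real _)).
  by move: `|_| => y; nra.
Qed.

Let int11 i j : P.-integrable setT (EFin \o (fun x => `|coord i x * coord j x|)).
Proof.
apply: (@int_dom _ (fun x => coord i x ^+ 2 + coord j x ^+ 2)).
- by apply: measurableT_comp => //; exact: measurable_funM.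
- exact: (integrableD measurableT (int2 i) (int2 j)).
- move=> x; rewrite normr_id normrM -(real_normK (num_real (coord i x))).
  rewrite -(real_normK (num_real (coord j x))).
  by move: `|_| `|_| => y z; nra.
Qed.

Let Lfun1 (g : 'cV[R]_n -> R) : measurable_fun setT g -> P.-integrable setT (EFin \o (fun x => `|g x|)) ->
  g \in Lfun P 1.
Proof. by move=> mg ig; apply/Lfun1_integrable; exact: (int_dom mg ig). Qed.

Let a := mean P.
Let S := Cov P.

Let aE i : a i ord0 = \int[P]_x coord i x.
Proof. by rewrite mxE unlock. Qed.

Let SE i j : S i j = \int[P]_x (coord i x * coord j x) - a i ord0 * a j ord0.
Proof.
have L1 k : coord k \in Lfun P 1 by exact: Lfun1 (mcoord k) (int1 k).
have L2 : (coord i \* coord j)%R \in Lfun P 1.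
  exact: Lfun1 (measurable_funM (mcoord i) (mcoord j)) (int11 i j).
rewrite mxE (covarianceE (L1 i) (L1 j) L2) -/(coord i) -/(coord j).
have E1 k := expectation_fin_num (L1 k).
rewrite fineB ?fineM ?fin_numM ?E1 ?(expectation_fin_num L2)//.
by rewrite !aE unlock.
Qed.

Let a_ N := mn P (cube N) id o.
Let A_ N := cv P (cube N) id o.

Let cvg_a i : a_ N i ord0 @[N --> \oo] --> a i ord0.
Proof.
rewrite aE; under eq_fun do rewrite mxE.
exact: (cvg_Ex_cube (fun=> mcoord i) (int1 i) (fun _ x => lexx _) (fun x => cvg_cst _)).
Qed.

Let cvg_A i j : A_ N i j @[N --> \oo] --> S i j.
Proof.
rewrite SE; under eq_fun do rewrite mxE.
rewrite /Cv; apply: cvgB.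
  exact: (cvg_Ex_cube (fun=> measurable_funM (mcoord i) (mcoord j)) (int11 i j)
    (fun _ x => lexx _) (fun x => cvg_cst _)).
have h k : Ex P (cube N) o (fun x => id x k ord0) @[N --> \oo] --> a k ord0.
  by have := @cvg_a k; under [in X in X -> _]eq_fun do rewrite mxE.
by apply: cvgM.
Qed.

Let cvg_trA : \tr (A_ N) @[N --> \oo] --> \tr S.
Proof. by apply: cvgr_sum => i; exact: cvg_A. Qed.

Let cvg_trAA : \tr (A_ N *m A_ N) @[N --> \oo] --> \tr (S *m S).
Proof.
rewrite mxtrace_mulE; under eq_fun do rewrite mxtrace_mulE.
apply: cvgr_sum => i; apply: cvgr_sum => j; apply: cvgM; exact: cvg_A.
Qed.

Let w s (c x : 'cV[R]_n) := expR (- (s * inner (x - c) (x - c))).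

Let subE (u v : 'cV[R]_n) i : (u - v) i ord0 = u i ord0 - v i ord0.
Proof. by rewrite !mxE. Qed.

Let cvg_w s : 0 <= s -> Ex P (cube N) o (w s (a_ N)) @[N --> \oo] --> \int[P]_x w s a x.
Proof.
move=> s0; have mw c : measurable_fun setT (w s c).
  apply: measurableT_comp => //; apply: measurableT_comp => //.
  by apply: measurable_funM => //; exact: measurable_dist2.
have w1 c x : `|w s c x| <= 1.
  by rewrite ger0_norm ?expR_ge0// -[leRHS]expR0 ler_expR oppr_le0 mulr_ge0// inner_ge0.
apply: (cvg_Ex_cube (fun N => mw (a_ N)) int1c (fun N x => w1 (a_ N) x)) => x.
apply: continuous_cvg; first exact: continuous_expR.
apply: cvgN; apply: cvgM; first exact: cvg_cst.
apply: cvgr_sum => i.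
have h : (x - a_ N) i ord0 @[N --> \oo] --> (x - a) i ord0.
  under eq_fun do rewrite subE; rewrite subE.
  by apply: cvgB; [exact: cvg_cst|exact: cvg_a].
exact: cvgM.
Qed.

(** Both sides of the bound on a cube converge when the cube grows: the means and
    covariances by dominated convergence, thanks to the finite second moments,
    and the Laplace transforms because their integrands, which depend on the
    cube through its mean, are at most [1]. *)
Lemma exp_moment_law (s k : R) : 0 < s -> 0 < k -> K < k ->
  0 < \tr S -> 0 < \tr (S *m S) ->
  \int[P]_x expR (- (s * inner (x - a) (x - a))) <=
  expR (- (\tr S ^+ 2 / (k * \tr (S *m S)) * ln (1 + k * s * (\tr (S *m S) / \tr S)))).
Proof.
move=> s0 k0 Kk m0 q0.
pose F m q : R := expR (- (m ^+ 2 / (k * q) * ln (1 + k * s * (q / m)))).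
have cF : F (\tr (A_ N)) (\tr (A_ N *m A_ N)) @[N --> \oo] --> F (\tr S) (\tr (S *m S)).
  apply: continuous_cvg; first exact: continuous_expR.
  apply: cvgN; apply: cvgM.
    apply: cvgM; first by rewrite expr2; under eq_fun do rewrite expr2; exact: cvgM.
    apply: cvgV; first by rewrite gt_eqF// mulr_gt0.
    by apply: cvgM => //; exact: cvg_cst.
  apply: continuous_cvg.
    apply: continuous_ln; rewrite ltr_pwDl// !mulr_ge0// ?ltW//.
    by rewrite invr_gt0.
  apply: cvgD; first exact: cvg_cst.
  apply: cvgM; first exact: cvg_cst.
  apply: cvgM => //; apply: cvgV => //.
  by rewrite gt_eqF.
apply: (ler_cvg_to (cvg_w (ltW s0)) cF).
have [B [_ hB]] := second_moment_cube dP cf K0 hyp.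
have hm := cvgr_gt _ cvg_trA _ m0.
have hq := cvgr_gt _ cvg_trAA _ q0.
have hP : \forall N \near \oo, (0 < P (@cube R n N))%E by apply: filterS hB => N [].
near=> N.
have PN : (0 < P (cube N))%E by near: N.
apply: (exp_moment_convex dP cf (mc N) PN (@convex_cube R n N) (@nice_coord_cube R n N) hyp s0 k0 Kk).
- by near: N; exact: hm.
- by near: N; exact: hq.
Unshelve. all: by end_near. Qed.

End limit.

(** This [s] is the optimal one in the Markov inequality; it makes
    [1 + k s q / m] equal to [1 / u]. *)
Lemma small_ball_exponent (R : realType) (k m q u s : R) :
  0 < k -> 0 < m -> 0 < q -> 0 < u < 1 ->
  s = m / (k * q) * (u^-1 - 1) ->
  s * (u * m) - m ^+ 2 / (k * q) * ln (1 + k * s * (q / m)) <=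
  - (m ^+ 2 / (k * q) * (1 - u + u * ln u)).
Proof.
move=> k0 m0 q0 /andP[u0 u1] sE.
have -> : 1 + k * s * (q / m) = u^-1.
  by rewrite sE; field; rewrite !gt_eqF.
have -> : s * (u * m) = m ^+ 2 / (k * q) * (1 - u).
  by rewrite sE; field; rewrite !gt_eqF.
rewrite lnV ?posrE// -mulrBr -mulrN; apply: ler_wpM2l.
  by rewrite divr_ge0 ?sqr_ge0// mulr_ge0 ?ltW.
have := @ln_le_ratio _ u; rewrite u0 ltW// => /(_ isT).
by move: (ln u) => l; lra.
Qed.

Lemma chernoff_ball (R : realType) n (P : probability 'cV[R]_n R) (a : 'cV[R]_n) (s r : R) :
  0 <= s -> 0 <= r ->
  measurable [set x | enorm (x - a) <= r] /\
  fine (P [set x | enorm (x - a) <= r]) <=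
  expR (s * r ^+ 2) * \int[P]_x expR (- (s * inner (x - a) (x - a))).
Proof.
move=> s0 r0; set S := [set x | _].
have SE : S = (fun x => inner (x - a) (x - a)) @^-1` `]-oo, r ^+ 2]%classic.
  have E v : (Num.sqrt v <= r) = (v <= r ^+ 2).
    by rewrite -{1}(ger0_norm r0) -sqrtr_sqr ler_sqrt ?sqr_ge0.
  by apply/seteqP; split=> x; rewrite /S/= in_itv/= /enorm E.
have mS : measurable S.
  by rewrite SE -[X in measurable X]setTI; apply: measurable_dist2.
split=> //.
pose w x := expR (- (s * inner (x - a) (x - a))).
have nw : nice setT w.
  split.
    apply: measurableT_comp => //; apply: measurableT_comp => //.
    by apply: measurable_funM => //; exact: measurable_dist2.
  exists 1 => x _.
  by rewrite ger0_norm ?expR_ge0// -[leRHS]expR0 ler_expR oppr_le0 mulr_ge0// inner_ge0.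
have nS : nice setT (\1_S : 'cV[R]_n -> R).
  split; first exact: measurable_indic.
  by exists 1 => x _; rewrite indicE; case: (_ \in _); rewrite ?normr1 ?normr0.
have := @le_J _ _ _ P setT measurableT _ _ nS (niceM (nice_cst setT (expR (s * r ^+ 2))) nw).
rewrite (JZ P measurableT _ nw) (J_indic P measurableT mS) setIT; apply.
move=> x _; rewrite indicE; case: (boolP (_ \in _)) => [/set_mem hx|_]; last first.
  by rewrite mulr_ge0 ?expR_ge0.
rewrite -expRD -[leLHS]expR0 ler_expR -mulrBr mulr_ge0// subr_ge0.
by move: hx; rewrite SE /= in_itv.
Qed.

Section law.
Context (R : realType) (n : nat).

Lemma Cov_trace_ge0 (P : probability 'cV[R]_n R) : 0 <= \tr (Cov P).
Proof. by apply: sumr_ge0 => i _; rewrite mxE; apply/fine_ge0/variance_ge0. Qed.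

Lemma Cov_sym (P : probability 'cV[R]_n R) : (Cov P)^T = Cov P.
Proof. by apply/matrixP => i j; rewrite !mxE covarianceC. Qed.

Lemma sym_trace_sq_ge0 (A : 'M[R]_n) : A^T = A -> 0 <= \tr (A *m A).
Proof.
move=> sA; rewrite mxtrace_mulE; apply: sumr_ge0 => i _; apply: sumr_ge0 => j _.
by rewrite -{2}sA mxE -expr2 sqr_ge0.
Qed.

End law.

(** The bound is closed under [k -> K]; comparing logarithms gives
    [X <= k (- ln p)], which is linear in [k]. *)
Lemma le_expR_limit (R : realType) (K p X : R) : 0 < K -> p <= 1 ->
  (forall k, K < k -> p <= expR (- (X / k))) -> p <= expR (- (X / K)).
Proof.
move=> K0 p1 h; have [p0|p0] := leP p 0; first by rewrite (le_trans p0)// expR_ge0.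
have L0 : 0 <= - ln p by rewrite oppr_ge0 ln_le0.
rewrite -ler_ln ?posrE ?expR_gt0// expRK lerNr ler_pdivrMr//.
apply/ler_addgt0Pr => e e0.
pose k := K + e / (- ln p + 1).
have d0 : 0 < - ln p + 1 by rewrite ltr_wpDl.
have Kk : K < k by rewrite ltrDl divr_gt0.
have k0 := lt_trans K0 Kk.
have := h _ Kk; rewrite -ler_ln ?posrE ?expR_gt0// expRK lerNr ler_pdivrMr// => /le_trans.
apply; rewrite /k mulrDr lerD2l mulrCA ler_piMr ?(ltW e0)//.
by rewrite ler_pdivrMr// mul1r lerDl.
Qed.

Theorem theorem5p1 (R : realType) (n : nat) (D : R) :
  (1 <= n)%N -> 0 < D ->
  (forall (mu : probability 'cV[R]_n R) (M : 'M[R]_n),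
      isotropic mu -> log_concave mu -> M^T = M ->
      ('V_mu[fun y : 'cV[R]_n => inner (M *m y) y]
         <= (2 * D * \tr (M ^+ 2))%:E)%E) ->
  forall nu : probability 'cV[R]_n R, log_concave nu ->
  forall eps : R, 0 < eps < 1 ->
  let Sigma := Cov nu in
  (nu [set z | (enorm (z - mean nu) <= eps * Num.sqrt (\tr Sigma))%R]
     <= (expR (- ((\tr Sigma) ^+ 2 / (2 * D * \tr (Sigma ^+ 2))
                  * (1 - eps ^+ 2 + eps ^+ 2 * ln (eps ^+ 2)))))%:E)%E.
Proof.
move=> _ D0 hyp nu [f dP cf] eps /andP[e0 e1]; cbv zeta; set Sigma := Cov nu.
set u := eps ^+ 2.
have u01 : 0 < u < 1 by rewrite exprn_gt0//= exprn_ilt1// ltW.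
have K0 : 0 < 2 * D by rewrite mulr_gt0.
have -> : \tr (Sigma ^+ 2) = \tr (Sigma *m Sigma) by [].
have m0 := Cov_trace_ge0 nu; have q0 := sym_trace_sq_ge0 (Cov_sym nu).
rewrite -/Sigma in m0 q0.
have r0 : 0 <= eps * Num.sqrt (\tr Sigma) by rewrite mulr_ge0 ?sqrtr_ge0 ?ltW.
have [mS _] := chernoff_ball nu (mean nu) (lexx 0) r0.
(* The degenerate case [Sigma = 0], in which the bound is [1]. *)
have [c0|c0] := eqVneq (\tr Sigma ^+ 2 / (2 * D * \tr (Sigma *m Sigma))) 0.
  by rewrite c0 mul0r oppr0 expR0 probability_le1.
have [{}m0 {}q0] : 0 < \tr Sigma /\ 0 < \tr (Sigma *m Sigma).
  by split; rewrite lt_neqAle ?m0 ?q0 andbT eq_sym; apply: contra c0 => /eqP ->;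
    rewrite ?mulr0 ?invr0 ?mulr0// expr0n mul0r.
rewrite -[leLHS]fineK; last exact: fin_num_measure.
rewrite lee_fin.
set p := fine _; set m := \tr Sigma in m0 r0 *; set q := \tr (Sigma *m Sigma) in q0 *.
have XE k : m ^+ 2 / (k * q) * (1 - u + u * ln u) = m ^+ 2 / q * (1 - u + u * ln u) / k.
  by rewrite invfM [k^-1 * _]mulrC !mulrA mulrAC.
rewrite XE; apply: le_expR_limit => // [|k Kk].
  by rewrite -lee_fin fineK ?probability_le1//; exact: fin_num_measure.
have k0 := lt_trans K0 Kk.
pose s := m / (k * q) * (u^-1 - 1).
have /andP[u0 u1] := u01.
have s0 : 0 < s.
  by rewrite mulr_gt0 ?divr_gt0 ?mulr_gt0// subr_gt0 invf_gt1.
have [_ h1] := chernoff_ball nu (mean nu) (ltW s0) r0.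
have h2 := exp_moment_law dP cf (ltW K0) hyp s0 k0 Kk m0 q0.
apply: (le_trans h1).
apply: (le_trans (ler_wpM2l (expR_ge0 _) h2)).
rewrite -expRD ler_expR -XE.
have -> : (eps * Num.sqrt m) ^+ 2 = u * m by rewrite exprMn sqr_sqrtr// ltW.
exact: small_ball_exponent k0 m0 q0 u01 erefl.
Qed.
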